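(* Let $n\geq 2$ and $\beta>n/2$, let $\omega(x)=1+|x|^2$ on $\mathbb{R}^n$, let $\mu_\beta$ be the generalised Cauchy probability measure on $\mathbb{R}^n$ with density proportional to $\omega^{-\beta}$, and let $Lf=\omega\Delta f-2(\beta-1)\langle x,df\rangle$ with spectral gap $\lambda_1(-L)$ in $L^2(\mu_\beta)$. Then $$\lambda_1(-L)=\begin{cases}(\beta-n/2)^2 & \text{if } n/2<\beta\leq n/2+2,\\ 4(\beta-n/2-1) & \text{if } n/2+2\leq\beta\leq n+1,\\ 2(\beta-1) & \text{if } n+1\leq\beta.\end{cases}$$
   Context: $d\mu_\beta=\frac{1}{Z_{n,\beta}}(1+|x|^2)^{-\beta}dx$ with $Z_{n,\beta}=\pi^{n/2}\,\Gamma(\beta-n/2)/\Gamma(\beta)$ (here $\Gamma$ is Euler's Gamma function). The operator $L$, defined on $\mathcal{C}_c^\infty(\mathbb{R}^n)$, is symmetric and essentially self-adjoint in $L^2(\mu_\beta)$; its self-adjoint extension, still denoted $L$, has domain $\mathcal{D}(L)\subset L^2(\mu_\beta)$. The spectral gap is $$\lambda_1(-L)=\inf\left\{\frac{\int_{\mathbb{R}^n}-f\,Lf\,d\mu_\beta}{\mathrm{Var}_{\mu_\beta}(f)}\ :\ f\in\mathcal{D}(L),\ \mathrm{Var}_{\mu_\beta}(f)\neq0\right\}.$$ Equivalently it is the largest constant $\lambda$ such that $\lambda\,\mathrm{Var}_{\mu_\beta}(f)\leq\int_{\mathbb{R}^n}|df|^2(1+|x|^2)\,d\mu_\beta$ for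 all such $f$. *)

(* Defs.v *)
From HB Require Import structures.
From mathcomp Require Import all_boot all_order all_algebra.
From mathcomp Require Import all_classical all_reals all_analysis.
From mathcomp Require Import measurable_realfun.

Set Implicit Arguments.
Unset Strict Implicit.
Unset Printing Implicit Defensive.

Import Order.TTheory GRing.Theory Num.Theory.
Import numFieldNormedType.Exports.

Local Open Scope classical_set_scope.
Local Open Scope ring_scope.

(* R^n is the type 'rV[R]_n of row vectors. Its sigma-algebra is the product
   one, generated by the n coordinate functions, exactly as for n.-tuple R. *)
Section measurable_rV.
Context {d : measure_display} {T : sigmaRingType d}.
Variable n : nat.

Let coord (i : 'I_n) (x : 'rV[T]_n) : T := x ord0 i.

Let rV_set0 : g_sigma_preimage coord set0.
Proof. exact: sigma_algebra0. Qed.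

Let rV_setC A : g_sigma_preimage coord A -> g_sigma_preimage coord (~` A).
Proof. exact: sigma_algebraC. Qed.

Let rV_bigcup (F : _^nat) : (forall i, g_sigma_preimage coord (F i)) ->
  g_sigma_preimage coord (\bigcup_i (F i)).
Proof. exact: sigma_algebra_bigcup. Qed.

HB.instance Definition _ := @isMeasurable.Build (measure_tuple_display d)
  ('rV[T]_n) (g_sigma_preimage coord) rV_set0 rV_setC rV_bigcup.

End measurable_rV.

Section measurable_rV_lemmas.
Context {d : measure_display} {T : measurableType d}.

Lemma measurable_coord n (i : 'I_n) :
  measurable_fun [set: 'rV[T]_n] (fun x : 'rV[T]_n => x ord0 i).
Proof.
move=> _ Y mY; rewrite setTI; apply: sub_sigma_algebra => /=.
rewrite -bigcup_seq/=; exists i => /=; first by rewrite mem_index_enum.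
by exists Y => //; rewrite setTI.
Qed.

Lemma measurable_fun_rVP d1 (T1 : measurableType d1) n (f : T1 -> 'rV[T]_n) :
  measurable_fun [set: T1] f <->
  forall i, measurable_fun [set: T1] (fun x => f x ord0 i).
Proof.
split=> [mf i|mf].
  exact: (measurableT_comp (measurable_coord i) mf).
move=> _ A mA; rewrite setTI.
apply: (mA (fun A => measurable (f @^-1` A))); split.
  split.
  - by rewrite preimage_set0.
  - by move=> B mB; rewrite setTD preimage_setC; exact: measurableC.
  - by move=> F mF; rewrite preimage_bigcup; exact: bigcup_measurable.
move=> B; rewrite -bigcup_seq/= => -[i _ [C mC <-]].
have := mf i measurableT _ mC.
by rewrite !setTI.
Qed.

Definition cons_rV n (p : T * 'rV[T]_n) : 'rV[T]_n.+1 :=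
  \row_i (if unlift ord0 i is Some j then p.2 ord0 j else p.1).

Definition uncons_rV n (x : 'rV[T]_n.+1) : T * 'rV[T]_n :=
  (x ord0 ord0, \row_j x ord0 (lift ord0 j)).

Lemma cons_rVK n : cancel (@cons_rV n) (@uncons_rV n).
Proof.
case=> a v; rewrite /uncons_rV mxE unlift_none; congr pair.
by apply/rowP => j; rewrite !mxE liftK.
Qed.

Lemma measurable_cons_rV n : measurable_fun setT (@cons_rV n).
Proof.
apply/measurable_fun_rVP => i; rewrite /cons_rV.
under eq_fun do rewrite mxE.
case: unliftP => [j _|_]; last exact: measurable_fst.
exact: (measurableT_comp (measurable_coord j) measurable_snd).
Qed.

Lemma measurable_uncons_rV n : measurable_fun setT (@uncons_rV n).
Proof.
apply: measurable_fun_pair => /=; first exact: measurable_coord.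
apply/measurable_fun_rVP => j; under eq_fun do rewrite mxE.
exact: measurable_coord.
Qed.

End measurable_rV_lemmas.

Section lebesgue_rV.
Context {R : realType}.
Local Open Scope ereal_scope.

Section step.
Variables (n : nat) (m : {sigma_finite_measure set 'rV[R]_n -> \bar R}).

Definition lebesgue_rV_step : set 'rV[R]_n.+1 -> \bar R :=
  pushforward (@lebesgue_measure R \x m) (@cons_rV _ R n).

Let step0 : lebesgue_rV_step set0 = 0.
Proof. by rewrite /lebesgue_rV_step /pushforward preimage_set0 measure0. Qed.

Let step_ge0 A : 0 <= lebesgue_rV_step A.
Proof. by rewrite /lebesgue_rV_step /pushforward measure_ge0. Qed.

Let step_sigma_additive : semi_sigma_additive lebesgue_rV_step.
Proof.
move=> F mF tF mUF; rewrite /lebesgue_rV_step /pushforward preimage_bigcup.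
have mpre A : measurable A -> measurable (@cons_rV _ R n @^-1` A).
  by move=> mA; rewrite -[X in measurable X]setTI; exact: measurable_cons_rV.
apply: measure_semi_sigma_additive.
- by move=> k; exact: mpre.
- apply/trivIsetP => /= i j _ _ ij; rewrite -preimage_setI.
  by move/trivIsetP : tF => /(_ _ _ _ _ ij) ->//; rewrite preimage_set0.
- by rewrite -preimage_bigcup; exact: mpre.
Qed.

HB.instance Definition _ := isMeasure.Build _ _ _ lebesgue_rV_step
  step0 step_ge0 step_sigma_additive.

Let step_sigma_finite : sigma_finite setT lebesgue_rV_step.
Proof.
have /sigma_finiteP[F [TF ndF Foo]] := sigma_finiteT (@lebesgue_measure R).
have /sigma_finiteP[G [TG ndG Goo]] := sigma_finiteT m.
exists (fun k => @uncons_rV _ R n @^-1` (F k `*` G k)).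
  rewrite -preimage_bigcup; apply/esym/seteqP; split=> // x _ /=.
  have [k _ Fk] : (\bigcup_k F k) (uncons_rV x).1 by rewrite -TF.
  have [l _ Gl] : (\bigcup_k G k) (uncons_rV x).2 by rewrite -TG.
  exists (maxn k l) => //; split.
  - by move: Fk; exact/subsetPset/ndF/leq_maxl.
  - by move: Gl; exact/subsetPset/ndG/leq_maxr.
move=> k; have [mFk Fk_fin] := Foo k; have [mGk Gk_fin] := Goo k.
have mFG : measurable (F k `*` G k) by exact: measurableX.
split; first by rewrite -[X in measurable X]setTI; exact: measurable_uncons_rV.
rewrite /lebesgue_rV_step /pushforward.
have -> : @cons_rV _ R n @^-1` (@uncons_rV _ R n @^-1` (F k `*` G k)) =
    F k `*` G k.
  rewrite -comp_preimage (_ : _ \o _ = id) ?preimage_id//.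
  by apply/funext => p; exact: cons_rVK.
by rewrite product_measure1E// lte_mul_pinfty// ge0_fin_numE.
Qed.

HB.instance Definition _ := Measure_isSigmaFinite.Build _ _ _ lebesgue_rV_step
  step_sigma_finite.

End step.

(* n-dimensional Lebesgue measure, as the n-fold product of the
   one-dimensional one. *)
Fixpoint lebesgue_rV (n : nat) :
    {sigma_finite_measure set 'rV[R]_n -> \bar R} :=
  match n with
  | 0 => \d_(0%R : 'rV[R]_0)
  | k.+1 => lebesgue_rV_step (lebesgue_rV k)
  end.

Lemma lebesgue_rV_box n (A : 'I_n -> set R) : (forall i, measurable (A i)) ->
  lebesgue_rV n [set x | forall i, A i (x ord0 i)] =
  \prod_(i < n) lebesgue_measure (A i).
Proof.
elim: n A => [|n IH] A mA.
  by rewrite big_ord0 /= diracE mem_set// => -[].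
have mB : measurable
    [set x : 'rV[R]_n | forall i, A (lift ord0 i) (x ord0 i)].
  have -> : [set x : 'rV[R]_n | forall i, A (lift ord0 i) (x ord0 i)] =
      \bigcap_(i in [set: 'I_n])
        ((fun x : 'rV[R]_n => x ord0 i) @^-1` A (lift ord0 i)).
    by apply/seteqP; split=> x /= xA i; [move=> _; exact: xA|exact: (xA i I)].
  apply: fin_bigcap_measurable => [|i _]; first exact: finite_finset.
  by rewrite -[X in measurable X]setTI; exact: measurable_coord.
rewrite big_ord_recl -(IH (fun i => A (lift ord0 i)))// -product_measure1E//; last exact: (mA ord0).
rewrite /= /lebesgue_rV_step /pushforward.
congr (_ _); apply/seteqP; split=> -[a v] /=.
  move=> vA; split=> [|i].
    by have := vA ord0; rewrite mxE unlift_none.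
  by have := vA (lift ord0 i); rewrite mxE liftK.
by move=> [aA vA] i; rewrite mxE; case: unliftP => [j ->|->].
Qed.

End lebesgue_rV.

Section cauchy_weight.
Context {R : realType} (n : nat) (beta : R).
Local Open Scope ereal_scope.

(* The norm `|x| of 'rV[R]_n is the sup norm: the squared Euclidean norm is
   written out as a sum. *)
Definition omega (x : 'rV[R]_n) : R := (1 + \sum_(i < n) x ord0 i ^+ 2)%R.

Lemma omega_gt0 x : (0 < omega x)%R.
Proof. by rewrite ltr_wpDr// sumr_ge0// => i _; exact: sqr_ge0. Qed.

Lemma measurable_omega : measurable_fun setT omega.
Proof.
apply: measurable_funD; first exact: measurable_cst; apply: measurable_sum => i.
by apply: measurable_funX; exact: measurable_coord.
Qed.

Definition cauchy_weight (A : set 'rV[R]_n) : \bar R :=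
  \int[lebesgue_rV n]_(x in A) (omega x `^ (- beta))%:E.

Let weight_ge0 A : 0 <= cauchy_weight A.
Proof. by apply: integral_ge0 => x _; rewrite lee_fin powR_ge0. Qed.

Let weight0 : cauchy_weight set0 = 0.
Proof. exact: integral_set0. Qed.

Let weight_sigma_additive : semi_sigma_additive cauchy_weight.
Proof.
move=> F mF tF mUF; rewrite /cauchy_weight ge0_integral_bigcup//=.
- by apply: is_cvg_ereal_nneg_natsum_cond => k _ _; exact: weight_ge0.
- apply: measurable_funTS; apply/measurable_EFinP.
  exact: (measurableT_comp (measurable_powR _) measurable_omega).
- by move=> x _; rewrite lee_fin powR_ge0.
Qed.

HB.instance Definition _ := isMeasure.Build _ _ _ cauchy_weight
  weight0 weight_ge0 weight_sigma_additive.

End cauchy_weight.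

(* The second argument of mnormalize is only used when the total mass is 0 or
   infinite, which does not happen for beta > n / 2. *)
Definition cauchy {R : realType} (n : nat) (beta : R) :
    probability 'rV[R]_n R :=
  mnormalize (@cauchy_weight R n beta) (\d_(0 : 'rV[R]_n)).

Section generator.
Context {R : realType} {n : nat}.
Implicit Types f g : 'rV[R]_n -> R.

Definition partial (i : 'I_n) f : 'rV[R]_n -> R :=
  fun x => 'D_(delta_mx ord0 i) f x.

(* C^infty: since every iterated partial derivative is Frechet differentiable,
   partial derivatives of all orders exist and are continuous. *)
Definition smooth f :=
  forall (s : seq 'I_n) (x : 'rV[R]_n), differentiable (foldr partial f s) x.

Definition test_function f :=
  smooth f /\ compact (closure [set x | f x != 0]).

Definition laplacian f : 'rV[R]_n -> R :=
  fun x => \sum_(i < n) partial i (partial i f) x.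

Definition diffusion (beta : R) f : 'rV[R]_n -> R :=
  fun x => omega x * laplacian f x -
    2 * (beta - 1) * \sum_(i < n) x ord0 i * partial i f x.

(* The graph of the self-adjoint extension of the diffusion operator. On test
   functions the operator is essentially self-adjoint in L^2(cauchy), that is,
   its self-adjoint extension is its closure: [diffusion_ext beta f g] says
   that f belongs to the domain and that its image is (the class of) g. *)
Definition diffusion_ext (beta : R) f g :=
  let mu := cauchy n beta in
  [/\ f \in Lfun mu 2%:E, g \in Lfun mu 2%:E &
    exists phi : nat -> 'rV[R]_n -> R,
    [/\ forall k, test_function (phi k),
        ('N[mu]_2%:E[EFin \o (phi k \- f)%R] @[k --> \oo] --> 0)%E &
        ('N[mu]_2%:E[EFin \o (diffusion beta (phi k) \- g)%R] @[k --> \oo]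
          --> 0)%E]].

Definition spectral_gap (beta : R) : \bar R :=
  let mu := cauchy n beta in
  ereal_inf [set r | exists f g, [/\ diffusion_ext beta f g,
    'V_mu[f] != 0%E & r = (\int[mu]_x (- f x * g x)%:E / 'V_mu[f])%E]].

End generator.
Arguments spectral_gap {R} n beta.

(* Main.v *)
Require Import Defs.
From mathcomp Require Import all_boot all_order all_algebra.
From mathcomp Require Import all_classical all_reals all_analysis.
From mathcomp Require Import measurable_realfun.
From mathcomp Require Import ring lra.

Set Implicit Arguments.
Unset Strict Implicit.
Unset Printing Implicit Defensive.

Import Order.TTheory GRing.Theory Num.Theory.
Import numFieldNormedType.Exports.

Local Open Scope classical_set_scope.
Local Open Scope ring_scope.

(** Write [omega] for 1 + |x|^2 and a = beta - n/2. Integrating by parts against the weight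
    [omega^(-beta)] turns the quadratic form of -L into the weighted energy of |df|^2 with weight
    [omega^(1 - beta)] ([dirichlet_form]), so the gap is the best constant in a weighted Poincaré
    inequality. The self-adjoint extension is the closure of L on test functions, so a lower bound
    has to be proved for test functions only ([spectral_gap_ge]).

    Lower bound for beta >= n/2 + 2 ([cauchy_poincare]). The identity Gamma(beta) omega^(-beta) =
    int s^(beta-1) e^(-s omega) ds presents the Cauchy measure as a mixture of centred Gaussians of
    parameter t, mixed by a Gamma law of parameter a ([gauss_mixture]). For f of mean zero the
    second moment splits into the average of the Gaussian variances and the second moment, under the
    Gamma law, of the Gaussian mean M(t). The first part is controlled by the Gaussian Poincaré
    inequality with constant 2t; after mixing, the factor 1/t becomes the weight [omega^(1 - beta)]
    and the constant 2(beta - 1). The second part is controlled by [gamma_poincare]: (a - 1) times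
    the variance of M is at most the Gamma mean of t^2 M'(t)^2. Finally t M'(t) is, up to a factor,
    the component of f along the radial second Hermite polynomial, whose Gaussian eigenvalue is 4t
    instead of 2t. This surplus in the Gaussian inequality ([gauss_poincare_improved]) pays for M',
    and the balance closes exactly when lam <= 4(a - 1) and lam <= 2(beta - 1). The one-dimensional
    Gaussian and Gamma inequalities are both instances of one Hardy-type inequality obtained by
    completing a square ([hardy2]).

    Lower bound for beta <= n/2 + 2 ([core_inequality_low]). At the exponent n/2 + 2 the constant is
    4. Applying that inequality to [omega^(1 - a/2)] (phi - c) and removing the divergence of the
    field omega^(-beta) (phi - c)^2 x, which integrates to 0, leaves the constant a^2 at exponent
    beta.

    Upper bounds. Rayleigh quotients of explicit trial functions give the matching values: a
    coordinate x_i for 2(beta - 1), [omega] for 4(a - 1), and [omega^g] with g increasing to a/2 for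
    a^2, which is approached without being attained by these functions. The trial functions are
    truncated by smooth cutoffs whose gradient is O(omega^(-1/2)) uniformly
    ([spectral_gap_le_trial]). *)

(** * Slicing the first coordinate off Lebesgue measure *)

Section product_structure.
Context {R : realType}.
Implicit Types n : nat.
Notation leb := (@lebesgue_measure R).
Local Open Scope ereal_scope.

(* The factor R carries here the Borel structure on which [lebesgue_measure]
   is declared, which is not syntactically the default one. *)
Lemma measurable_cons_rV_leb n :
  @measurable_fun _ _ (measurableTypeR R * 'rV[R]_n)%type 'rV[R]_n.+1 setT
    (@cons_rV _ R n).
Proof. exact: (@measurable_cons_rV _ R n). Qed.

Lemma ge0_integral_rVS n (f : 'rV[R]_n.+1 -> \bar R) :
  measurable_fun setT f -> (forall x, 0 <= f x) ->
  \int[lebesgue_rV n.+1]_x f x =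
  \int[leb \x lebesgue_rV n]_p f (cons_rV p).
Proof.
move=> mf f0.
exact: (ge0_integral_pushforward (@measurable_cons_rV_leb n)
  (leb \x lebesgue_rV n) measurableT mf (fun x _ => f0 x)).
Qed.

Lemma ge0_integral_cons n (f : 'rV[R]_n.+1 -> \bar R) :
  measurable_fun setT f -> (forall x, 0 <= f x) ->
  \int[lebesgue_rV n.+1]_x f x =
  \int[leb]_t \int[lebesgue_rV n]_v f (cons_rV (t, v)).
Proof.
move=> mf f0; rewrite ge0_integral_rVS// fubini_tonelli1//.
by apply: measurableT_comp => //; exact: measurable_cons_rV_leb.
Qed.

Lemma integrable_cons n (f : 'rV[R]_n.+1 -> \bar R) :
  (lebesgue_rV n.+1).-integrable setT f ->
  (leb \x lebesgue_rV n).-integrable setT (f \o (@cons_rV _ R n)).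
Proof.
move=> /integrableP[mf foo]; apply/integrableP; split.
  by apply: measurableT_comp => //; exact: measurable_cons_rV_leb.
by move: foo; rewrite ge0_integral_rVS//; exact: measurableT_comp.
Qed.

Lemma integral_rVS n (f : 'rV[R]_n.+1 -> \bar R) :
  (lebesgue_rV n.+1).-integrable setT f ->
  \int[lebesgue_rV n.+1]_x f x =
  \int[leb \x lebesgue_rV n]_p f (cons_rV p).
Proof.
move=> fi; have := integrable_cons fi; have /measurable_int mf := fi.
move=> fi'.
exact: (integral_pushforward (@measurable_cons_rV_leb n) mf fi' measurableT).
Qed.

Lemma integral_cons n (f : 'rV[R]_n.+1 -> \bar R) :
  (lebesgue_rV n.+1).-integrable setT f ->
  \int[lebesgue_rV n.+1]_x f x =
  \int[leb]_t \int[lebesgue_rV n]_v f (cons_rV (t, v)).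
Proof.
move=> fi; rewrite integral_rVS//.
by rewrite -integral12_prod_meas1//; exact: integrable_cons.
Qed.

Lemma integral_consC n (f : 'rV[R]_n.+1 -> \bar R) :
  (lebesgue_rV n.+1).-integrable setT f ->
  \int[lebesgue_rV n.+1]_x f x =
  \int[lebesgue_rV n]_v \int[leb]_t f (cons_rV (t, v)).
Proof.
move=> fi; rewrite integral_rVS//.
by rewrite -integral21_prod_meas1//; exact: integrable_cons.
Qed.

Lemma measurable_cons_rVl n (t : R) :
  measurable_fun setT (fun v : 'rV[R]_n => cons_rV (t, v)).
Proof.
apply: (measurableT_comp (@measurable_cons_rV _ R n)).
exact: measurable_fun_pair.
Qed.

Lemma measurable_cons_rVr n (v : 'rV[R]_n) :
  measurable_fun setT (fun t : R => cons_rV (t, v)).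
Proof.
apply: (measurableT_comp (@measurable_cons_rV _ R n)).
exact: measurable_fun_pair.
Qed.

End product_structure.

(** * Continuous functions on row vectors are measurable *)

Section measurable_rV_open.
Context {R : realType} (n : nat).
Local Open Scope ring_scope.

(** The sigma-algebra is generated by coordinates, so the point is countability: [U] is the union of
    the sup-norm cubes with rational centre and radius 1/(k+1) that it contains. A cube not
    contained in [U] is replaced by the empty set, so that the index type stays countable. *)
Lemma measurable_open_rV (U : set 'rV[R]_n) : open U -> measurable U.
Proof.
move=> oU.
pose F (p : 'rV[rat]_n * nat) : set 'rV[R]_n :=
  let B := [set x : 'rV[R]_n | forall i, `|x ord0 i - ratr (p.1 ord0 i)| < p.2.+1%:R^-1] in
  if `[< B `<=` U >] then B else set0.
have -> : U = \bigcup_p F p.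
  apply/seteqP; split=> [x Ux|x [p _]]; last first.
    by rewrite /F; case: ifPn => // /asboolP; exact.
  have /nbhs_ballP[e /= e0 eU] : nbhs x U by exact: open_nbhs_nbhs.
  have [N Ne] : exists N : nat, N.+1%:R^-1 < e / 2.
    have e2 : 0 < e / 2 by rewrite divr_gt0.
    have [N _ /(_ N)] := near_infty_natSinv_lt (PosNum e2).
    by move=> /(_ (leqnn _)) H; exists N; exact: H.
  have /choice[q qP] (i : 'I_n) : exists q : rat, `|x ord0 i - ratr q| < N.+1%:R^-1.
    have N0 : 0 < N.+1%:R^-1 :> R by rewrite invr_gt0.
    move: N.+1%:R^-1 N0 => d d0; have [|q] := @rat_in_itvoo R (x ord0 i - d) (x ord0 i + d).
      by lra.
    rewrite in_itv/= => /andP[q1 q2]; exists q.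
    by rewrite ltr_distl; apply/andP; split; lra.
  exists (\row_i q i, N) => //; rewrite /F; case: ifPn => [_ i|/asboolPn].
    by rewrite mxE.
  move=> []; move=> y /= yq; apply: eU; split=> // i j; rewrite (ord1 i).
  rewrite -ball_normE /= /ball_; apply: (@le_lt_trans _ _ (`|x ord0 j - ratr (q j)| +
    `|ratr (q j) - y ord0 j|)).
    by rewrite (le_trans _ (ler_normD _ _))// addrA subrK.
  rewrite (splitr e) ltrD//; first exact: lt_trans Ne.
  by rewrite distrC (lt_trans _ Ne)//; have := yq j; rewrite mxE.
apply: countable_bigcupT_measurable => [|p]; first exact: countableP.
rewrite /F; case: ifP => _ //.
have -> : [set x : 'rV[R]_n | forall i, `|x ord0 i - ratr (p.1 ord0 i)| < p.2.+1%:R^-1] =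
  \bigcap_(i in [set: 'I_n])
        ((fun x : 'rV[R]_n => x ord0 i) @^-1` (ball (ratr (p.1 ord0 i) : R) p.2.+1%:R^-1)).
  apply/seteqP; split=> x /= xA i; first by move=> _; rewrite /= -ball_normE /ball_/= distrC.
  by have := xA i I; rewrite /= -ball_normE /ball_/= distrC.
apply: fin_bigcap_measurable => [|i _]; first exact: finite_finset.
rewrite -[X in measurable X]setTI; apply: measurable_coord => //.
exact: measurable_ball.
Qed.

Lemma continuous_measurable_rV (f : 'rV[R]_n -> R) :
  continuous f -> measurable_fun setT f.
Proof.
move=> /continuousP cf; apply: (measurability _ (RGenOInfty.measurableE R)).
move=> _ [_ [a ->] <-]; rewrite setTI preimage_itvoy; apply: measurable_open_rV.
exact: (cf _ (@open_gt R a)).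
Qed.

End measurable_rV_open.

(** * The fundamental theorem of calculus along an exhaustion by segments *)

Section ftc_exhaustion.
Context {R : realType}.
Notation leb := (@lebesgue_measure R).
Variables (l r : nat -> R).
Hypothesis lr : forall k, l k < r k.
Hypothesis ndlr : forall k, `[l k, r k] `<=` `[l k.+1, r k.+1].
Let D := \bigcup_k `[l k, r k]%classic.

(** Integrate B + psi' <= A over each segment, enlarge the integral of A to all of D, and let the
    segments grow: the boundary terms vanish and the integral of B converges monotonically. The
    conclusion lives in the extended reals, so it also serves to prove finiteness. *)
Lemma ge0_integral_le_primitive (A B psi dpsi : R -> R) :
  (forall x, D x -> is_derive x 1 psi (dpsi x)) ->
  (forall x, D x -> {for x, continuous dpsi}) ->
  (forall x, D x -> {for x, continuous A}) ->
  (forall x, D x -> {for x, continuous B}) ->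
  (forall x, D x -> 0 <= A x) -> (forall x, D x -> 0 <= B x) ->
  (forall x, D x -> B x + dpsi x <= A x) ->
  psi (r k) - psi (l k) @[k --> \oo] --> 0 ->
  (\int[leb]_(x in D) (B x)%:E <= \int[leb]_(x in D) (A x)%:E)%E.
Proof.
move=> dP cdP cA cB A0 B0 AB psi0.
have inD k x : x \in `[l k, r k] -> D x by move=> xk; exists k.
have wc (f : R -> R) k : (forall x, D x -> {for x, continuous f}) ->
    {within `[l k, r k], continuous f}.
  by move=> cf; apply: continuous_in_subspaceT => x; rewrite inE => /inD; exact: cf.
have ii (f : R -> R) k : (forall x, D x -> {for x, continuous f}) ->
    leb.-integrable `[l k, r k] (EFin \o f).
  move=> cf; apply: continuous_compact_integrable; first exact: segment_compact.
  exact: wc.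
have mD (f : R -> R) : (forall x, D x -> {for x, continuous f}) ->
    measurable_fun D (EFin \o f).
  move=> cf; apply/measurable_fun_bigcup => // k.
  by have /measurable_int := ii f k cf.
have mf (f : R -> R) k : (forall x, D x -> {for x, continuous f}) ->
    measurable_fun `[l k, r k] (EFin \o f).
  by move=> /ii => /(_ k) /measurable_int.
have step k : (\int[leb]_(x in `[l k, r k]) (B x)%:E + (psi (r k) - psi (l k))%:E
    <= \int[leb]_(x in D) (A x)%:E)%E.
  apply: (@le_trans _ _ (\int[leb]_(x in `[l k, r k]) (A x)%:E)%E); last first.
    apply: ge0_subset_integral => //=.
    - exact: bigcup_measurable.
    - exact: mD.
    - by move=> x xk; exists k.
  have -> : (psi (r k) - psi (l k))%:E = (\int[leb]_(x in `[l k, r k]) (dpsi x)%:E)%E.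
    rewrite EFinB (@continuous_FTC2 _ dpsi psi)//.
    - exact: wc.
    - have dk x : x \in `[l k, r k] -> derivable psi x 1.
        by move=> xk; have [] := dP _ (inD _ _ xk).
      split.
      + by move=> x /subset_itv_oo_cc; exact: dk.
      + apply: cvg_at_right_filter; apply: differentiable_continuous.
        by apply/derivable1_diffP; apply: dk; rewrite bound_itvE ltW.
      + apply: cvg_at_left_filter; apply: differentiable_continuous.
        by apply/derivable1_diffP; apply: dk; rewrite bound_itvE ltW.
    - move=> x /subset_itv_oo_cc xk; rewrite derive1E.
      by have [] := dP _ (inD _ _ xk).
  rewrite -integralD//; [|exact: ii|exact: ii].
  apply: le_integral => //; first by apply: integrableD => //; exact: ii.
  - exact: ii.
  - by move=> x /set_mem/inD Dx; rewrite -EFinD lee_fin AB.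
have lim1 : (\int[leb]_(x in `[l k, r k]) (B x)%:E + (psi (r k) - psi (l k))%:E)%E @[k --> \oo]
    --> (\int[leb]_(x in D) (B x)%:E)%E.
  rewrite -[X in _ --> X]adde0; apply: cvgeD; first by rewrite fin_num_adde_defl.
    have H := @ge0_nondecreasing_set_cvg_integral _ (measurableTypeR R) R (fun k => `[l k, r k]%classic)
      (EFin \o B) leb.
    apply: H => //.
    - by apply/nondecreasing_seqP => k; apply/subsetPset; exact: ndlr.
    - by move=> k; exact: mf.
    - by move=> k x /inD Dx; rewrite lee_fin B0.
  by apply: cvg_EFin; [exact: nearW|].
by apply: (cvge_to_le lim1); exact: nearW.
Qed.

(** The positive and negative parts of [dpsi] differ by [dpsi], so the previous inequality applied
    to psi and to -psi shows that their integrals coincide. *)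
Lemma integral_primitive0 (psi dpsi : R -> R) :
  (forall x, D x -> is_derive x 1 psi (dpsi x)) ->
  (forall x, D x -> {for x, continuous dpsi}) ->
  leb.-integrable D (EFin \o dpsi) ->
  psi (r k) - psi (l k) @[k --> \oo] --> 0 ->
  (\int[leb]_(x in D) (dpsi x)%:E = 0)%E.
Proof.
move=> dP cdP intP psi0.
have e1 x : dpsi x = Num.max (dpsi x) 0 - Num.max (- dpsi x) 0.
  by rewrite /Num.max; case: ltgtP => h1; case: ltgtP => h2; lra.
have mx0 (a : R) : 0 <= Num.max a 0 by rewrite le_max lexx orbT.
have c0 (f : R -> R) x : {for x, continuous f} ->
    {for x, continuous (fun x => Num.max (f x) 0)}.
  by move=> cf; apply: continuous_max => //; exact: cst_continuous.
have cN x : D x -> {for x, continuous (fun x => - dpsi x)}.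
  by move=> /cdP; exact: continuousN.
have h1 : (\int[leb]_(x in D) (Num.max (- dpsi x) 0)%:E <=
    \int[leb]_(x in D) (Num.max (dpsi x) 0)%:E)%E.
  apply: (ge0_integral_le_primitive dP cdP) => //.
  - by move=> x /cdP /c0.
  - by move=> x /cN /c0.
  - by move=> x _; rewrite {2}[dpsi x]e1 addrC subrK.
have h2 : (\int[leb]_(x in D) (Num.max (dpsi x) 0)%:E <=
    \int[leb]_(x in D) (Num.max (- dpsi x) 0)%:E)%E.
  apply: (@ge0_integral_le_primitive _ _ (fun x => - psi x) (fun x => - dpsi x)) => //.
  - by move=> x /dP ?; exact: is_deriveN.
  - by move=> x /cN /c0.
  - by move=> x /cdP /c0.
  - by move=> x _; rewrite {2}[dpsi x]e1 opprB addrC subrK.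
  - rewrite -oppr0; under eq_fun do rewrite -opprD.
    exact: cvgN.
have mD : measurable D by exact: bigcup_measurable.
have h3 : (\int[leb]_(x in D) (Num.max (dpsi x) 0)%:E =
    \int[leb]_(x in D) (Num.max (- dpsi x) 0)%:E)%E.
  by apply/eqP; rewrite eq_le h1 h2.
rewrite integralE.
rewrite (_ : \int[leb]_(x in D) _ = \int[leb]_(x in D) (Num.max (dpsi x) 0)%:E)%E; last first.
  by apply: eq_integral => x _; rewrite funeposE -EFin_max.
rewrite (_ : integral _ _ (funeneg _) = \int[leb]_(x in D) (Num.max (- dpsi x) 0)%:E)%E; last first.
  by apply: eq_integral => x _; rewrite funenegE -EFinN -EFin_max.
rewrite h3 subee//; rewrite -h3.
have : (\int[leb]_(x in D) ((EFin \o dpsi)^\+ x))%E \is a fin_num.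
  exact: integrable_pos_fin_num.
congr (_ \is a fin_num).
by apply: eq_integral => x _; rewrite funeposE -EFin_max.
Qed.

End ftc_exhaustion.

(** * Derivatives along coordinate lines *)

Section lines.
Context {R : realType}.
Notation leb := (@lebesgue_measure R).
Notation e_ := (delta_mx ord0).

(** Regularity is asked only along lines parallel to one axis. This weak form restricts to slices of
    R^(n+1), which is what inductions on the dimension through Fubini use. *)
Definition C1_line n (i : 'I_n) (F dF : 'rV[R]_n -> R) := forall x (t : R),
  is_derive t 1 (fun s : R => F (x + s *: e_ i)) (dF (x + t *: e_ i)) /\
  {for t, continuous (fun s : R => dF (x + s *: e_ i))}.

Definition vanish_line n (i : 'I_n) (F : 'rV[R]_n -> R) := forall x,
  F (x + s *: e_ i) @[s --> +oo] --> 0 /\ F (x + s *: e_ i) @[s --> -oo] --> 0.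

Lemma cons_rV_line n (j : 'I_n) (t : R) (v : 'rV[R]_n) s :
  cons_rV (t, v + s *: e_ j) = cons_rV (t, v) + s *: e_ (lift ord0 j).
Proof.
apply/rowP => k; rewrite !mxE; case: unliftP => [k' ->|->] /=.
  by rewrite !mxE (inj_eq lift_inj).
by rewrite mulr0 addr0.
Qed.

Lemma cons_rV_line0 n (t : R) (v : 'rV[R]_n) :
  cons_rV (t, v) = @cons_rV _ R _ (0, v) + t *: e_ ord0.
Proof.
apply/rowP => k; rewrite !mxE; case: unliftP => [k' ->|->] /=.
  by rewrite mulr0 addr0.
by rewrite mulr1 add0r.
Qed.

Let cons_fun n (j : 'I_n) (F : 'rV[R]_n.+1 -> R) t v :
  (fun s : R => F (cons_rV (t, v + s *: e_ j))) =
  (fun s => F (cons_rV (t, v) + s *: e_ (lift ord0 j))).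
Proof. by apply/funext => s; rewrite cons_rV_line. Qed.

Let cons_fun0 n (F : 'rV[R]_n.+1 -> R) v :
  (fun s : R => F (cons_rV (s, v))) =
  (fun s => F (@cons_rV _ R _ (0, v) + s *: e_ ord0)).
Proof. by apply/funext => s; rewrite cons_rV_line0. Qed.

Lemma C1_line_slice n (j : 'I_n) F dF t : C1_line (lift ord0 j) F dF ->
  C1_line j (fun v => F (cons_rV (t, v))) (fun v => dF (cons_rV (t, v))).
Proof. by move=> dFP v s; rewrite !cons_fun cons_rV_line; exact: dFP. Qed.

Lemma C1_line_slice0 n F dF (v : 'rV[R]_n) : C1_line ord0 F dF -> forall t : R,
  is_derive t 1 (fun s : R => F (cons_rV (s, v))) (dF (cons_rV (t, v))) /\
  {for t, continuous (fun s : R => dF (cons_rV (s, v)))}.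
Proof. by move=> dFP t; rewrite !cons_fun0 cons_rV_line0; exact: dFP. Qed.

Lemma vanish_line_slice n (j : 'I_n) F t : vanish_line (lift ord0 j) F ->
  vanish_line j (fun v => F (cons_rV (t, v))).
Proof. by move=> FP v; rewrite !cons_fun; exact: FP. Qed.

Lemma vanish_line_slice0 n F (v : 'rV[R]_n) : vanish_line ord0 F ->
  F (cons_rV (s, v)) @[s --> +oo] --> 0 /\ F (cons_rV (s, v)) @[s --> -oo] --> 0.
Proof. by move=> FP; rewrite !cons_fun0; exact: FP. Qed.

Lemma bigcup_segment_NT :
  \bigcup_k `[(- k.+1%:R)%R, k.+1%:R]%classic = [set: R].
Proof.
apply/seteqP; split=> // x _; exists (Num.truncn `|x|) => //=.
by rewrite in_itv/= -ler_norml ltW// truncnS_gt.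
Qed.

Lemma segment_NT_nd k : `[(- k.+1%:R)%R, k.+1%:R : R] `<=` `[- k.+2%:R, k.+2%:R].
Proof.
move=> x /=; rewrite !in_itv/= -!ler_norml => /le_trans; apply.
by rewrite ler_nat.
Qed.

Lemma cvg_natSr_pinfty : (k.+1%:R : R) @[k --> \oo] --> +oo.
Proof.
apply/cvgryPge => A; exists (Num.truncn A) => // k /= Ak.
by rewrite (le_trans (ltW (truncnS_gt A)))// ler_nat ltnS.
Qed.

Lemma integral_derive0 (psi dpsi : R -> R) :
  (forall t : R, is_derive t 1 psi (dpsi t)) -> continuous dpsi ->
  leb.-integrable setT (EFin \o dpsi) ->
  psi s @[s --> +oo] --> 0 -> psi s @[s --> -oo] --> 0 ->
  (\int[leb]_x (dpsi x)%:E = 0)%E.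
Proof.
move=> dP cP iP py pNy.
rewrite -[X in integral _ X _]bigcup_segment_NT.
apply: (@integral_primitive0 _ (fun k => - k.+1%:R) (fun k => k.+1%:R) _ _ psi dpsi) => //.
- by move=> k; rewrite gtrN.
- by move=> k; exact: segment_NT_nd.
- by move=> x _; exact: cP.
- by rewrite bigcup_segment_NT.
- rewrite -[X in _ --> X]subr0; apply: cvgB.
  + exact: (cvg_comp _ _ cvg_natSr_pinfty py).
  + apply: (cvg_comp (fun k => - k.+1%:R) psi _ pNy).
    by apply/cvgNrNy; exact: cvg_natSr_pinfty.
Qed.

(** Induction on n by Fubini. If i is not the first coordinate, almost every slice at fixed t falls
    under the induction hypothesis; if it is, the inner integral over t is zero by the
    one-dimensional case. *)
Lemma integral_line0 n (i : 'I_n) (G dG : 'rV[R]_n -> R) :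
  C1_line i G dG -> vanish_line i G ->
  (lebesgue_rV n).-integrable setT (EFin \o dG) ->
  (\int[lebesgue_rV n]_x (dG x)%:E = 0)%E.
Proof.
elim: n i G dG => [[]//|n IH] i G dG dGP G0 dGi.
case: (unliftP ord0 i) dGP G0 => [j|] -> dGP G0.
- rewrite (integral_cons dGi) -[RHS](integral0 leb setT).
  apply: ae_eq_integral => //.
  + exact: measurable_fubini_F (integrable_cons dGi).
  + apply: filterS (ae_integrable1 (integrable_cons dGi)) => t ti _.
    by apply: IH ti; [exact: C1_line_slice|exact: vanish_line_slice].
- rewrite (integral_consC dGi) -[RHS](integral0 (lebesgue_rV n) setT).
  apply: ae_eq_integral => //.
  + exact: measurable_fubini_G (integrable_cons dGi).
  + apply: filterS (ae_integrable2 (integrable_cons dGi)) => v vi _.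
    have := C1_line_slice0 v dGP => dGv.
    have [py pNy] := vanish_line_slice0 v G0.
    apply: (@integral_derive0 (fun t => G (cons_rV (t, v)))) => // t.
    * by have [] := dGv t.
    * by have [] := dGv t.
Qed.

End lines.

(** * Calculus rules in one real variable *)

Section derivative_rules.
Context {R : realType}.
Implicit Types (f g : R -> R) (x a b : R).

Lemma der_eq f x a b : is_derive x (1 : R) f a -> a = b -> is_derive x (1 : R) f b.
Proof. by move=> fa <-. Qed.

Lemma der_id x : is_derive x (1 : R) (fun y : R => y) (1 : R).
Proof. exact: is_derive_id. Qed.

Lemma der_cst (c x : R) : is_derive x (1 : R) (fun=> c) (0 : R).
Proof. exact: is_derive_cst. Qed.

Lemma derD f g x a b : is_derive x (1 : R) f a -> is_derive x (1 : R) g b ->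
  is_derive x (1 : R) (fun y => f y + g y) (a + b).
Proof. exact: is_deriveD. Qed.

Lemma derN f x a : is_derive x (1 : R) f a ->
  is_derive x (1 : R) (fun y => - f y) (- a).
Proof. exact: is_deriveN. Qed.

Lemma derB f g x a b : is_derive x (1 : R) f a -> is_derive x (1 : R) g b ->
  is_derive x (1 : R) (fun y => f y - g y) (a - b).
Proof. exact: is_deriveB. Qed.

Lemma derM f g x a b : is_derive x (1 : R) f a -> is_derive x (1 : R) g b ->
  is_derive x (1 : R) (fun y => f y * g y) (a * g x + f x * b).
Proof.
move=> fa gb; have H := is_deriveM fa gb.
apply: (der_eq H).
by rewrite addrC mulrC.
Qed.

Lemma derV f x a : f x != 0 -> is_derive x (1 : R) f a ->
  is_derive x (1 : R) (fun y => (f y)^-1) (- a / f x ^+ 2).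
Proof.
move=> fx fa; have H := is_deriveV fx fa; apply: (der_eq H).
by rewrite /GRing.scale/= !mulNr mulrC.
Qed.

Lemma derX f n x a : is_derive x (1 : R) f a ->
  is_derive x (1 : R) (fun y => f y ^+ n) (n%:R * f x ^+ n.-1 * a).
Proof. move=> fa; elim: n => [|n IH].
  by rewrite !mul0r; exact: der_cst.
have -> : (fun y => f y ^+ n.+1) = (fun y => f y * f y ^+ n).
  by apply/funext => y; rewrite exprS.
apply: (der_eq (derM fa IH)); case: n {IH} => [|n] /=.
  by rewrite expr0; ring.
by rewrite exprS -[n.+2]addn1 natrD; ring. Qed.

Lemma der_comp f g x a b :
  is_derive (g x) (1 : R) f a -> is_derive x (1 : R) g b ->
  is_derive x (1 : R) (fun y => f (g y)) (a * b).
Proof. exact: is_derive1_comp. Qed.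

Lemma der_continuous f x a : is_derive x (1 : R) f a -> {for x, continuous f}.
Proof.
by move=> [df _]; apply: differentiable_continuous; exact/derivable1_diffP.
Qed.

Lemma contD f g x : {for x, continuous f} -> {for x, continuous g} ->
  {for x, continuous (fun y => f y + g y)}.
Proof. exact: continuousD. Qed.

Lemma contB f g x : {for x, continuous f} -> {for x, continuous g} ->
  {for x, continuous (fun y => f y - g y)}.
Proof. exact: continuousB. Qed.

Lemma contM f g x : {for x, continuous f} -> {for x, continuous g} ->
  {for x, continuous (fun y => f y * g y)}.
Proof. exact: continuousM. Qed.

Lemma contX f n x : {for x, continuous f} ->
  {for x, continuous (fun y => f y ^+ n)}.
Proof.
move=> cf; elim: n => [|n IH]; first exact: cst_continuous.
have -> : (fun y => f y ^+ n.+1) = (fun y => f y * f y ^+ n).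
  by apply/funext => y; rewrite exprS.
exact: contM.
Qed.

Lemma contV f x : f x != 0 -> {for x, continuous f} ->
  {for x, continuous (fun y => (f y)^-1)}.
Proof. exact: continuousV. Qed.

Lemma cont_cst c x : {for x, continuous (fun=> c : R)}.
Proof. exact: cst_continuous. Qed.

End derivative_rules.

(** * A weighted Hardy inequality away from a point *)

Section hardy.
Context {R : realType}.
Notation leb := (@lebesgue_measure R).
Variables (l r : nat -> R).
Hypothesis lr : forall k, l k < r k.
Hypothesis ndlr : forall k, `[l k, r k] `<=` `[l k.+1, r k.+1].
Let D := \bigcup_k `[l k, r k]%classic.

(* Completing a square: [E N^2 / (x - z)] is a primitive of the difference of
   the two sides up to a perfect square. *)
Lemma hardy (z kappa : R) (e w E dE N dN : R -> R) :
  0 <= kappa -> (forall x, D x -> x != z) ->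
  (forall x, D x -> is_derive x 1 N (dN x)) ->
  (forall x, D x -> is_derive x 1 E (dE x)) ->
  (forall x, D x -> {for x, continuous dN}) ->
  (forall x, D x -> {for x, continuous dE}) ->
  (forall x, D x -> {for x, continuous e}) ->
  (forall x, D x -> {for x, continuous w}) ->
  (forall x, D x -> 0 <= e x) -> (forall x, D x -> 0 <= w x) ->
  (forall x a b, D x -> kappa * w x * b ^+ 2 +
    (2 * E x * a * b / (x - z) + dE x * b ^+ 2 / (x - z) -
     E x * b ^+ 2 / (x - z) ^+ 2) <= e x * a ^+ 2) ->
  let psi x := E x * N x ^+ 2 / (x - z) in
  psi (r k) @[k --> \oo] --> 0 -> psi (l k) @[k --> \oo] --> 0 ->
  (\int[leb]_(x in D) (kappa * w x * N x ^+ 2)%:E <=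
   \int[leb]_(x in D) (e x * dN x ^+ 2)%:E)%E.
Proof.
move=> k0 Dz dNP dEP cdN cdE ce cw e0 w0 quad psi psir psil.
have cN x : D x -> {for x, continuous N} by move=> /dNP /der_continuous.
have cE x : D x -> {for x, continuous E} by move=> /dEP /der_continuous.
have cV x : D x -> {for x, continuous (fun y => (y - z)^-1)}.
  move=> Dx; apply: continuousV; first by rewrite subr_eq0 Dz.
  by apply: continuousB; [exact: cvg_id|exact: cst_continuous].
pose dpsi x := 2 * E x * dN x * N x / (x - z) + dE x * N x ^+ 2 / (x - z) -
     E x * N x ^+ 2 / (x - z) ^+ 2.
apply: (ge0_integral_le_primitive lr ndlr (psi := psi) (dpsi := dpsi)).
- move=> x Dx.
  have xz : x - z != 0 by rewrite subr_eq0 Dz.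
  have h1 := dNP x Dx; have h2 := dEP x Dx.
  have h3 := derV (f := fun y => y - z) xz (derB (der_id x) (der_cst z x)).
  apply: (der_eq (derM (derM h2 (derX 2 h1)) h3)).
  by rewrite /dpsi /=; field.
- move=> x Dx; rewrite /dpsi.
  have cEx := cE x Dx; have cNx := cN x Dx; have cVx := cV x Dx.
  have cdEx := cdE x Dx; have cdNx := cdN x Dx.
  apply: contB; last first.
    have -> : (fun y => E y * N y ^+ 2 / (y - z) ^+ 2) =
        (fun y => E y * N y ^+ 2 * ((y - z)^-1) ^+ 2).
      by apply/funext => y; rewrite exprVn.
    by apply: contM; [apply: contM => //; exact: contX|exact: contX].
  apply: contD; apply: contM => //; apply: contM => //; last exact: contX.
  by apply: contM => //; apply: contM => //; exact: cont_cst.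
- by move=> x Dx; apply: contM; [exact: ce|apply: contX; exact: cdN].
- move=> x Dx; apply: contM; [apply: contM; [exact: cont_cst|exact: cw]|].
  by apply: contX; exact: cN.
- by move=> x Dx; rewrite mulr_ge0// ?sqr_ge0 ?e0.
- by move=> x Dx; rewrite mulr_ge0// ?sqr_ge0// mulr_ge0 ?w0.
- by move=> x Dx; exact: quad.
- by rewrite -[X in _ --> X]subr0; exact: cvgB.
Qed.

End hardy.

(** * Functions of polynomial growth *)

Section polynomial_growth.
Context d (T : measurableType d) (R : realType) (om : T -> R).

(** The class of integrands for Gaussian expectations: stable under sums and products, and
    integrable against every weight for which all powers of [om] are. *)
Definition pgrowth (F : T -> R) := measurable_fun setT F /\
  exists C k, forall x, `|F x| <= C * om x ^+ k.

Hypotheses (mom : measurable_fun setT om) (om1 : forall x, 1 <= om x).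

Let om0 x : 0 <= om x. Proof. exact: le_trans (om1 x). Qed.

Lemma pgrowth_ub F : pgrowth F ->
  exists2 C, 0 <= C & exists k, forall x, `|F x| <= C * om x ^+ k.
Proof.
move=> [_ [C [k Fk]]]; exists `|C|; first exact: normr_ge0.
exists k => x; apply: le_trans (Fk x) _.
by rewrite ler_wpM2r ?exprn_ge0// ler_norm.
Qed.

Lemma pgrowth_cst c : pgrowth (cst c).
Proof.
split; first exact: measurable_cst.
by exists `|c|, 0%N => x; rewrite expr0 mulr1.
Qed.

Lemma pgrowthM F G : pgrowth F -> pgrowth G -> pgrowth (fun x => F x * G x).
Proof.
move=> Fp Gp; split; first exact: measurable_funM Fp.1 Gp.1.
have [C C0 [k Fk]] := pgrowth_ub Fp; have [C' C'0 [k' Gk]] := pgrowth_ub Gp.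
exists (C * C'), (k + k')%N => x; rewrite normrM exprD mulrACA.
by apply: ler_pM.
Qed.

Lemma pgrowthD F G : pgrowth F -> pgrowth G -> pgrowth (fun x => F x + G x).
Proof.
move=> Fp Gp; split; first exact: measurable_funD Fp.1 Gp.1.
have [C C0 [k Fk]] := pgrowth_ub Fp; have [C' C'0 [k' Gk]] := pgrowth_ub Gp.
exists (C + C'), (maxn k k') => x; rewrite (le_trans (ler_normD _ _))// mulrDl.
apply: lerD; [apply: le_trans (Fk x) _|apply: le_trans (Gk x) _];
  by rewrite ler_wpM2l// ler_weXn2l// ?leq_maxl ?leq_maxr.
Qed.

Lemma pgrowthZ c F : pgrowth F -> pgrowth (fun x => c * F x).
Proof. by move=> Fp; apply: pgrowthM => //; exact: pgrowth_cst. Qed.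

Lemma pgrowthB F G : pgrowth F -> pgrowth G -> pgrowth (fun x => F x - G x).
Proof.
move=> Fp Gp; have := pgrowthD Fp (pgrowthZ (-1) Gp).
by congr (pgrowth _); apply/funext => x; rewrite mulN1r.
Qed.

Lemma pgrowthX F k : pgrowth F -> pgrowth (fun x => F x ^+ k).
Proof.
move=> Fp; elim: k => [|k IH]; first exact: pgrowth_cst.
have := pgrowthM Fp IH; congr (pgrowth _).
by apply/funext => x; rewrite exprS.
Qed.

Lemma pgrowth_sum (I : Type) (s : seq I) (F : I -> T -> R) :
  (forall i, pgrowth (F i)) -> pgrowth (fun x => \sum_(i <- s) F i x).
Proof.
move=> Fp; elim: s => [|i s IH].
  have := pgrowth_cst 0; congr (pgrowth _).
  by apply/funext => x; rewrite big_nil.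
have := pgrowthD (Fp i) IH; congr (pgrowth _).
by apply/funext => x; rewrite big_cons.
Qed.

Lemma pgrowth_om : pgrowth om.
Proof.
split=> //; exists 1, 1%N => x; rewrite mul1r expr1 ger0_norm//; exact: om0.
Qed.

Lemma pgrowth_le (F G : T -> R) : measurable_fun setT F -> pgrowth G ->
  (forall x, `|F x| <= `|G x|) -> pgrowth F.
Proof.
move=> mF [_ [C [k Gk]]] FG; split=> //; exists C, k => x.
exact: le_trans (FG x) (Gk x).
Qed.

End polynomial_growth.

(** * Expectations under a weight with all moments *)

Section weighted_expectation.
Context d (T : measurableType d) (R : realType) (m : {measure set T -> \bar R}).

Definition moment_weight (w om : T -> R) :=
  [/\ [/\ measurable_fun setT w, measurable_fun setT om,
          forall x, 0 <= w x & forall x, 1 <= om x],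
      (\int[m]_x w x)%R = 1 &
      forall k, m.-integrable setT (fun x => (om x ^+ k * w x)%:E)].

Definition wE (w : T -> R) (F : T -> R) := (\int[m]_x (F x * w x))%R.

Variables (w om : T -> R).
Hypothesis mw : moment_weight w om.
Notation pg := (pgrowth om).
Notation E := (wE w).

Lemma pg_integrable F : pg F -> m.-integrable setT (fun x => (F x * w x)%:E).
Proof.
have [[mew mom w0 om1] _ ik] := mw.
move=> Fp; have [C C0 [k Fk]] := pgrowth_ub om1 Fp.
have := integrableZl measurableT C (ik k).
apply: le_integrable => //.
  by apply/measurable_EFinP; apply: measurable_funM => //; exact: Fp.1.
move=> x _; rewrite -EFinM !abse_EFin lee_fin.
rewrite [leLHS]normrM [X in _ * X]ger0_norm // mulrA.
rewrite [leRHS]ger0_norm ?mulr_ge0// ?exprn_ge0// ?(le_trans _ (om1 x))//.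
by rewrite ler_wpM2r.
Qed.

Lemma wE_cst c : E (cst c) = c.
Proof.
have [[mew mom w0 om1] i1 ik] := mw.
rewrite /wE/= RintegralZl ?i1 ?mulr1//.
have := ik 0%N; congr (_.-integrable _ _).
by apply/funext => x; rewrite /= expr0 mul1r.
Qed.

Lemma wED F G : pg F -> pg G -> E (fun x => F x + G x) = E F + E G.
Proof.
move=> Fp Gp; rewrite /wE -RintegralD//; [|exact: pg_integrable..].
by apply: eq_Rintegral => x _; rewrite mulrDl.
Qed.

Lemma wEB F G : pg F -> pg G -> E (fun x => F x - G x) = E F - E G.
Proof.
move=> Fp Gp; rewrite /wE -RintegralB//; [|exact: pg_integrable..].
by apply: eq_Rintegral => x _; rewrite mulrBl.
Qed.

Lemma wEZ c F : pg F -> E (fun x => c * F x) = c * E F.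
Proof.
move=> Fp; rewrite /wE -RintegralZl//; last exact: pg_integrable.
by apply: eq_Rintegral => x _; rewrite mulrA.
Qed.

Lemma wE_ge0 F : (forall x, 0 <= F x) -> 0 <= E F.
Proof.
have [[mew mom w0 om1] i1 ik] := mw.
by move=> F0; apply: Rintegral_ge0 => x _; rewrite mulr_ge0.
Qed.

Lemma wE_le F G : pg F -> pg G -> (forall x, F x <= G x) -> E F <= E G.
Proof.
have [[mew mom w0 om1] i1 ik] := mw.
move=> Fp Gp FG; apply: le_Rintegral => //; [exact: pg_integrable..|].
by move=> x _; rewrite ler_wpM2r.
Qed.

Lemma wE_sum (I : Type) (s : seq I) (F : I -> T -> R) : (forall i, pg (F i)) ->
  E (fun x => \sum_(i <- s) F i x) = \sum_(i <- s) E (F i).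
Proof.
have [[mew mom w0 om1] i1 ik] := mw.
move=> Fp; elim: s => [|i s IH].
  by rewrite big_nil -[RHS](wE_cst 0); congr wE; apply/funext => x; rewrite big_nil.
rewrite big_cons -IH -wED//; last exact: pgrowth_sum.
by congr wE; apply/funext => x; rewrite big_cons.
Qed.

Lemma wE_sqrB F c : pg F ->
  E (fun x => (F x - c) ^+ 2) = E (fun x => F x ^+ 2) - 2 * c * E F + c ^+ 2.
Proof.
have [[mew mom w0 om1] i1 ik] := mw.
move=> Fp.
have -> : (fun x => (F x - c) ^+ 2) =
    (fun x => (F x ^+ 2 - 2 * c * F x) + cst (c ^+ 2) x).
  by apply/funext => x /=; ring.
rewrite wED ?wE_cst ?wEB ?wEZ//; first exact: pgrowthX.
- exact: pgrowthZ.
- by apply: pgrowthB => //; [exact: pgrowthX|exact: pgrowthZ].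
- exact: pgrowth_cst.
Qed.

Lemma wE_var_ge0 F : pg F -> E F ^+ 2 <= E (fun x => F x ^+ 2).
Proof.
move=> Fp; have := wE_ge0 (fun x => sqr_ge0 (F x - E F)).
rewrite wE_sqrB// -subr_ge0; congr (0 <= _); ring.
Qed.

End weighted_expectation.

(** * Gaussian weights *)

Section gaussian.
Context {R : realType}.
Notation leb := (@lebesgue_measure R).
Implicit Types (tau : R) (n : nat).

Lemma exprn_le_expR (x : R) k : 0 <= x -> x ^+ k <= k`!%:R * expR x.
Proof.
move=> x0; case: k => [|k].
  by rewrite expr0 fact0 mul1r (le_trans _ (expR_ge1Dx x))// lerDl.
rewrite -ler_pdivrMl ?ltr0n ?fact_gt0// mulrC.
by apply: le_trans (expR_ge1Dxn k x0); rewrite lerDr.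
Qed.

(** Half of the exponent absorbs the polynomial factor: (tau y / 2)^k <= k! e^(tau y / 2). *)
Lemma exprn_expRN_le tau k : 0 < tau -> exists2 K, 0 <= K & forall y : R, 1 <= y ->
  y ^+ k * expR (tau * (1 - y)) <= K * expR (tau / 2 * (1 - y)).
Proof.
move=> t0; exists (k`!%:R * (2 / tau) ^+ k * expR (tau / 2)).
  by rewrite !mulr_ge0 ?expR_ge0 ?exprn_ge0 ?divr_ge0// ltW.
move=> y y1; have y0 : 0 <= tau / 2 * y by rewrite !mulr_ge0 ?(ltW t0)// (le_trans _ y1).
have := exprn_le_expR k y0.
have -> : tau * (1 - y) = tau / 2 * (1 - y) + (tau / 2 - tau / 2 * y) by field.
rewrite !expRD !expRN exprMn => H.
have E0 := expR_gt0 (tau / 2 * y).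
rewrite [leRHS](_ : _ = expR (tau / 2 * (1 - y)) * expR (tau / 2) *
   ((2 / tau) ^+ k * (k`!%:R * expR (tau / 2 * y))) / expR (tau / 2 * y)); last first.
  by field; rewrite !gt_eqF.
rewrite [leLHS](_ : _ = expR (tau / 2 * (1 - y)) * expR (tau / 2) *
  ((2 / tau) ^+ k * ((tau / 2) ^+ k * y ^+ k)) / expR (tau / 2 * y)); last first.
  rewrite (mulrA ((2 / tau) ^+ k)) -exprMn (_ : 2 / tau * (tau / 2) = 1) ?expr1n.
    by field; rewrite gt_eqF.
  by field; rewrite gt_eqF.
rewrite ler_pM2r ?invr_gt0// ler_wpM2l ?mulr_ge0 ?expR_ge0//.
by rewrite ler_wpM2l// exprn_ge0// divr_ge0// ltW.
Qed.

(** All moments for parameter tau are dominated by the weight of parameter tau/2, whose total mass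
    is already known to be 1. *)
Lemma gauss_moment_weight d (T : measurableType d) (m : {measure set T -> \bar R})
    (om : T -> R) (c : R -> R) :
  measurable_fun setT om -> (forall x, 1 <= om x) ->
  (forall tau, 0 < tau -> 0 < c tau) ->
  (forall tau, 0 < tau ->
    (\int[m]_x (c tau * expR (tau * (1 - om x)))%:E = 1)%E) ->
  forall tau, 0 < tau -> moment_weight m (fun x => c tau * expR (tau * (1 - om x))) om.
Proof.
move=> mom om1 c0 i1 tau t0.
have mw t : measurable_fun setT (fun x => c t * expR (t * (1 - om x))).
  apply: measurable_funM; first exact: measurable_cst.
  apply: measurableT_comp; first exact: measurable_expR.
  apply: measurable_funM; first exact: measurable_cst.
  by apply: measurable_funB => //; exact: measurable_cst.
have w0 t x : 0 < t -> 0 <= c t * expR (t * (1 - om x)).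
  by move=> /c0 /ltW ct; rewrite mulr_ge0// expR_ge0.
have wi t : 0 < t -> m.-integrable setT (fun x => (c t * expR (t * (1 - om x)))%:E).
  move=> tt; apply/integrableP; split; first exact/measurable_EFinP.
  under eq_integral do rewrite gee0_abs ?lee_fin ?w0//.
  by rewrite i1// ltry.
split; first by split=> // x; exact: w0.
  by rewrite /Rintegral i1.
move=> k; have [K K0 KP] := exprn_expRN_le k t0.
have t20 : 0 < tau / 2 by rewrite divr_gt0.
have := integrableZl measurableT (c tau * K / c (tau / 2)) (wi _ t20).
apply: le_integrable => //.
  apply/measurable_EFinP; apply: measurable_funM; last exact: mw.
  exact: measurable_funX.
move=> x _; rewrite -EFinM !abse_EFin lee_fin.
have om0 : 0 <= om x by exact: le_trans (om1 x).
rewrite ger0_norm; last by rewrite mulr_ge0 ?exprn_ge0 ?w0.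
apply: le_trans (ler_norm _).
rewrite mulrCA [leRHS](_ : _ = c tau * (K * expR (tau / 2 * (1 - om x)))).
  by rewrite ler_wpM2l ?KP// ltW ?c0.
by field; rewrite gt_eqF ?c0.
Qed.

Definition om1 (t : R) : R := 1 + t ^+ 2.

Definition gauss1 tau (t : R) : R := Num.sqrt (tau / pi) * expR (tau * (1 - om1 t)).

(** Since 1 - [omega] is minus the squared Euclidean norm, this is the centred Gaussian density with
    variance 1/(2 tau) in each coordinate. Writing it through [omega] makes e^(-s) times it
    proportional to e^(-s omega), which is what the Gamma mixture integrates. *)
Definition gauss n tau (x : 'rV[R]_n) : R :=
  Num.sqrt (tau / pi) ^+ n * expR (tau * (1 - omega x)).

Lemma om1_ge1 t : 1 <= om1 t. Proof. by rewrite lerDl sqr_ge0. Qed.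

Lemma measurable_om1 : measurable_fun setT om1.
Proof. by apply: measurable_funD => //; exact: measurable_funX. Qed.

Lemma omega_ge1 n (x : 'rV[R]_n) : 1 <= omega x.
Proof. by rewrite lerDl sumr_ge0// => i _; exact: sqr_ge0. Qed.

Lemma omega_cons n t (v : 'rV[R]_n) : omega (cons_rV (t, v)) = t ^+ 2 + omega v.
Proof.
rewrite /omega big_ord_recl mxE unlift_none addrCA; congr (_ + (_ + _)).
by apply: eq_bigr => i _; rewrite mxE liftK.
Qed.

Lemma gauss_cons n tau t (v : 'rV[R]_n) :
  gauss tau (cons_rV (t, v)) = gauss1 tau t * gauss tau v.
Proof.
rewrite /gauss /gauss1 omega_cons exprS mulrACA -expRD; congr (_ * expR _).
by rewrite /om1; ring.
Qed.

Lemma sqrt_tau_pi_gt0 tau : 0 < tau -> 0 < Num.sqrt (tau / pi).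
Proof. by move=> t0; rewrite sqrtr_gt0 divr_gt0// pi_gt0. Qed.

Lemma integral_gauss1 tau : 0 < tau -> (\int[leb]_t (gauss1 tau t)%:E = 1)%E.
Proof.
(* [s] is the standard deviation, for which the weight is the normal density of mean 0. *)
move=> t0; set s := Num.sqrt ((2 * tau)^-1).
have s2 : s ^+ 2 = (2 * tau)^-1 by rewrite sqr_sqrtr// invr_ge0 mulr_ge0// ltW.
have s0 : s != 0 by rewrite gt_eqF// sqrtr_gt0 invr_gt0 mulr_gt0.
rewrite -[RHS](integral_normal_pdf 0 s); apply: eq_integral => t _.
rewrite normal_pdfE// /normal_peak /normal_fun /gauss1 s2 subr0.
have p0 : 0 < pi :> R by exact: pi_gt0.
congr (_ * expR _)%:E.
  rewrite -sqrtrV; last first.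
    by rewrite mulrn_wge0// ltW// mulr_gt0// invr_gt0 mulr_gt0.
  congr Num.sqrt; rewrite mulr2n; move: p0; move: (pi : R) => p p0; field.
  by rewrite !gt_eqF ?addr_gt0.
by rewrite /om1 mulr2n; field; rewrite gt_eqF.
Qed.

Lemma measurable_gauss n tau : measurable_fun setT (@gauss n tau).
Proof.
apply: measurable_funM; first exact: measurable_cst.
apply: measurableT_comp; first exact: measurable_expR.
apply: measurable_funM; first exact: measurable_cst.
by apply: measurable_funB; [exact: measurable_cst|exact: measurable_omega].
Qed.

Lemma measurable_gauss_EFin n tau :
  measurable_fun setT (fun x : 'rV[R]_n => (gauss tau x)%:E).
Proof. by apply/measurable_EFinP; exact: measurable_gauss. Qed.

Lemma gauss_ge0 n tau (x : 'rV[R]_n) : 0 <= gauss tau x.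
Proof. by rewrite mulr_ge0 ?expR_ge0// exprn_ge0. Qed.

Lemma gauss1_ge0 tau t : 0 <= gauss1 tau t.
Proof. by rewrite mulr_ge0 ?expR_ge0. Qed.

Lemma integral_gauss n tau : 0 < tau ->
  (\int[lebesgue_rV n]_x (gauss tau x)%:E = 1)%E.
Proof.
move=> t0; elim: n => [|n IH].
  rewrite integral_dirac//; last exact: measurable_gauss_EFin.
  by rewrite diracT mul1e /gauss /omega big_ord0 addr0 subrr mulr0 expR0 mulr1.
rewrite ge0_integral_cons; last 2 first.
- exact: measurable_gauss_EFin.
- by move=> x; rewrite lee_fin gauss_ge0.
rewrite -[RHS](integral_gauss1 t0); apply: eq_integral => t _.
under eq_integral do rewrite gauss_cons EFinM.
rewrite ge0_integralZl//.
- by rewrite IH mule1.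
- exact: measurable_gauss_EFin.
- by move=> x _; rewrite lee_fin gauss_ge0.
- by rewrite lee_fin gauss1_ge0.
Qed.

Lemma mw_gauss1 tau : 0 < tau -> moment_weight leb (gauss1 tau) om1.
Proof.
apply: (@gauss_moment_weight _ (measurableTypeR R) leb om1 (fun tau => Num.sqrt (tau / pi))).
- exact: measurable_om1.
- exact: om1_ge1.
- exact: sqrt_tau_pi_gt0.
- exact: integral_gauss1.
Qed.

Lemma mw_gauss n tau : 0 < tau ->
  moment_weight (lebesgue_rV n) (gauss tau) (@omega R n).
Proof.
apply: (@gauss_moment_weight _ _ (lebesgue_rV n) (@omega R n) (fun tau => Num.sqrt (tau / pi) ^+ n)).
- exact: measurable_omega.
- exact: omega_ge1.
- by move=> t /sqrt_tau_pi_gt0 ?; rewrite exprn_gt0.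
- exact: integral_gauss.
Qed.

End gaussian.

(** * The Hardy inequality across a zero of the function *)

Section two_sided_hardy.
Context {R : realType}.
Notation leb := (@lebesgue_measure R).

Lemma ge0_integral_punctured (A B C : set R) (z : R) (F : R -> \bar R) :
  measurable B -> measurable C -> A = B `|` ([set z] `|` C) ->
  (forall x, B x -> x < z) -> (forall x, C x -> z < x) ->
  measurable_fun A F -> (forall x, A x -> 0 <= F x)%E ->
  (\int[leb]_(x in A) F x = \int[leb]_(x in B) F x + \int[leb]_(x in C) F x)%E.
Proof.
move=> mB mC AE Bz Cz; rewrite AE => mF F0.
have mz : measurable [set z] by exact: measurable_set1.
rewrite ge0_integral_setU//; last 2 first.
- exact: measurableU.
- apply/disj_setPS => x [/Bz xz [xE|/Cz zx]] /=.
    by move: xz; rewrite xE ltxx.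
  by have := lt_trans xz zx; rewrite ltxx.
rewrite ge0_integral_setU//; last 3 first.
- by apply: measurable_funS mF; [apply: measurableU => //; exact: measurableU|move=> x; right].
- by move=> x zx; apply: F0; right.
- by apply/disj_setPS => x [-> /Cz]; rewrite ltxx.
by rewrite integral_set1 add0e.
Qed.

Variables (z : R) (l r eps : nat -> R).
Hypothesis l_eps : forall k, l k < z - eps k.
Hypothesis eps_r : forall k, z + eps k < r k.
Hypothesis ndl : forall k, l k.+1 <= l k.
Hypothesis ndr : forall k, r k <= r k.+1.
Hypothesis eps_gt0 : forall k, 0 < eps k.
Hypothesis eps_ni : forall k, eps k.+1 <= eps k.
Hypothesis eps_cvg : eps k @[k --> \oo] --> 0.
Let D := \bigcup_k `[l k, r k]%classic.

(** The one-sided inequality is applied on each side of z, on segments stopping at distance [eps k].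
    The new boundary terms vanish because N(z) = 0 makes N^2/(x - z) tend to 0, and the point z
    itself has measure zero. *)
Lemma hardy2 (kappa : R) (e w E dE N dN : R -> R) :
  0 <= kappa -> N z = 0 ->
  (forall x, D x -> is_derive x 1 N (dN x)) ->
  (forall x, D x -> is_derive x 1 E (dE x)) ->
  (forall x, D x -> {for x, continuous dN}) ->
  (forall x, D x -> {for x, continuous dE}) ->
  (forall x, D x -> {for x, continuous e}) ->
  (forall x, D x -> {for x, continuous w}) ->
  (forall x, D x -> 0 <= e x) -> (forall x, D x -> 0 <= w x) ->
  (forall x a b, D x -> x != z -> kappa * w x * b ^+ 2 +
    (2 * E x * a * b / (x - z) + dE x * b ^+ 2 / (x - z) -
     E x * b ^+ 2 / (x - z) ^+ 2) <= e x * a ^+ 2) ->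
  let psi x := E x * N x ^+ 2 / (x - z) in
  psi (r k) @[k --> \oo] --> 0 -> psi (l k) @[k --> \oo] --> 0 ->
  (\int[leb]_(x in D) (kappa * w x * N x ^+ 2)%:E <=
   \int[leb]_(x in D) (e x * dN x ^+ 2)%:E)%E.
Proof.
move=> k0 Nz dNP dEP cdN cdE ce cw e0 w0 quad psi psir psil.
pose D1 := \bigcup_k `[l k, z - eps k]%classic.
pose D2 := \bigcup_k `[z + eps k, r k]%classic.
have r_nd : {homo r : n m / (n <= m)%N >-> n <= m} by apply/nondecreasing_seqP.
have l_ni : {homo l : n m / (n <= m)%N >-> m <= n} by apply/nonincreasing_seqP.
have e_lt x : 0 < x -> exists k0, forall k, (k0 <= k)%N -> eps k < x.
  move=> x0; move/cvgrPdist_lt : eps_cvg => /(_ x x0)[k1 _ k1P]; exists k1 => k kk.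
  by have := k1P k kk; rewrite sub0r normrN ger0_norm// ltW.
have D1D x : D1 x -> D x.
  move=> [k _ /=]; rewrite in_itv/= => /andP[lx xz]; exists k => //=.
  rewrite in_itv/= lx/=; have := eps_gt0 k; have := eps_r k; lra.
have D2D x : D2 x -> D x.
  move=> [k _ /=]; rewrite in_itv/= => /andP[lx xz]; exists k => //=.
  rewrite in_itv/= xz andbT; have := eps_gt0 k; have := l_eps k; lra.
have D1z x : D1 x -> x < z.
  move=> [k _ /=]; rewrite in_itv/= => /andP[_ xz]; have := eps_gt0 k; lra.
have D2z x : D2 x -> z < x.
  move=> [k _ /=]; rewrite in_itv/= => /andP[zx _]; have := eps_gt0 k; lra.
have Dz : D z.
  exists 0%N => //=; rewrite in_itv/=.
  have := eps_gt0 0%N; have := l_eps 0%N; have := eps_r 0%N; lra.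
have DE : D = D1 `|` ([set z] `|` D2).
  apply/seteqP; split=> [x [k _ /=]|x [/D1D//|[->//|/D2D//]]].
  rewrite in_itv/= => /andP[lx xr]; case: (ltgtP x z) => [xz|zx|->].
  - left; have [|k1 k1P] := e_lt (z - x); first by rewrite subr_gt0.
    exists (maxn k k1) => //=; rewrite in_itv/=.
    have := k1P _ (leq_maxr k k1); have := l_ni _ _ (leq_maxl k k1); lra.
  - right; right; have [|k1 k1P] := e_lt (x - z); first by rewrite subr_gt0.
    exists (maxn k k1) => //=; rewrite in_itv/=.
    have := k1P _ (leq_maxr k k1); have := r_nd _ _ (leq_maxl k k1); lra.
  - by right; left.
have mD1 : measurable D1 by exact: bigcup_measurable.
have mD2 : measurable D2 by exact: bigcup_measurable.
have cN x : D x -> {for x, continuous N} by move=> /dNP /der_continuous.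
have mF (F : R -> R) : (forall x, D x -> {for x, continuous F}) ->
    measurable_fun D (EFin \o F).
  move=> cF; apply/measurable_fun_bigcup => // k; apply/measurable_EFinP.
  apply: subspace_continuous_measurable_fun => //.
  by apply: continuous_in_subspaceT => x; rewrite inE => xk; apply: cF; exists k.
have cvg_psi (h : nat -> R) : (forall k, h k != z) -> h k @[k --> \oo] --> z ->
    psi (h k) @[k --> \oo] --> 0.
  move=> hz hcvg.
  (* Carathéodory's form of the derivative: N(x) = q(x)(x - z) with q continuous at z, hence psi(x)
     = E(x) q(x)^2 (x - z) off z. *)
  have [q [qP cq _]] := (is_derive1_caratheodory N z (dN z)).1 (dNP z Dz).
  have -> : (fun k => psi (h k)) = (fun k => E (h k) * q (h k) ^+ 2 * (h k - z)).
    apply/funext => k; have := qP (h k); rewrite Nz subr0 /psi => ->.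
    by field; rewrite subr_eq0.
  have cG : {for z, continuous (fun x => E x * q x ^+ 2 * (x - z))}.
    apply: contM; first apply: contM.
    - exact: der_continuous (dEP z Dz).
    - exact: contX.
    - by apply: contB; [exact: cvg_id|exact: cont_cst].
  have := cvg_comp _ _ hcvg cG.
  by rewrite /= subrr mulr0; exact.
have h1 : (\int[leb]_(x in D1) (kappa * w x * N x ^+ 2)%:E <=
   \int[leb]_(x in D1) (e x * dN x ^+ 2)%:E)%E.
  have nd : forall k, `[l k, z - eps k] `<=` `[l k.+1, z - eps k.+1].
    move=> k x /=; rewrite !in_itv/= => /andP[lx xz].
    by have := ndl k; have := eps_ni k; lra.
  have neq x : D1 x -> x != z by move=> /D1z; rewrite lt_neqAle => /andP[].
  have cvg0 : psi (z - eps k) @[k --> \oo] --> 0.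
    apply: cvg_psi => [k|]; first by have := eps_gt0 k; lra.
    by rewrite -[X in _ --> X]subr0; apply: cvgB => //; exact: cvg_cst.
  exact: (hardy l_eps nd k0 neq (fun x xD => dNP x (D1D x xD))
    (fun x xD => dEP x (D1D x xD)) (fun x xD => cdN x (D1D x xD))
    (fun x xD => cdE x (D1D x xD)) (fun x xD => ce x (D1D x xD))
    (fun x xD => cw x (D1D x xD)) (fun x xD => e0 x (D1D x xD))
    (fun x xD => w0 x (D1D x xD))
    (fun x a b xD => quad x a b (D1D x xD) (neq x xD)) cvg0 psil).
have h2 : (\int[leb]_(x in D2) (kappa * w x * N x ^+ 2)%:E <=
   \int[leb]_(x in D2) (e x * dN x ^+ 2)%:E)%E.
  have nd : forall k, `[z + eps k, r k] `<=` `[z + eps k.+1, r k.+1].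
    move=> k x /=; rewrite !in_itv/= => /andP[lx xz].
    by have := ndr k; have := eps_ni k; lra.
  have neq x : D2 x -> x != z by move=> /D2z; rewrite lt_neqAle eq_sym => /andP[].
  have cvg0 : psi (z + eps k) @[k --> \oo] --> 0.
    apply: cvg_psi => [k|]; first by have := eps_gt0 k; lra.
    by rewrite -[X in _ --> X]addr0; apply: cvgD => //; exact: cvg_cst.
  exact: (hardy eps_r nd k0 neq (fun x xD => dNP x (D2D x xD))
    (fun x xD => dEP x (D2D x xD)) (fun x xD => cdN x (D2D x xD))
    (fun x xD => cdE x (D2D x xD)) (fun x xD => ce x (D2D x xD))
    (fun x xD => cw x (D2D x xD)) (fun x xD => e0 x (D2D x xD))
    (fun x xD => w0 x (D2D x xD))
    (fun x a b xD => quad x a b (D2D x xD) (neq x xD)) psir cvg0).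
rewrite (ge0_integral_punctured mD1 mD2 DE D1z D2z); last 2 first.
- apply: mF => x Dx; apply: contM; [apply: contM; [exact: cont_cst|exact: cw]|].
  by apply: contX; exact: cN.
- by move=> x Dx; rewrite lee_fin mulr_ge0// ?sqr_ge0// mulr_ge0 ?w0.
rewrite [leRHS](ge0_integral_punctured mD1 mD2 DE D1z D2z); last 2 first.
- by apply: mF => x Dx; apply: contM; [exact: ce|apply: contX; exact: cdN].
- by move=> x Dx; rewrite lee_fin mulr_ge0// ?sqr_ge0 ?e0.
exact: leeD.
Qed.

End two_sided_hardy.

(** * The Gaussian Poincaré inequality in dimension one *)

Section gauss_poincare1.
Context {R : realType}.
Notation leb := (@lebesgue_measure R).

Lemma pgrowth_gauss_decay d (T : measurableType d) (om F : T -> R) tau :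
  0 < tau -> (forall x, 1 <= om x) -> pgrowth om F ->
  exists2 K, 0 <= K & forall x, `|F x| * expR (tau * (1 - om x)) <= K / om x.
Proof.
move=> t0 om1 Fp; have [C C0 [k Fk]] := pgrowth_ub om1 Fp.
have [K K0 KP] := exprn_expRN_le k.+1 t0.
exists (C * K) => [|x]; first exact: mulr_ge0.
have om0 : 0 < om x by exact: lt_le_trans (om1 x).
rewrite ler_pdivlMr//.
apply: (@le_trans _ _ (C * (om x ^+ k.+1 * expR (tau * (1 - om x))))).
  rewrite -(mulrA `|F x|) exprS [leRHS](_ : _ =
    C * om x ^+ k * (expR (tau * (1 - om x)) * om x)); last by ring.
  by rewrite ler_wpM2r// mulr_ge0 ?expR_ge0// ltW.
rewrite ler_wpM2l// (le_trans (KP _ (om1 x)))//.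
by rewrite ler_piMr// expR_le1 pmulr_rle0 ?divr_gt0// subr_le0.
Qed.

Lemma der_gauss1 tau t : is_derive t (1 : R) (gauss1 tau) (- (2 * tau * t * gauss1 tau t)).
Proof.
have d1 : is_derive t (1 : R) (fun t => tau * (1 - om1 t)) (- (2 * tau * t)).
  apply: (der_eq (derM (der_cst tau t) (derB (der_cst 1 t)
    (derD (der_cst 1 t) (derX 2 (der_id t)))))).
  by rewrite /=; ring.
apply: (der_eq (derM (der_cst (Num.sqrt (tau / pi)) t)
  (der_comp (f := expR) (is_derive_expR _) d1))).
by rewrite /gauss1; ring.
Qed.

Lemma cvg_div_natS (K : R) : K / k.+1%:R @[k --> \oo] --> 0.
Proof.
rewrite -[X in _ --> X](mulr0 K); apply: cvgM; first exact: cvg_cst.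
exact: cvg_harmonic.
Qed.

(** The Hardy inequality with z = 0 and e, w, E all equal to the Gaussian density: equality in the
    square means N'/N = 1/x, so the extremal is N = x, the first Hermite polynomial. *)
Lemma gauss1_poincare tau (f df : R -> R) : 0 < tau ->
  (forall t, is_derive t (1 : R) f (df t)) -> continuous df ->
  pgrowth om1 f -> pgrowth om1 df ->
  2 * tau * (wE leb (gauss1 tau) (fun t => f t ^+ 2) - wE leb (gauss1 tau) f ^+ 2)
  <= wE leb (gauss1 tau) (fun t => df t ^+ 2).
Proof.
move=> t0 dP cdf fp dfp.
have mw := mw_gauss1 t0.
have mom := @measurable_om1 R; have om11 := @om1_ge1 R.
pose g := gauss1 tau.
pose N t := f t - f 0.
have Np : pgrowth om1 N by apply: pgrowthB => //; exact: pgrowth_cst.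
have cg t : {for t, continuous g} by exact: der_continuous (der_gauss1 tau t).
have main : (\int[leb]_(x in \bigcup_k `[(- (k.+2%:R))%R, k.+2%:R]%classic)
    (2 * tau * g x * N x ^+ 2)%:E <=
   \int[leb]_(x in \bigcup_k `[(- (k.+2%:R))%R, k.+2%:R]%classic)
    (g x * df x ^+ 2)%:E)%E.
  have [K K0 KP] := pgrowth_gauss_decay t0 om11 (pgrowthX om11 2 Np).
  have psiP (h : R) : `|g h * N h ^+ 2 / (h - 0)| <= Num.sqrt (tau / pi) * K / `|h|.
    rewrite subr0 normrM normfV ler_wpM2r ?invr_ge0//.
    rewrite normrM (ger0_norm (gauss1_ge0 _ _)) mulrC /g /gauss1 mulrCA ler_wpM2l//.
    apply: le_trans (KP h) _; rewrite ler_pdivrMr ?ler_peMr//.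
    exact: lt_le_trans (om11 h).
  have psi_cvg (h : nat -> R) : (forall k, k.+1%:R <= `|h k|) ->
      g (h k) * N (h k) ^+ 2 / (h k - 0) @[k --> \oo] --> 0.
    move=> hk; apply/norm_cvg0P.
    apply: (@squeeze_cvgr _ _ _ _ (cst 0) (fun k => Num.sqrt (tau / pi) * K / k.+1%:R)).
    - apply: nearW => k; rewrite normr_ge0/= (le_trans (psiP _))//.
      by rewrite ler_wpM2l ?mulr_ge0// lef_pV2 ?posrE// (lt_le_trans _ (hk k)).
    - exact: cvg_cst.
    - exact: cvg_div_natS.
  (* The endpoints start at 2 because the removed radius 1/(k+1) starts at 1, and the inequality
     between them must be strict. *)
  apply: (@hardy2 _ 0 (fun k => - k.+2%:R) (fun k => k.+2%:R) (fun k => k.+1%:R^-1)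
    _ _ _ _ _ _ _ (2 * tau) g g g (fun t => - (2 * tau * t * g t)) N df).
  - by move=> k; rewrite sub0r ltrN2 (@le_lt_trans _ _ 1) ?invf_le1 ?ler1n ?ltr1n.
  - by move=> k; rewrite add0r (@le_lt_trans _ _ 1) ?invf_le1 ?ler1n ?ltr1n.
  - by move=> k; rewrite lerN2 ler_nat.
  - by move=> k; rewrite ler_nat.
  - by move=> k; rewrite invr_gt0.
  - by move=> k; rewrite lef_pV2 ?posrE// ler_nat.
  - exact: cvg_harmonic.
  - by rewrite mulr_ge0// ltW.
  - by rewrite /N subrr.
  - by move=> t _; apply: (der_eq (derB (dP t) (der_cst (f 0) t))); rewrite subr0.
  - by move=> t _; exact: der_gauss1.
  - by move=> t _; exact: cdf.
  - move=> t _; apply: continuousN; apply: contM => //; apply: contM; last exact: cvg_id.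
    exact: cont_cst.
  - by move=> t _.
  - by move=> t _.
  - by move=> t _; exact: gauss1_ge0.
  - by move=> t _; exact: gauss1_ge0.
  - move=> x a b _ x0; rewrite subr0 -subr_ge0.
    (* The derivative of g contributes -2 tau g b^2, which cancels the term with kappa = 2 tau; only
       a perfect square remains. *)
    rewrite (_ : _ - _ = g x * (a - b / x) ^+ 2); last by field.
    by rewrite mulr_ge0 ?sqr_ge0 ?gauss1_ge0.
  - by apply: psi_cvg => k; rewrite ger0_norm// ler_nat.
  - by apply: psi_cvg => k; rewrite normrN ger0_norm// ler_nat.
have DT : \bigcup_k `[(- (k.+2%:R))%R, k.+2%:R]%classic = [set: R].
  rewrite -subTset -bigcup_segment_NT; apply: subset_bigcup => k _.
  exact: segment_NT_nd.
rewrite DT in main.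
have iN := pg_integrable mw (pgrowthX om11 2 Np).
have idf := pg_integrable mw (pgrowthX om11 2 dfp).
have h1 : 2 * tau * wE leb g (fun t => N t ^+ 2) <= wE leb g (fun t => df t ^+ 2).
  rewrite -(wEZ mw); last exact: pgrowthX.
  rewrite /wE /Rintegral; apply: fine_le.
  - by apply: integrable_fin_num => //; exact: (pg_integrable mw (pgrowthZ om11 _ (pgrowthX om11 2 Np))).
  - exact: integrable_fin_num.
  - apply: (le_trans _ (le_trans main _)).
      rewrite le_eqVlt; apply/orP; left; apply/eqP.
      by apply: eq_integral => t _; rewrite mulrAC.
    rewrite le_eqVlt; apply/orP; left; apply/eqP.
    by apply: eq_integral => t _; rewrite mulrC.
apply: le_trans h1; rewrite ler_wpM2l ?mulr_ge0 ?(ltW t0)//.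
(* The second moment about f(0) exceeds the variance by the square of the mean minus f(0). *)
rewrite (wE_sqrB mw)//.
by have := sqr_ge0 (wE leb g f - f 0); rewrite -/g; lra.
Qed.

End gauss_poincare1.

(** * Tensorisation of the Gaussian Poincaré inequality *)

Section gauss_poincare.
Context {R : realType}.
Notation leb := (@lebesgue_measure R).
Variable tau : R.
Hypothesis t0 : 0 < tau.
Notation E1 := (wE leb (gauss1 tau)).
Notation E n := (wE (lebesgue_rV n) (gauss tau)).
Notation pg n := (pgrowth (@omega R n)).

Let mw1 := mw_gauss1 t0.
Let mwn n := mw_gauss n t0.

(** This submultiplicativity lets polynomial growth pass to slices and to partial expectations. *)
Lemma omega_cons_le n t (v : 'rV[R]_n) : omega (cons_rV (t, v)) <= om1 t * omega v.
Proof.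
rewrite omega_cons /om1 mulrDl mul1r addrC lerD2l ler_peMr ?sqr_ge0//.
exact: omega_ge1.
Qed.

Lemma omega_gt0' n (x : 'rV[R]_n) : 0 < omega x.
Proof. exact: lt_le_trans (omega_ge1 x). Qed.

Lemma om1_gt0 (t : R) : 0 < om1 t.
Proof. exact: lt_le_trans (om1_ge1 t). Qed.

Lemma pgrowth_slice n F (t : R) : pg n.+1 F -> pg n (fun v => F (cons_rV (t, v))).
Proof.
move=> Fp; split.
  exact: (measurableT_comp Fp.1 (measurable_cons_rVl t)).
have [C C0 [k Fk]] := pgrowth_ub (@omega_ge1 R n.+1) Fp.
exists (C * om1 t ^+ k), k => v; apply: le_trans (Fk _) _.
rewrite -mulrA -exprMn ler_wpM2l// lerXn2r ?nnegrE ?omega_cons_le//.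
  exact/ltW/omega_gt0'.
by rewrite mulr_ge0 ?(ltW (om1_gt0 _)) ?(ltW (omega_gt0' _)).
Qed.

Lemma pgrowth_slice0 n F (v : 'rV[R]_n) : pg n.+1 F ->
  pgrowth om1 (fun t : R => F (cons_rV (t, v))).
Proof.
move=> Fp; split.
  exact: (measurableT_comp Fp.1 (measurable_cons_rVr v)).
have [C C0 [k Fk]] := pgrowth_ub (@omega_ge1 R n.+1) Fp.
exists (C * omega v ^+ k), k => t; apply: le_trans (Fk _) _.
rewrite -mulrA -exprMn ler_wpM2l// (mulrC (omega v)).
rewrite lerXn2r ?nnegrE ?omega_cons_le//.
  exact/ltW/omega_gt0'.
by rewrite mulr_ge0 ?(ltW (om1_gt0 _)) ?(ltW (omega_gt0' _)).
Qed.

Let slice_integral n F t : pg n.+1 F ->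
  (\int[lebesgue_rV n]_v (F (cons_rV (t, v)) * gauss tau (cons_rV (t, v)))%:E =
  (E n (fun v => F (cons_rV (t, v))) * gauss1 tau t)%:E)%E.
Proof.
move=> Fp; have Fi := pg_integrable (mwn n) (pgrowth_slice t Fp).
rewrite EFinM muleC fineK; last exact: integrable_fin_num.
rewrite -integralZl//; apply: eq_integral => v _.
by rewrite gauss_cons mulrCA EFinM.
Qed.

Let slice_integral0 n F (v : 'rV[R]_n) : pg n.+1 F ->
  (\int[leb]_t (F (cons_rV (t, v)) * gauss tau (cons_rV (t, v)))%:E =
  (E1 (fun t => F (cons_rV (t, v))) * gauss tau v)%:E)%E.
Proof.
move=> Fp; have Fi := pg_integrable mw1 (pgrowth_slice0 v Fp).
rewrite EFinM muleC fineK; last exact: integrable_fin_num.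
rewrite -integralZl//; apply: eq_integral => t _.
by rewrite -EFinM gauss_cons; congr _%:E; ring.
Qed.

Lemma wE_cons n F : pg n.+1 F ->
  E n.+1 F = E1 (fun t => E n (fun v => F (cons_rV (t, v)))).
Proof.
move=> Fp; rewrite /wE {1}/Rintegral integral_cons; last first.
  exact: (pg_integrable (mwn n.+1) Fp).
by congr fine; apply: eq_integral => t _; rewrite slice_integral.
Qed.

Lemma wE_consC n F : pg n.+1 F ->
  E n.+1 F = E n (fun v => E1 (fun t => F (cons_rV (t, v)))).
Proof.
move=> Fp; rewrite /wE {1}/Rintegral integral_consC; last first.
  exact: (pg_integrable (mwn n.+1) Fp).
by congr fine; apply: eq_integral => t _; rewrite slice_integral0.
Qed.

Let measurable_gaussV d (T : measurableType d) c (om : T -> R) :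
  measurable_fun setT om ->
  measurable_fun setT (fun x => (c * expR (tau * (1 - om x)))^-1).
Proof.
move=> mom.
have -> : (fun x => (c * expR (tau * (1 - om x)))^-1) =
    (fun x => c^-1 * expR (tau * (om x - 1))).
  by apply/funext => x; rewrite invfM -expRN -mulrN opprB.
apply: measurable_funM; first exact: measurable_cst.
apply: measurableT_comp; first exact: measurable_expR.
apply: measurable_funM; first exact: measurable_cst.
by apply: measurable_funB => //; exact: measurable_cst.
Qed.

Lemma pgrowth_wE_slice n F : pg n.+1 F ->
  pgrowth om1 (fun t : R => E n (fun v => F (cons_rV (t, v)))).
Proof.
move=> Fp; split.
  have H := measurable_fubini_F (integrable_cons (pg_integrable (mwn n.+1) Fp)).
  (* Fubini gives measurability of the partial integral, which still carries the factor
     [gauss1 tau t]; this factor is positive and is divided out. *)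
  have -> : (fun t => E n (fun v => F (cons_rV (t, v)))) =
      (fun t => fine (fubini_F (lebesgue_rV n) ((fun x => (F x * gauss tau x)%:E) \o
       (@cons_rV _ R n)) t) * (gauss1 tau t)^-1).
    apply/funext => t; rewrite /fubini_F /= slice_integral//= mulfK//.
    by rewrite gt_eqF// mulr_gt0 ?expR_gt0 ?sqrt_tau_pi_gt0.
  apply: measurable_funM; first exact: (measurableT_comp _ H).
  exact: (measurable_gaussV _ (@measurable_om1 R)).
have [C C0 [k Fk]] := pgrowth_ub (@omega_ge1 R n.+1) Fp.
exists (C * E n (fun v => omega v ^+ k)), k => t.
have pgo : pg n (fun v => C * om1 t ^+ k * omega v ^+ k).
  apply: pgrowthZ; first exact: omega_ge1.
  apply: pgrowthX; first exact: omega_ge1.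
  by apply: pgrowth_om; [exact: measurable_omega|exact: omega_ge1].
have pgs := pgrowth_slice t Fp.
have bnd v : `|F (cons_rV (t, v))| <= C * om1 t ^+ k * omega v ^+ k.
  apply: le_trans (Fk _) _; rewrite -mulrA -exprMn ler_wpM2l//.
  rewrite lerXn2r ?nnegrE ?omega_cons_le//; first exact/ltW/omega_gt0'.
  by rewrite mulr_ge0 ?(ltW (om1_gt0 _)) ?(ltW (omega_gt0' _)).
have pgk : pg n (fun v => omega v ^+ k).
  apply: pgrowthX; first exact: omega_ge1.
  by apply: pgrowth_om; [exact: measurable_omega|exact: omega_ge1].
rewrite mulrAC -(wEZ (mwn n)) // ler_norml; apply/andP; split.
  rewrite -mulN1r -(wEZ (mwn n))//; apply: (wE_le (mwn n)) => //.
    exact: (pgrowthZ (@omega_ge1 R n)).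
  by move=> v; have := bnd v; rewrite ler_norml mulN1r => /andP[].
by apply: (wE_le (mwn n)) => // v; exact: le_trans (ler_norm _) (bnd v).
Qed.

Lemma pgrowth_wE_slice0 n F : pg n.+1 F ->
  pg n (fun v => E1 (fun t => F (cons_rV (t, v)))).
Proof.
move=> Fp; split.
  have H := measurable_fubini_G (integrable_cons (pg_integrable (mwn n.+1) Fp)).
  have -> : (fun v => E1 (fun t => F (cons_rV (t, v)))) =
      (fun v => fine (fubini_G leb ((fun x => (F x * gauss tau x)%:E) \o
       (@cons_rV _ R n)) v) * (gauss tau v)^-1).
    apply/funext => v; rewrite /fubini_G /= slice_integral0//= mulfK//.
    by rewrite gt_eqF// mulr_gt0 ?expR_gt0// exprn_gt0// sqrt_tau_pi_gt0.
  apply: measurable_funM; first exact: (measurableT_comp _ H).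
  exact: (measurable_gaussV _ (@measurable_omega R n)).
have [C C0 [k Fk]] := pgrowth_ub (@omega_ge1 R n.+1) Fp.
exists (C * E1 (fun t => om1 t ^+ k)), k => v.
have pgk : pgrowth om1 (fun t : R => om1 t ^+ k).
  apply: pgrowthX; first exact: om1_ge1.
  by apply: pgrowth_om; [exact: measurable_om1|exact: om1_ge1].
have pgo : pgrowth om1 (fun t : R => C * omega v ^+ k * om1 t ^+ k).
  by apply: pgrowthZ => //; exact: om1_ge1.
have pgs := pgrowth_slice0 v Fp.
have bnd t : `|F (cons_rV (t, v))| <= C * omega v ^+ k * om1 t ^+ k.
  apply: le_trans (Fk _) _; rewrite -mulrA -exprMn ler_wpM2l// mulrC.
  rewrite lerXn2r ?nnegrE ?omega_cons_le//; first exact/ltW/omega_gt0'.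
  by rewrite mulr_ge0 ?(ltW (om1_gt0 _)) ?(ltW (omega_gt0' _)).
rewrite mulrAC -(wEZ mw1) // ler_norml; apply/andP; split.
  rewrite -mulN1r -(wEZ mw1)//; apply: (wE_le mw1) => //.
    exact: (pgrowthZ (@om1_ge1 R)).
  by move=> t; have := bnd t; rewrite ler_norml mulN1r => /andP[].
by apply: (wE_le mw1) => // t; exact: le_trans (ler_norm _) (bnd t).
Qed.

Lemma pgrowth_snd n (p : 'rV[R]_n -> R) : pg n p -> pg n.+1 (fun x => p (uncons_rV x).2).
Proof.
move=> pp; split.
  apply: (measurableT_comp pp.1).
  exact: (measurableT_comp measurable_snd (@measurable_uncons_rV _ R n)).
have [C C0 [k Fk]] := pgrowth_ub (@omega_ge1 R n) pp.
exists C, k => x; apply: le_trans (Fk _) _.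
rewrite ler_wpM2l// lerXn2r ?nnegrE ?(ltW (omega_gt0' _))//.
rewrite /omega lerD2l big_ord_recl /= -[leLHS]add0r lerD ?sqr_ge0//.
by apply: ler_sum => i _; rewrite mxE.
Qed.

(* Efron-Stein: the variance of the conditional mean [m] of the last
   coordinates is at most the mean of the conditional variances. *)
Lemma gauss_var_slice n F : pg n.+1 F ->
  E1 (fun t => E n (fun v => F (cons_rV (t, v))) ^+ 2) - E n.+1 F ^+ 2 <=
  E n.+1 (fun x => F x ^+ 2) - E n (fun v => E1 (fun t => F (cons_rV (t, v))) ^+ 2).
Proof.
move=> Fp.
pose m t := E n (fun v => F (cons_rV (t, v))).
pose p v := E1 (fun t => F (cons_rV (t, v))).
have mp : pgrowth om1 m by exact: pgrowth_wE_slice.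
have pp : pg n p by exact: pgrowth_wE_slice0.
have om1n := @omega_ge1 R n; have om1n1 := @omega_ge1 R n.+1.
have om11 := @om1_ge1 R.
(* Averaged over t first, [H] gives the conditional variances given v. Averaged over v first, it
   dominates (m t - E F)^2 by Jensen. *)
pose H x := (F x - p (uncons_rV x).2) ^+ 2.
have Hp : pg n.+1 H.
  by apply: pgrowthX => //; apply: pgrowthB => //; exact: pgrowth_snd.
have HE (t : R) v : H (cons_rV (t, v)) = (F (cons_rV (t, v)) - p v) ^+ 2.
  by rewrite /H cons_rVK.
have EH1 : E n.+1 H = E n.+1 (fun x => F x ^+ 2) - E n (fun v => p v ^+ 2).
  rewrite wE_consC// (wE_consC (pgrowthX om1n1 2 Fp)) -(wEB (mwn n)).
  - congr wE; apply/funext => v.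
    have -> : (fun t => H (cons_rV (t, v))) = (fun t => (F (cons_rV (t, v)) - p v) ^+ 2).
      by apply/funext => t; rewrite HE.
    by rewrite (wE_sqrB mw1) -/(p v); [ring|exact: pgrowth_slice0].
  - exact: (pgrowth_wE_slice0 (pgrowthX om1n1 2 Fp)).
  - exact: pgrowthX.
have EH2 : E1 (fun t => m t ^+ 2) - E n.+1 F ^+ 2 <= E n.+1 H.
  rewrite (wE_cons Hp).
  have -> : E1 (fun t => m t ^+ 2) - E n.+1 F ^+ 2 = E1 (fun t => (m t - E n.+1 F) ^+ 2).
    by rewrite (wE_sqrB mw1)// -(wE_cons Fp); ring.
  apply: (wE_le mw1).
  - by apply: pgrowthX => //; apply: pgrowthB => //; exact: pgrowth_cst.
  - exact: pgrowth_wE_slice.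
  - move=> t.
    have -> : (fun v => H (cons_rV (t, v))) = (fun v => (F (cons_rV (t, v)) - p v) ^+ 2).
      by apply/funext => v; rewrite HE.
    have -> : m t - E n.+1 F = E n (fun v => F (cons_rV (t, v)) - p v).
      by rewrite (wEB (mwn n)) ?wE_consC//; exact: pgrowth_slice.
    by apply: (wE_var_ge0 (mwn n)); apply: pgrowthB => //; exact: pgrowth_slice.
by rewrite -EH1.
Qed.

(** Induction on n. The induction hypothesis bounds the variance in v at fixed t, the
    one-dimensional inequality bounds the variance in t at fixed v, and by the Efron-Stein bound
    these two averaged variances add up to at least the full variance. *)
Theorem gauss_poincare n (F : 'rV[R]_n -> R) (dF : 'I_n -> 'rV[R]_n -> R) :
  (forall i, C1_line i F (dF i)) -> pg n F -> (forall i, pg n (dF i)) ->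
  2 * tau * (E n (fun x => F x ^+ 2) - E n F ^+ 2) <=
  E n (fun x => \sum_(i < n) dF i x ^+ 2).
Proof.
elim: n F dF => [|n IH] F dF dFP Fp dFp.
  have FE x : F x = F 0 by rewrite [x]thinmx0.
  have -> : (fun x => F x ^+ 2) = cst (F 0 ^+ 2) by apply/funext => x; rewrite FE.
  have -> : wE (lebesgue_rV 0) (gauss tau) F = F 0.
    by rewrite -[RHS](wE_cst (mwn 0)); congr wE; apply/funext => x; rewrite FE.
  rewrite (wE_cst (mwn 0)) subrr mulr0.
  by apply: (wE_ge0 (mwn 0)) => x; rewrite big_ord0.
have om1n := @omega_ge1 R n; have om1n1 := @omega_ge1 R n.+1.
have om11 := @om1_ge1 R.
have F2p := pgrowthX om1n1 2 Fp.
have dF2p i := pgrowthX om1n1 2 (dFp i).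
pose S x := \sum_(j < n) dF (lift ord0 j) x ^+ 2.
have Sp : pg n.+1 S by apply: pgrowth_sum => // j; exact: dF2p.
have -> : (fun x => \sum_(i < n.+1) dF i x ^+ 2) = (fun x => dF ord0 x ^+ 2 + S x).
  by apply/funext => x; rewrite big_ord_recl.
rewrite (wED (mwn n.+1))//.
have h1 : 2 * tau * (E n.+1 (fun x => F x ^+ 2) -
    E1 (fun t => E n (fun v => F (cons_rV (t, v))) ^+ 2)) <= E n.+1 S.
  rewrite !wE_cons//.
  have q1 := pgrowth_wE_slice F2p.
  have q2 := pgrowthX om11 2 (pgrowth_wE_slice Fp).
  rewrite -(wEB mw1)// -(wEZ mw1); last exact: pgrowthB.
  apply: (wE_le mw1); [exact: (pgrowthZ om11 _ (pgrowthB om11 q1 q2))|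
    exact: pgrowth_wE_slice|].
  move=> t; apply: (IH (fun v => F (cons_rV (t, v)))
    (fun j v => dF (lift ord0 j) (cons_rV (t, v)))).
  - by move=> j; exact: C1_line_slice.
  - exact: pgrowth_slice.
  - by move=> j; exact: pgrowth_slice.
have h2 : 2 * tau * (E n.+1 (fun x => F x ^+ 2) -
    E n (fun v => E1 (fun t => F (cons_rV (t, v))) ^+ 2)) <=
    E n.+1 (fun x => dF ord0 x ^+ 2).
  rewrite !wE_consC//.
  have q1 := pgrowth_wE_slice0 F2p.
  have q2 := pgrowthX om1n 2 (pgrowth_wE_slice0 Fp).
  rewrite -(wEB (mwn n))// -(wEZ (mwn n)); last exact: pgrowthB.
  apply: (wE_le (mwn n)); [exact: (pgrowthZ om1n _ (pgrowthB om1n q1 q2))|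
    exact: (pgrowth_wE_slice0 (dF2p ord0))|].
  move=> v.
  exact: (gauss1_poincare t0 (fun t => (C1_line_slice0 v (dFP ord0) t).1)
    (fun t => (C1_line_slice0 v (dFP ord0) t).2) (pgrowth_slice0 v Fp)
    (pgrowth_slice0 v (dFp ord0))).
have := gauss_var_slice Fp => h3.
apply: le_trans (lerD h2 h1); rewrite -mulrDr ler_wpM2l ?mulr_ge0 ?(ltW t0)//.
lra.
Qed.

End gauss_poincare.

(** * Calculus and decay along coordinate lines *)

Section C1_line_rules.
Context {R : realType} (n : nat).
Implicit Types (F G : 'rV[R]_n -> R) (i j : 'I_n).
Notation e_ := (delta_mx ord0).

Lemma C1_line_ext i F dF dG : C1_line i F dF -> dF =1 dG -> C1_line i F dG.
Proof. by move=> h /funext <-. Qed.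

Lemma C1_line_cst i (c : R) : C1_line i (fun=> c) (fun=> 0).
Proof. by move=> x t; split; [exact: der_cst|exact: cont_cst]. Qed.

Lemma C1_lineD i F G dF dG : C1_line i F dF -> C1_line i G dG ->
  C1_line i (fun x => F x + G x) (fun x => dF x + dG x).
Proof.
by move=> Fi Gi x t; split;
  [exact: (derD (Fi x t).1 (Gi x t).1)|exact: (contD (Fi x t).2 (Gi x t).2)].
Qed.

Lemma C1_lineM i F G dF dG : C1_line i F dF -> C1_line i G dG ->
  C1_line i (fun x => F x * G x) (fun x => dF x * G x + F x * dG x).
Proof.
move=> Fi Gi x t; split; first exact: (derM (Fi x t).1 (Gi x t).1).
have cF := der_continuous (Fi x t).1; have cG := der_continuous (Gi x t).1.
by apply: contD; apply: contM => //; [exact: (Fi x t).2|exact: (Gi x t).2].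
Qed.

Lemma C1_lineZ i c F dF : C1_line i F dF ->
  C1_line i (fun x => c * F x) (fun x => c * dF x).
Proof.
move=> Fi; apply: (C1_line_ext (C1_lineM (C1_line_cst i c) Fi)) => x.
by rewrite mul0r add0r.
Qed.

Lemma C1_lineB i F G dF dG : C1_line i F dF -> C1_line i G dG ->
  C1_line i (fun x => F x - G x) (fun x => dF x - dG x).
Proof.
by move=> Fi Gi x t; split;
  [exact: (derB (Fi x t).1 (Gi x t).1)|exact: (contB (Fi x t).2 (Gi x t).2)].
Qed.

Lemma C1_line_sum i (I : Type) (s : seq I) (F dF : I -> 'rV[R]_n -> R) :
  (forall k, C1_line i (F k) (dF k)) ->
  C1_line i (fun x => \sum_(k <- s) F k x) (fun x => \sum_(k <- s) dF k x).
Proof.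
move=> Fi; elim: s => [|k s IH].
  have := C1_line_cst i 0; congr (C1_line i _ _);
    by apply/funext => x; rewrite big_nil.
have := C1_lineD (Fi k) IH; congr (C1_line i _ _);
  by apply/funext => x; rewrite big_cons.
Qed.

Lemma C1_line_comp i (phi dphi : R -> R) F dF :
  (forall x, is_derive (F x) (1 : R) phi (dphi (F x))) ->
  (forall x, {for F x, continuous dphi}) -> C1_line i F dF ->
  C1_line i (fun x => phi (F x)) (fun x => dphi (F x) * dF x).
Proof.
move=> dP cP Fi x t; split; first exact: (der_comp (dP _) (Fi x t).1).
apply: contM; last exact: (Fi x t).2.
have cF := der_continuous (Fi x t).1.
exact: (continuous_comp cF (cP _)).
Qed.

Lemma C1_line_coord i j : C1_line i (fun x : 'rV[R]_n => x ord0 j) (fun=> (j == i)%:R).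
Proof.
move=> x t; split; last exact: cont_cst.
have -> : (fun s => (x + s *: e_ i) ord0 j) = (fun s : R => x ord0 j + s * (j == i)%:R).
  by apply/funext => s; rewrite !mxE eqxx.
apply: (der_eq (derD (der_cst _ t) (derM (der_id t) (der_cst _ t)))).
by rewrite mulr0 addr0 add0r mul1r.
Qed.

Lemma C1_line_omega i : C1_line i (@omega R n) (fun x => 2 * x ord0 i).
Proof.
apply: (C1_line_ext (C1_lineD (C1_line_cst i 1) (C1_line_sum
  (index_enum _) (fun j => C1_lineM (C1_line_coord i j) (C1_line_coord i j))))) => x.
rewrite add0r (bigD1 i)//= eqxx big1 => [|j /negPf ->].
  by rewrite mulr1n; ring.
by rewrite mul0r mulr0 addr0.
Qed.

Lemma C1_line_omega_powR i (b : R) : C1_line i (fun x : 'rV[R]_n => omega x `^ b)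
  (fun x => 2 * b * x ord0 i * omega x `^ (b - 1)).
Proof.
have dP (x : 'rV[R]_n) : is_derive (omega x) (1 : R) (fun y => y `^ b) (b * omega x `^ (b - 1)).
  exact: (is_derive1_powR b (omega_gt0 x)).
have cP (x : 'rV[R]_n) : {for omega x, continuous (fun y => b * y `^ (b - 1))}.
  apply: contM; first exact: cont_cst.
  exact: (der_continuous (is_derive1_powR (b - 1) (omega_gt0 x))).
apply: (C1_line_ext (C1_line_comp dP cP (C1_line_omega i))) => x.
by ring.
Qed.

Lemma C1_line_gauss i tau : C1_line i (@gauss R n tau)
  (fun x => - (2 * tau * x ord0 i * gauss tau x)).
Proof.
have h := C1_lineZ tau (C1_lineB (C1_line_cst i 1) (C1_line_omega i)).
have dP (x : 'rV[R]_n) : is_derive (tau * (1 - omega x)) (1 : R) expR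
  (expR (tau * (1 - omega x))) by exact: is_derive_expR.
have cP (x : 'rV[R]_n) : {for tau * (1 - omega x), continuous (@expR R)}.
  exact: continuous_expR.
apply: (C1_line_ext (C1_lineZ (Num.sqrt (tau / pi) ^+ n) (C1_line_comp dP cP h))) => x.
by rewrite /gauss; ring.
Qed.

Lemma omega_line_pinfty i (x : 'rV[R]_n) (A : R) :
  exists M : R, forall s, M <= `|s| -> A <= omega (x + s *: e_ i).
Proof.
exists (`|A| + 1 + `|x ord0 i|) => s Ms.
have h1 : `|A| + 1 <= `|x ord0 i + s|.
  by rewrite [x ord0 i + s]addrC; have := lerB_normD s (x ord0 i); lra.
have h2 : (x ord0 i + s) ^+ 2 <= omega (x + s *: e_ i).
  rewrite /omega (bigD1 i)//= !mxE !eqxx mulr1 addrCA lerDl addr_ge0//.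
  by apply: sumr_ge0 => j _; exact: sqr_ge0.
apply: le_trans h2; apply: (le_trans (ler_norm A)).
rewrite -real_normK ?num_real//.
have A0 := normr_ge0 A; nra.
Qed.

Lemma vanish_line_decay i G (K d : R) : 0 < d ->
  (forall x, `|G x| <= K * omega x `^ (- d)) -> vanish_line i G.
Proof.
move=> d0 GK x.
have key e : 0 < e -> exists M, forall s, M <= `|s| -> `|G (x + s *: e_ i)| < e.
  move=> e0.
  have K1 : 0 < `|K| + 1 by rewrite ltr_wpDl.
  pose A := (e / (2 * (`|K| + 1))) `^ (- d^-1).
  have [M MP] := omega_line_pinfty i x A.
  exists M => s /MP As; apply: le_lt_trans (GK _) _.
  have h : omega (x + s *: e_ i) `^ (- d) <= e / (2 * (`|K| + 1)).
    have -> : e / (2 * (`|K| + 1)) = A `^ (- d).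
      by rewrite -powRrM mulrNN mulVf ?gt_eqF// powRr1// divr_ge0// ltW// mulr_gt0.
    rewrite !powRN lef_pV2 ?posrE ?powR_gt0 ?omega_gt0//.
      by rewrite ge0_ler_powR ?nnegrE ?powR_ge0 ?(ltW d0) ?(ltW (omega_gt0 _)).
    by rewrite divr_gt0// mulr_gt0.
  apply: (@le_lt_trans _ _ ((`|K| + 1) * (e / (2 * (`|K| + 1))))).
    apply: (@le_trans _ _ ((`|K| + 1) * omega (x + s *: e_ i) `^ (- d))).
      by rewrite ler_wpM2r ?powR_ge0// (le_trans (ler_norm _))// lerDl.
    by rewrite ler_wpM2l// ltW.
  rewrite [ltLHS](_ : _ = e / 2); last by field; rewrite gt_eqF.
  by rewrite ltr_pdivrMr// ltr_pMr// ltr1n.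
split; apply/cvgrPdist_lt => e e0; have [M MP] := key e e0.
- near=> s; rewrite sub0r normrN; apply: MP.
  by rewrite (le_trans _ (ler_norm s))//; near: s; exact: nbhs_pinfty_ge.
- near=> s; rewrite sub0r normrN; apply: MP.
  rewrite -normrN (le_trans _ (ler_norm (- s)))// lerNr.
  by near: s; apply: nbhs_ninfty_le; exact: num_real.
Unshelve. all: by end_near. Qed.

End C1_line_rules.

(** * The Gaussian Poincaré inequality with a second-order gain *)

Section gauss_improved.
Context {R : realType} (n : nat) (tau : R).
Hypothesis t0 : 0 < tau.
Notation E := (wE (lebesgue_rV n) (gauss tau)).
Notation pg := (pgrowth (@omega R n)).
Let om1 := @omega_ge1 R n.
Let mw := mw_gauss n t0.

Lemma pgrowth_coord i : pg (fun x => x ord0 i).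
Proof.
apply: (@pgrowth_le _ _ _ _ _ (@omega R n)) => //.
- exact: measurable_coord.
- exact: pgrowth_om (@measurable_omega R n) om1.
- move=> x; rewrite (ger0_norm (ltW (omega_gt0 x))).
  have h : `|x ord0 i| ^+ 2 + 1 <= omega x.
    rewrite /omega (bigD1 i)//= real_normK ?num_real// [leLHS]addrC lerD2l lerDl.
    by apply: sumr_ge0 => j _; exact: sqr_ge0.
  have := sqr_ge0 (`|x ord0 i| - 1); have := normr_ge0 (x ord0 i); nra.
Qed.

(** Stein's identity: the integral of the i-th derivative of F times the Gaussian density is zero,
    the product vanishing at infinity. *)
Lemma gauss_ibp i F dF : C1_line i F dF -> pg F -> pg dF ->
  E dF = 2 * tau * E (fun x => x ord0 i * F x).
Proof.
move=> Fi Fp dFp.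
have xFp : pg (fun x => x ord0 i * F x) by exact: pgrowthM (pgrowth_coord i) Fp.
pose dG x := dF x * gauss tau x + F x * - (2 * tau * x ord0 i * gauss tau x).
have GP : C1_line i (fun x => F x * gauss tau x) dG := C1_lineM Fi (C1_line_gauss i tau).
have dGE x : dG x = (dF x - 2 * tau * (x ord0 i * F x)) * gauss tau x.
  by rewrite /dG; ring.
have dGp := pgrowthB om1 dFp (pgrowthZ om1 (2 * tau) xFp).
have G0 : vanish_line i (fun x => F x * gauss tau x).
  have [K K0 KP] := pgrowth_gauss_decay t0 om1 Fp.
  apply: (@vanish_line_decay _ _ _ _ (Num.sqrt (tau / pi) ^+ n * K) 1) => // x.
  rewrite powRN powRr1 ?(ltW (omega_gt0 x))// normrM (ger0_norm (gauss_ge0 _ _)).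
  by rewrite /gauss mulrCA -mulrA ler_wpM2l ?exprn_ge0.
have dGi : (lebesgue_rV n).-integrable setT (EFin \o dG).
  have := pg_integrable mw dGp; congr (_.-integrable _ _).
  by apply/funext => x /=; rewrite dGE.
have := integral_line0 GP G0 dGi.
have -> : (\int[lebesgue_rV n]_x (dG x)%:E)%E =
    (E (fun x => dF x - 2 * tau * (x ord0 i * F x)))%:E.
  rewrite fineK; last exact: integrable_fin_num (pg_integrable mw dGp).
  by apply: eq_integral => x _; rewrite dGE.
rewrite (wEB mw)//; last exact: pgrowthZ.
by rewrite (wEZ mw)// => -[] /eqP; rewrite subr_eq0 => /eqP.
Qed.

(** 2 tau |x|^2 - n, the radial second Hermite polynomial: the eigenfunction of the
    Ornstein-Uhlenbeck operator with eigenvalue 4 tau, twice the first one. *)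
Definition hermite2 (x : 'rV[R]_n) : R := 2 * tau * (omega x - 1) - n%:R.

Lemma pgrowth_omega : pg (@omega R n).
Proof. exact: pgrowth_om (@measurable_omega R n) om1. Qed.

Lemma pgrowth_hermite2 : pg hermite2.
Proof.
apply: pgrowthB => //; last exact: pgrowth_cst.
by apply: pgrowthZ => //; apply: pgrowthB => //; [exact: pgrowth_omega|exact: pgrowth_cst].
Qed.

(** Stein's identity applied to x_i F and summed over i: pairing with [hermite2] measures the radial
    derivative of F. With F = 1 it yields the mean of [hermite2], with F = [hermite2] its square
    norm 2n. *)
Lemma gauss_euler F dF : (forall i, C1_line i F (dF i)) -> pg F ->
  (forall i, pg (dF i)) ->
  E (fun x => \sum_(i < n) x ord0 i * dF i x) = E (fun x => F x * hermite2 x).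
Proof.
move=> Fi Fp dFp.
have pxd i : pg (fun x => x ord0 i * dF i x) by exact: pgrowthM (pgrowth_coord i) (dFp i).
have pxF i : pg (fun x => x ord0 i * F x) by exact: pgrowthM (pgrowth_coord i) Fp.
have pxxF i : pg (fun x => x ord0 i * (x ord0 i * F x)).
  exact: pgrowthM (pgrowth_coord i) (pxF i).
rewrite (wE_sum mw)//.
have step i : E (fun x => x ord0 i * dF i x) =
    E (fun x => 2 * tau * (x ord0 i * (x ord0 i * F x)) - F x).
  have h := C1_lineM (C1_line_coord i i) (Fi i).
  have h2 : pg (fun x => (i == i)%:R * F x + x ord0 i * dF i x).
    by apply: pgrowthD => //; exact: pgrowthZ.
  have := gauss_ibp h (pxF i) h2.
  rewrite (wED mw)//; last exact: pgrowthZ.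
  rewrite (wEZ mw)// eqxx mul1r (wEB mw)//; last exact: pgrowthZ.
  by rewrite (wEZ mw)// => <-; rewrite addrAC subrr add0r.
under eq_bigr do rewrite step.
rewrite -(wE_sum mw); last by move=> i; apply: pgrowthB => //; exact: pgrowthZ.
congr wE; apply/funext => x; rewrite sumrB sumr_const card_ord -mulr_sumr.
under eq_bigr do rewrite mulrA -expr2.
rewrite -mulr_suml /hermite2 /omega -[F x *+ n]mulr_natr; ring.
Qed.

Let qp := pgrowth_hermite2.

Let C1_hermite2 i : C1_line i hermite2 (fun x => 4 * tau * x ord0 i).
Proof.
have := C1_lineB (C1_lineZ (2 * tau) (C1_lineB (C1_line_omega i) (C1_line_cst i 1)))
  (C1_line_cst i n%:R).
by move/C1_line_ext; apply => x; ring.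
Qed.

Lemma gauss_hermite2_mean : E hermite2 = 0.
Proof.
have p1 : pg (fun=> 1) by exact: pgrowth_cst.
have p0 (i : 'I_n) : pg (fun=> 0) by exact: pgrowth_cst.
have := gauss_euler (fun i => C1_line_cst i 1) p1 p0.
have -> : (fun x : 'rV[R]_n => \sum_(i < n) x ord0 i * 0) = cst 0.
  by apply/funext => x; rewrite big1// => i _; rewrite mulr0.
rewrite (wE_cst mw) => ->; congr wE.
by apply/funext => x; rewrite mul1r.
Qed.

Lemma gauss_hermite2_sqr : E (fun x => hermite2 x ^+ 2) = 2 * n%:R.
Proof.
have dqp i : pg (fun x => 4 * tau * x ord0 i) by apply: pgrowthZ => //; exact: pgrowth_coord.
have := gauss_euler C1_hermite2 qp dqp.
have -> : (fun x : 'rV[R]_n => \sum_(i < n) x ord0 i * (4 * tau * x ord0 i)) =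
    (fun x => 2 * hermite2 x + cst (2 * n%:R) x).
  apply/funext => x; under eq_bigr do rewrite mulrCA -expr2.
  by rewrite -mulr_sumr /hermite2 /omega /=; ring.
rewrite (wED mw); [|exact: pgrowthZ|exact: pgrowth_cst].
by rewrite (wE_cst mw) (wEZ mw)// gauss_hermite2_mean mulr0 add0r => ->.
Qed.

(** Apply the Poincaré inequality to F minus its projection on [hermite2]. Along that eigenfunction
    the energy is 4 tau times the variance instead of 2 tau, so the variance of the projection is
    gained once more. The second inequality is Bessel's. *)
Theorem gauss_poincare_improved F dF : (0 < n)%N ->
  (forall i, C1_line i F (dF i)) -> pg F -> (forall i, pg (dF i)) ->
  let V := E (fun x => F x ^+ 2) - E F ^+ 2 in
  let c := E (fun x => F x * hermite2 x) in
  2 * tau * (V + c ^+ 2 / (2 * n%:R)) <= E (fun x => \sum_(i < n) dF i x ^+ 2) /\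
  c ^+ 2 / (2 * n%:R) <= V.
Proof.
move=> n0 Fi Fp dFp V c.
(* The projection coefficient, [hermite2] having square norm 2n. *)
pose s := c / (2 * n%:R).
have nR : 0 < n%:R :> R by rewrite ltr0n.
pose G x := F x - s * hermite2 x.
pose dG i x := dF i x - s * (4 * tau * x ord0 i).
have Gi i : C1_line i G (dG i) := C1_lineB (Fi i) (C1_lineZ s (C1_hermite2 i)).
have sqp := pgrowthZ om1 s qp.
have Gp : pg G by exact: pgrowthB.
have xp := pgrowth_coord.
have dGp i : pg (dG i) by apply: pgrowthB => //; apply: pgrowthZ => //; exact: pgrowthZ.
have EG : E G = E F.
  by rewrite (wEB mw)// (wEZ mw)// gauss_hermite2_mean mulr0 subr0.
have F2p := pgrowthX om1 2 Fp; have q2p := pgrowthX om1 2 qp.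
have Fqp := pgrowthM om1 Fp qp.
have EG2 : E (fun x => G x ^+ 2) = E (fun x => F x ^+ 2) - c ^+ 2 / (2 * n%:R).
  have -> : (fun x => G x ^+ 2) = (fun x => F x ^+ 2 -
      (2 * s * (F x * hermite2 x) - s ^+ 2 * hermite2 x ^+ 2)).
    by apply/funext => x; rewrite /G; ring.
  rewrite (wEB mw)//; last by apply: pgrowthB => //; exact: pgrowthZ.
  rewrite (wEB mw) ?(wEZ mw)//; [|exact: pgrowthZ|exact: pgrowthZ].
  rewrite gauss_hermite2_sqr -/c /s; field; by rewrite gt_eqF.
have pxd i : pg (fun x => x ord0 i * dF i x) by exact: pgrowthM.
have d2p i := pgrowthX om1 2 (dFp i).
(* The cross term is the mean of x . dF, which [gauss_euler] identifies with c; the two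
   contributions -4 and +2 leave -2 tau c^2 / n. *)
have EdG : E (fun x => \sum_(i < n) dG i x ^+ 2) =
    E (fun x => \sum_(i < n) dF i x ^+ 2) - 2 * tau * (c ^+ 2 / n%:R).
  have -> : (fun x => \sum_(i < n) dG i x ^+ 2) =
     (fun x => \sum_(i < n) dF i x ^+ 2 - (8 * tau * s *
       (\sum_(i < n) x ord0 i * dF i x) - (8 * tau * s ^+ 2 * hermite2 x +
        cst (8 * tau * s ^+ 2 * n%:R) x))).
    apply/funext => x; rewrite /hermite2 /omega /=.
    have dGE i : dG i x ^+ 2 = dF i x ^+ 2 - (8 * tau * s * (x ord0 i * dF i x) -
        16 * tau ^+ 2 * s ^+ 2 * x ord0 i ^+ 2) by rewrite /dG; ring.
    rewrite (eq_bigr _ (fun i _ => dGE i)) !sumrB -!mulr_sumr; ring.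
  have p1 : pg (fun x => \sum_(i < n) x ord0 i * dF i x) by exact: pgrowth_sum.
  have p2 : pg (fun x => 8 * tau * s ^+ 2 * hermite2 x + cst (8 * tau * s ^+ 2 * n%:R) x).
    by apply: pgrowthD => //; [exact: pgrowthZ|exact: pgrowth_cst].
  rewrite (wEB mw); last 2 first.
  - exact: pgrowth_sum.
  - by apply: pgrowthB => //; exact: pgrowthZ.
  rewrite (wEB mw)//; last exact: pgrowthZ.
  rewrite (wEZ mw)// (wED mw); last 2 first.
  - exact: pgrowthZ.
  - exact: pgrowth_cst.
  rewrite (wEZ mw)// gauss_hermite2_mean (wE_cst mw) (gauss_euler Fi Fp dFp) -/c /s.
  by field; rewrite gt_eqF.
split.
- have := gauss_poincare t0 Gi Gp dGp; rewrite EdG EG2 EG /V.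
  have -> : c ^+ 2 / n%:R = 2 * (c ^+ 2 / (2 * n%:R)) by field; rewrite gt_eqF.
  move: (c ^+ 2 / _) => u; lra.
- by have := wE_var_ge0 mw Gp; rewrite EG2 EG /V; lra.
Qed.

End gauss_improved.

(** * Euler's Gamma integral *)

Section gamma_integral.
Context {R : realType}.
Notation leb := (@lebesgue_measure R).
Implicit Types (a b c t : R).

Lemma bigcup_segment_0y c : 0 < c ->
  \bigcup_k `[c / k.+3%:R, c * k.+2%:R]%classic = `]0, +oo[%classic :> set R.
Proof.
move=> c0; apply/seteqP; split=> x /=.
  move=> [k _ /=]; rewrite !in_itv/= andbT => /andP[+ _].
  by apply: lt_le_trans; rewrite divr_gt0.
rewrite in_itv/= andbT => x0.
exists (maxn (Num.truncn (c / x)) (Num.truncn (x / c))) => //=; rewrite in_itv/=.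
apply/andP; split.
- rewrite ler_pdivrMr// mulrC -ler_pdivrMr//.
  apply: le_trans (ltW (truncnS_gt _)) _.
  by rewrite ler_nat ltnS (leq_trans (leq_maxl _ (Num.truncn (x / c))))// leqW.
- rewrite mulrC -ler_pdivrMr//.
  apply: le_trans (ltW (truncnS_gt _)) _.
  by rewrite ler_nat ltnS (leq_trans (leq_maxr (Num.truncn (c / x)) _))// leqW.
Qed.

Definition gamma_int b : \bar R :=
  (\int[leb]_(t in `]0%R, +oo[) (t `^ (b - 1) * expR (- t))%:E)%E.

Lemma measurable_powR_expR b y :
  measurable_fun setT (fun t : R => t `^ b * expR (- (y * t))).
Proof.
apply: measurable_funM; first exact: measurable_powR.
apply: measurableT_comp; first exact: measurable_expR.
by apply: measurableT_comp => //; apply: measurable_funM => //; exact: measurable_cst.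
Qed.

Lemma powR_le_expR b : exists2 K, 0 <= K & forall t, 1 <= t -> t `^ b <= K * expR (t / 2).
Proof.
pose k := (Num.truncn `|b|).+1.
exists (k`!%:R * 2 ^+ k) => [|t t1]; first by rewrite mulr_ge0 ?exprn_ge0.
have t0 : 0 <= t by exact: le_trans t1.
apply: (@le_trans _ _ (t ^+ k)).
  rewrite -powR_mulrn// ler_powR// (le_trans (ler_norm b))//.
  exact/ltW/truncnS_gt.
have := exprn_le_expR k (divr_ge0 t0 (ler0n R 2)).
rewrite expr_div_n ler_pdivrMr ?exprn_gt0// => /le_trans; apply.
by rewrite mulrAC.
Qed.

Lemma cvg_powR_expR b c : 0 < c ->
  (c * k.+2%:R) `^ b * expR (- (c * k.+2%:R)) @[k --> \oo] --> 0.
Proof.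
move=> c0; have [K K0 KP] := powR_le_expR (b + 1).
apply: (@squeeze_cvgr _ _ _ _ (cst 0) (fun k => K / c / k.+1%:R)); last 2 first.
- exact: cvg_cst.
- exact: cvg_div_natS.
near=> k; rewrite mulr_ge0 ?powR_ge0 ?expR_ge0//=.
have ck0 : 0 < c * k.+2%:R by rewrite mulr_gt0.
have ck : 1 <= c * k.+2%:R.
  near: k; exists (Num.truncn c^-1) => // k /= kc.
  rewrite -ler_pdivrMl// mulr1 (le_trans (ltW (truncnS_gt _)))//.
  by rewrite ler_nat ltnS leqW.
have := KP _ ck; rewrite powRD ?powRr1 ?(ltW ck0) ?(gt_eqF ck0) ?implybT// => H.
apply: (@le_trans _ _ (K / (c * k.+2%:R))); last first.
  rewrite invfM mulrA ler_wpM2l ?divr_ge0 ?(ltW c0)//.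
  by rewrite lef_pV2 ?posrE// ler_nat.
rewrite ler_pdivlMr// mulrAC; apply: le_trans (ler_wpM2r (expR_ge0 _) H) _.
move: (c * _) ck0 => t t0; rewrite -[leRHS]mulr1 -[leLHS]mulrA ler_wpM2l//.
by rewrite -expRD expR_le1; lra.
Unshelve. all: by end_near. Qed.

Lemma cvg_powR0 b c : 0 < c -> 0 < b -> (c / k.+3%:R) `^ b @[k --> \oo] --> 0.
Proof.
move=> c0 b0.
have := cvg_at_rightP (fun x : R => x `^ b) 0 0.
case=> + _; move/(_ (powR_cvg0 b0) (fun k => c / k.+3%:R)); apply.
split=> [k|]; first by rewrite divr_gt0.
have := cvg_div_natS c; rewrite -(cvg_shiftn 2) /=.
by under eq_fun do rewrite addn2.
Qed.

Lemma gamma_int_ge0 b : (0 <= gamma_int b)%E.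
Proof. by apply: integral_ge0 => t _; rewrite lee_fin mulr_ge0 ?powR_ge0 ?expR_ge0. Qed.

Let cont_powR b t : 0 < t -> {for t, continuous (fun x : R => x `^ b)}.
Proof. by move=> t0; exact: der_continuous (is_derive1_powR b t0). Qed.

Let cont_expRN t : {for t, continuous (fun x : R => expR (- x))}.
Proof.
apply: continuous_comp; first exact: continuousN.
exact: continuous_expR.
Qed.

(** The primitive t^b e^(-t) is used in both directions, so the equality holds in the extended reals
    and can carry finiteness from b + 1 down to b. *)
Lemma gamma_intS b : 0 < b -> gamma_int (b + 1) = (b%:E * gamma_int b)%E.
Proof.
move=> b0; pose ps t := t `^ b * expR (- t).
pose A t := b * (t `^ (b - 1) * expR (- t)); pose dps t := A t - ps t.
have D0 := @bigcup_segment_0y 1 ltr01.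
have lr k : 1 / k.+3%:R < 1 * k.+2%:R :> R.
  by rewrite mul1r mul1r (@lt_le_trans _ _ 1) ?invf_lt1 ?ltr1n ?ler1n.
have nd k : `[1 / k.+3%:R, 1 * k.+2%:R] `<=` `[1 / k.+4%:R, 1 * k.+3%:R : R].
  move=> x /=; rewrite !in_itv/= !mul1r => /andP[x1 x2]; apply/andP; split.
    by apply: le_trans x1; rewrite lef_pV2 ?posrE// ler_nat.
  by apply: (le_trans x2); rewrite ler_nat.
have pos (x : R) : (\bigcup_k `[1 / k.+3%:R, (1 * k.+2%:R : R)]%classic) x -> 0 < x.
  by rewrite D0 /= in_itv/= andbT.
have dE t : 0 < t -> is_derive t (1 : R) ps (dps t).
  move=> tt0.
  apply: (der_eq (derM (is_derive1_powR b tt0)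
    (der_comp (f := expR) (is_derive_expR _) (derN (der_id t))))).
  by rewrite /dps /A /ps; ring.
have cps t : 0 < t -> {for t, continuous ps} by move=> /dE /der_continuous.
have cA t : 0 < t -> {for t, continuous A}.
  move=> tt0; apply: contM; first exact: cont_cst.
  by apply: contM; [exact: cont_powR|exact: cont_expRN].
have A0 t : 0 <= A t by rewrite !mulr_ge0 ?powR_ge0 ?expR_ge0// ltW.
have ps0 t : 0 <= ps t by rewrite !mulr_ge0 ?powR_ge0 ?expR_ge0// ltW.
have psr : ps (1 * k.+2%:R) @[k --> \oo] --> 0 by exact: cvg_powR_expR.
have psl : ps (1 / k.+3%:R) @[k --> \oo] --> 0.
  apply: (@squeeze_cvgr _ _ _ _ (cst 0) (fun k => (1 / k.+3%:R) `^ b)).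
  - by apply: nearW => k; rewrite ps0/= ler_piMr ?powR_ge0// expR_le1 oppr_le0.
  - exact: cvg_cst.
  - exact: cvg_powR0.
have psd : ps (1 * k.+2%:R) - ps (1 / k.+3%:R) @[k --> \oo] --> 0.
  by rewrite -[X in _ --> X]subr0; exact: cvgB.
have main : (\int[leb]_(x in `]0%R, +oo[) (A x)%:E = \int[leb]_(x in `]0%R, +oo[) (ps x)%:E)%E.
  rewrite -D0; apply/eqP; rewrite eq_le; apply/andP; split.
  - have dE' t : 0 < t -> is_derive t (1 : R) (fun x => - ps x) (- dps t).
      by move=> /dE ?; exact: derN.
    have psdN : - ps (1 * k.+2%:R) - - ps (1 / k.+3%:R) @[k --> \oo] --> 0.
      by rewrite -oppr0; under eq_fun do rewrite -opprD; exact: cvgN.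
    apply: (ge0_integral_le_primitive lr nd (fun x xD => dE' x (pos x xD)) _ _ _ _ _ _ psdN) => //.
    + by move=> x /pos x0; apply: continuousN; apply: contB; [exact: cA|exact: cps].
    + by move=> x /pos; exact: cps.
    + by move=> x /pos; exact: cA.
    + by move=> x _; rewrite /dps; lra.
  - apply: (ge0_integral_le_primitive lr nd (fun x xD => dE x (pos x xD)) _ _ _ _ _ _ psd) => //.
    + by move=> x /pos x0; apply: contB; [exact: cA|exact: cps].
    + by move=> x /pos; exact: cA.
    + by move=> x /pos; exact: cps.
    + by move=> x _; rewrite /dps; lra.
rewrite /gamma_int -ge0_integralZl//; last 3 first.
- apply/measurable_EFinP; apply: measurable_funTS.
  by have := measurable_powR_expR (b - 1) 1; under eq_fun do rewrite mul1r.
- by move=> x _; rewrite lee_fin mulr_ge0 ?powR_ge0 ?expR_ge0.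
- by rewrite lee_fin ltW.
by rewrite addrK -main; apply: eq_integral => x _; rewrite -EFinM.
Qed.

(** For parameters at least 1, compare with a multiple of the exponential density of rate 1/2; the
    remaining parameters in ]0, 1[ follow from the functional equation. *)
Lemma gamma_int_fin b : 0 < b -> (gamma_int b < +oo)%E.
Proof.
have ge1 c : 1 <= c -> (gamma_int c < +oo)%E.
  move=> c1; have [K K0 KP] := powR_le_expR (c - 1).
  have K1 : 0 <= 2 * (1 + K) by rewrite mulr_ge0// addr_ge0.
  have mpdf : measurable_fun setT (fun t => (2 * (1 + K) * exponential_pdf 2^-1 t)%:E).
    apply/measurable_EFinP; apply: measurable_funM; first exact: measurable_cst.
    exact: measurable_exponential_pdf.
  have pdf0 t : (0 <= (2 * (1 + K) * exponential_pdf 2^-1 t)%:E)%E.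
    by rewrite lee_fin mulr_ge0// exponential_pdf_ge0.
  apply: (@le_lt_trans _ _ (\int[leb]_(t in `]0%R, +oo[)
     (2 * (1 + K) * exponential_pdf 2^-1 t)%:E)%E).
    apply: ge0_le_integral => //.
    - by move=> t _; rewrite lee_fin mulr_ge0 ?powR_ge0 ?expR_ge0.
    - apply/measurable_EFinP; apply: measurable_funTS.
      by have := measurable_powR_expR (c - 1) 1; under eq_fun do rewrite mul1r.
    - exact: measurable_funTS.
    - move=> t; rewrite /= in_itv/= andbT => tt0; rewrite lee_fin.
      rewrite exponential_pdfE ?(ltW tt0)// [leRHS](_ : _ = (1 + K) * expR (- 2^-1 * t)); last by field.
      have -> : expR (- t) = (expR (t / 2))^-1 * expR (- 2^-1 * t).
        by rewrite -expRN -expRD; congr expR; field.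
      rewrite mulrA ler_wpM2r ?expR_ge0// ler_pdivrMr ?expR_gt0//.
      have e1 : 1 <= expR (t / 2) by rewrite -[leLHS]expR0 ler_expR divr_ge0// ltW.
      have e0 := expR_ge0 (t / 2).
      have [t1|t1] := leP 1 t; first by rewrite mulrDl mul1r (le_trans (KP _ t1))// lerDr.
      have h1 : t `^ (c - 1) <= 1.
        apply: (@le_trans _ _ (1 `^ (c - 1))); last by rewrite powR1.
        by rewrite ge0_ler_powR ?subr_ge0 ?nnegrE ?(ltW tt0) ?(ltW t1).
      nra.
  apply: (@le_lt_trans _ _ (\int[leb]_t (2 * (1 + K) * exponential_pdf 2^-1 t)%:E)%E).
    by apply: ge0_subset_integral => //=; exact: measurable_itv.
  under eq_integral do rewrite EFinM.
  rewrite ge0_integralZl//.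
  - by rewrite integral_exponential_pdf ?invr_gt0// mule1 ltry.
  - by apply/measurable_EFinP; exact: measurable_exponential_pdf.
  - by move=> t _; rewrite lee_fin exponential_pdf_ge0.
move=> b0; have := ge1 (b + 1); rewrite gamma_intS// lerDr => /(_ (ltW b0)).
have := gamma_int_ge0 b; case: (gamma_int b) => [x _ _|_|//]; first by rewrite ltry.
by rewrite gt0_muley ?lte_fin.
Qed.

Lemma gamma_int_gt0 b : (0 < gamma_int b)%E.
Proof.
have m1 : measurable `[1%R, 2%R : R] by exact: measurable_itv.
rewrite (@lt_le_trans _ _ (\int[leb]_(t in `[1%R, 2%R])
  (Num.min 1 (2 `^ (b - 1)) * expR (- 2))%:E)%E)//.
  have L : leb `[1%R, 2%R]%classic = 1%E.
    rewrite lebesgue_measure_itv/= lte_fin ltr1n -EFinD; congr _%:E; ring.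
  rewrite integral_cst// [X in (_ * X)%E]L mule1 lte_fin mulr_gt0 ?expR_gt0//.
apply: (@le_trans _ _ (\int[leb]_(t in `[1%R, 2%R]) (t `^ (b - 1) * expR (- t))%:E)%E).
  apply: ge0_le_integral => //.
  - apply/measurable_EFinP; apply: measurable_funTS.
    by have := measurable_powR_expR (b - 1) 1; under eq_fun do rewrite mul1r.
  - move=> t; rewrite /= in_itv/= => /andP[t1 t2]; rewrite lee_fin ler_pM ?expR_ge0//.
    + rewrite ge_min; have [bp|bn] := leP 0 (b - 1).
        by rewrite -{1}(powRr0 t) ler_powR.
      apply/orP; right; rewrite -(opprK (b - 1)) !(powRN _ (- (b - 1))).
      rewrite lef_pV2 ?posrE ?powR_gt0 ?(lt_le_trans ltr01)//.
      by rewrite ge0_ler_powR ?nnegrE ?(le_trans ler01 t1)// oppr_ge0 ltW.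
    + by rewrite ler1n.
    + by rewrite ler_expR lerN2.
apply: ge0_subset_integral => //=.
- apply/measurable_EFinP; apply: measurable_funTS.
  by have := measurable_powR_expR (b - 1) 1; under eq_fun do rewrite mul1r.
- by move=> t _; rewrite lee_fin mulr_ge0 ?powR_ge0 ?expR_ge0.
- move=> t /=; rewrite !in_itv/= andbT => /andP[t1 _]; exact: lt_le_trans t1.
Qed.

Definition Gam b : R := fine (gamma_int b).

Lemma GamE b : 0 < b -> gamma_int b = (Gam b)%:E.
Proof.
by move=> b0; rewrite fineK// ge0_fin_numE ?gamma_int_fin// gamma_int_ge0.
Qed.

Lemma Gam_gt0 b : 0 < b -> 0 < Gam b.
Proof. by move=> b0; rewrite -lte_fin -GamE// gamma_int_gt0. Qed.

Lemma GamS b : 0 < b -> Gam (b + 1) = b * Gam b.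
Proof. by move=> b0; rewrite /Gam gamma_intS// GamE. Qed.

(** Substitution t := y t. With 1 <= b the integrand is continuous up to 0, as the substitution rule
    on the closed half-line asks. *)
Lemma gamma_int_scale b y : 1 <= b -> 0 < y ->
  (\int[leb]_(t in `]0%R, +oo[) (t `^ (b - 1) * expR (- (y * t)))%:E =
   (y `^ (- b) * Gam b)%:E)%E.
Proof.
move=> b1 y0; pose G t : R := t `^ (b - 1) * expR (- t).
pose F t : R := y * t.
have mG c x : measurable_fun setT (fun t : R => (c * (t `^ (b - 1) * expR (- (x * t))))%:E).
  apply/measurable_EFinP; apply: measurable_funM; first exact: measurable_cst.
  exact: measurable_powR_expR.
have dF t : is_derive t (1 : R) F y.
  by apply: (der_eq (derM (der_cst y t) (der_id t))); rewrite mul0r mulr1 add0r.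
have dFE : F^`()%classic = cst y.
  by apply/funext => t; rewrite derive1E; have [] := dF t.
have b0 : 0 < b by exact: lt_le_trans b1.
have := @increasing_ge0_integration_by_substitutiony R F G 0.
have -> : F 0 = 0 by rewrite /F mulr0.
rewrite dFE => H.
have {}H : (\int[leb]_(x in `[0%R, +oo[) (G x)%:E =
    \int[leb]_(x in `[0%R, +oo[) ((G \o F) x * cst y x)%:E)%E.
  apply: H.
  - by move=> s t _ _ st; rewrite /F ltr_pM2l.
  - by move=> t _; exact: cst_continuous.
  - exact: is_cvg_cst.
  - exact: is_cvg_cst.
  - split; first by move=> t _; have [] := dF t.
    by apply: cvg_at_right_filter; exact: der_continuous (dF 0).
  - apply/cvgryPge => A; apply: filterS (nbhs_pinfty_ge (num_real (A / y))) => t.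
    by rewrite /F ler_pdivrMr// mulrC.
  - apply/continuous_within_itvcyP; split.
      move=> t; rewrite in_itv/= andbT => tt0.
      have cG : {for t, continuous G}.
        by apply: contM; [exact: cont_powR|exact: cont_expRN].
      exact: cG.
    rewrite /G; apply: cvgM; last first.
      by apply: cvg_at_right_filter; exact: cont_expRN.
    have [->|bn1] := eqVneq b 1.
      by rewrite subrr; under eq_fun do rewrite powRr0; rewrite powRr0; exact: cvg_cst.
    have b10 : 0 < b - 1 by rewrite subr_gt0 lt_neqAle eq_sym bn1.
    by rewrite powR0 ?gt_eqF//; exact: powR_cvg0.
  - by move=> t _; rewrite mulr_ge0 ?powR_ge0 ?expR_ge0.
have mG1 : measurable_fun setT (EFin \o G).
  have := mG 1 1; congr (measurable_fun _ _).
  by apply/funext => t; rewrite /= !mul1r.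
have E1 : gamma_int b = (\int[leb]_(x in `[0%R, +oo[) (G x)%:E)%E.
  by rewrite -integral_itv_obnd_cbnd//; exact: measurable_funTS.
have E2 : (\int[leb]_(x in `[0%R, +oo[) ((G \o F) x * cst y x)%:E =
   \int[leb]_(x in `]0%R, +oo[) ((y `^ b)%:E * (x `^ (b - 1) * expR (- (y * x)))%:E))%E.
  rewrite -integral_itv_obnd_cbnd; last first.
    apply: measurable_funTS; apply/measurable_EFinP; apply: measurable_funM.
      apply: (measurableT_comp (f := G)); first exact/measurable_EFinP.
      by apply: measurable_funM => //; exact: measurable_cst.
    exact: measurable_cst.
  apply: eq_integral => t; rewrite inE/= in_itv/= andbT => tt0.
  rewrite /G /F -EFinM powRM ?(ltW y0) ?(ltW tt0)//.
  have -> : y `^ b = y `^ (b - 1) * y.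
    have := @powRD R y (b - 1) 1; rewrite subrK powRr1 ?(ltW y0)// => -> //.
    by rewrite gt_eqF ?implybT.
  by congr _%:E; rewrite /cst; ring.
rewrite EFinM -GamE// E1 H E2 ge0_integralZl//.
- by rewrite muleA -EFinM powRN mulVf ?mul1e// gt_eqF// powR_gt0.
- apply: measurable_funTS; have := mG 1 y; congr (measurable_fun _ _).
  by apply/funext => t; rewrite mul1r.
- by move=> t _; rewrite lee_fin mulr_ge0 ?powR_ge0 ?expR_ge0.
- by rewrite lee_fin powR_ge0.
Qed.

End gamma_integral.

(** * A weighted Poincaré inequality for the Gamma law *)

Section gamma_poincare.
Context {R : realType}.
Notation leb := (@lebesgue_measure R).
Notation D0 := (`]0%R, +oo[%classic : set R).
Implicit Types (a b c t : R).

Lemma powR_mul t b c : 0 < t -> t `^ b * t `^ c = t `^ (b + c).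
Proof. by move=> tt0; rewrite powRD// (gt_eqF tt0) implybT. Qed.

Lemma measurable_powR_expRN c :
  measurable_fun setT (fun t : R => t `^ c * expR (- t)).
Proof. by have := @measurable_powR_expR R c 1; under eq_fun do rewrite mul1r. Qed.

Lemma gamma_integrable b : 0 < b ->
  leb.-integrable D0 (fun t => (t `^ (b - 1) * expR (- t))%:E).
Proof.
move=> b0; apply/integrableP; split.
  by apply/measurable_EFinP; apply: measurable_funTS; exact: measurable_powR_expRN.
under eq_integral do rewrite gee0_abs ?lee_fin ?mulr_ge0 ?powR_ge0 ?expR_ge0//.
exact: gamma_int_fin.
Qed.

Lemma gamma_integrable_le (F : R -> R) b K : 0 < b -> measurable_fun D0 F ->
  (forall t, 0 < t -> `|F t| <= K * (t `^ (b - 1) * (1 + t) ^+ 2 * expR (- t))) ->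
  leb.-integrable D0 (fun t => (F t)%:E).
Proof.
move=> b0 mF FK.
have i1 := gamma_integrable b0.
have i2 := @gamma_integrable (b + 1) (ltr_wpDr ler01 b0).
have i3 := @gamma_integrable (b + 2) (ltr_wpDr (ler0n _ 2) b0).
have mD : measurable (D0 : set (measurableTypeR R)) by exact: measurable_itv.
have iS := integrableD mD i1 (integrableD mD (integrableZl mD 2 i2) i3).
have := integrableZl mD K iS.
apply: le_integrable => //; first exact/measurable_EFinP.
move=> t /=; rewrite in_itv/= andbT => tt0.
rewrite -[leRHS]/(`|(K * (t `^ (b - 1) * expR (- t) +
  (2 * (t `^ (b + 1 - 1) * expR (- t)) + t `^ (b + 2 - 1) * expR (- t))))%:E|)%E.
rewrite !abse_EFin lee_fin; apply: le_trans (ler_norm _).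
apply: (le_trans (FK t tt0)); rewrite le_eqVlt; apply/orP; left; apply/eqP.
have e1 : t `^ (b + 1 - 1) = t `^ (b - 1) * t.
  by rewrite [in LHS]addrAC -(powR_mul (b - 1) 1 tt0) powRr1 ?ltW.
have e2 : t `^ (b + 2 - 1) = t `^ (b - 1) * t ^+ 2.
  by rewrite [in LHS]addrAC -(powR_mul (b - 1) 2 tt0) (powR_mulrn 2) ?ltW.
by rewrite e1 e2; ring.
Qed.

Variables (a d C : R) (M dM : R -> R).
Hypotheses (a1 : 1 < a) (d0 : 0 <= d) (da : 2 * d < a) (C0 : 0 <= C).
Hypothesis dMP : forall t, 0 < t -> is_derive t (1 : R) M (dM t).
Hypothesis cdM : forall t, 0 < t -> {for t, continuous dM}.
Hypothesis MC : forall t, 0 < t -> `|M t| <= C * t `^ (- d) * (1 + t).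
Let w t := t `^ (a - 1) * expR (- t).

Let w0 t : 0 <= w t. Proof. by rewrite mulr_ge0 ?powR_ge0 ?expR_ge0. Qed.

Let measurable_M : measurable_fun D0 M.
Proof.
apply: open_continuous_measurable_fun; first exact: interval_open.
by move=> t; rewrite inE/= in_itv/= andbT => /dMP /der_continuous.
Qed.

Let measurable_w : measurable_fun D0 w.
Proof. by apply: measurable_funTS; exact: measurable_powR_expRN. Qed.

Lemma gamma_integrable_wM : leb.-integrable D0 (fun t => (w t * M t)%:E).
Proof.
apply: (@gamma_integrable_le _ (a - d) C); first by move: d0 da; lra.
  exact: measurable_funM.
move=> t tt0; rewrite normrM (ger0_norm (w0 t)).
apply: (le_trans (ler_wpM2l (w0 t) (MC tt0))).
rewrite [leLHS](_ : _ = C * (t `^ (a - d - 1) * (1 + t) * expR (- t))).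
  rewrite ler_wpM2l// ler_wpM2r ?expR_ge0// ler_wpM2l ?powR_ge0//.
  by rewrite expr2 ler_peMr ?addr_ge0 ?(ltW tt0)// lerDl ltW.
by rewrite addrAC -(powR_mul _ _ tt0) /w; ring.
Qed.

(** The bound t^(-d) on M near 0 costs t^(-2d) after squaring, and 2d < a keeps the exponent
    integrable at 0. *)
Lemma gamma_integrable_wM2 : leb.-integrable D0 (fun t => (w t * M t ^+ 2)%:E).
Proof.
apply: (@gamma_integrable_le _ (a - 2 * d) (C ^+ 2)); first by move: d0 da; lra.
  by apply: measurable_funM => //; exact: measurable_funX.
move=> t tt0; rewrite normrM (ger0_norm (w0 t)) normrX.
have MC0 : 0 <= C * t `^ (- d) * (1 + t).
  by rewrite !mulr_ge0 ?powR_ge0// addr_ge0// ltW.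
have := ler_wpM2l (w0 t) (lerXn2r 2 (normr_ge0 _) MC0 (MC tt0)).
move/le_trans; apply; rewrite le_eqVlt; apply/orP; left; apply/eqP.
have -> : a - 2 * d - 1 = (a - 1) + (- d + - d) by ring.
by rewrite -(powR_mul (a - 1) _ tt0) -(powR_mul (- d) (- d) tt0) /w; ring.
Qed.

Let der_w t : 0 < t -> is_derive t (1 : R) w ((a - 1 - t) / t * w t).
Proof.
move=> tt0.
apply: (der_eq (derM (is_derive1_powR (a - 1) tt0)
    (der_comp (f := expR) (is_derive_expR _) (derN (der_id t))))).
have -> : t `^ (a - 1 - 1) = t `^ (a - 1) / t.
  by rewrite -[X in _ / X](powRr1 (ltW tt0)) -powRN powR_mul.
by rewrite /w; field; rewrite gt_eqF.
Qed.

Let cvg_right p c : 0 < p -> 0 < c ->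
  (c * k.+2%:R) `^ p * expR (- (c * k.+2%:R)) @[k --> \oo] --> 0.
Proof. by move=> _; exact: cvg_powR_expR. Qed.

Let cvg_left p c : 0 < p -> 0 < c ->
  (c / k.+3%:R) `^ p * expR (- (c / k.+3%:R)) @[k --> \oo] --> 0.
Proof.
move=> p0 c0; apply: (@squeeze_cvgr _ _ _ _ (cst 0) (fun k => (c / k.+3%:R) `^ p)).
- apply: nearW => k; rewrite mulr_ge0 ?powR_ge0 ?expR_ge0//=.
  by rewrite ler_piMr ?powR_ge0// expR_le1 oppr_le0 divr_ge0// ltW.
- exact: cvg_cst.
- exact: cvg_powR0.
Qed.

(** For the form with weight t^2 w the function 1/t is an eigenfunction with eigenvalue a - 1: its
    flux is -w, and w' = ((a - 1)/t - 1) w. Its centred version is proportional to 1 - (a - 1)/t,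
    which vanishes at z = a - 1; so the Hardy inequality is used at that point with E = (a - 1) t w,
    for which 1 - (a - 1)/t is extremal. *)
Theorem gamma_poincare :
  (\int[leb]_(t in D0) (w t * M t)%:E = 0)%E ->
  ((a - 1)%:E * \int[leb]_(t in D0) (w t * M t ^+ 2)%:E <=
   \int[leb]_(t in D0) (t ^+ 2 * w t * dM t ^+ 2)%:E)%E.
Proof.
move=> wM0; pose z := a - 1; have z0 : 0 < z by rewrite subr_gt0.
have mD : measurable (D0 : set (measurableTypeR R)) by exact: measurable_itv.
pose N t := M t - M z.
pose E t := (a - 1) * (t * w t).
pose dE t := (a - 1) * (a - t) * w t.
have DE := bigcup_segment_0y z0.
have Dpos (t : R) : (\bigcup_k `[z / k.+3%:R, z * k.+2%:R]%classic) t -> 0 < t.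
  by rewrite DE /= in_itv/= andbT.
pose C' := C + `|M z|.
have C'0 : 0 <= C' by rewrite addr_ge0.
have NC t : 0 < t -> `|N t| <= C' * ((1 + t `^ (- d)) * (1 + t)).
  move=> tt0; apply: le_trans (ler_normB _ _) _.
  have p0 := powR_ge0 t (- d); have q0 := normr_ge0 (M z).
  apply: le_trans (lerD (MC tt0) (lexx _)) _.
  have h1 : 0 <= C * (1 + t) by rewrite mulr_ge0// addr_ge0// ltW.
  have h2 : 0 <= `|M z| * (t + t `^ (- d) * (1 + t)).
    by rewrite mulr_ge0// addr_ge0 ?mulr_ge0 ?addr_ge0// ltW.
  rewrite /C'; lra.
(* A majorant of t w N^2 made of terms t^p e^(-t) with p > 0 (here 2d < a enters); each tends to 0
   at both ends of the half-line. *)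
pose S t := 4 * (t `^ a * expR (- t) + t `^ (a + 2) * expR (- t) +
  t `^ (a - 2 * d) * expR (- t) + t `^ (a - 2 * d + 2) * expR (- t)).
have SP t : 0 < t -> (t * w t) * N t ^+ 2 <= C' ^+ 2 * S t.
  move=> tt0.
  have h0 : 0 <= C' * ((1 + t `^ (- d)) * (1 + t)).
    by rewrite !mulr_ge0// addr_ge0 ?powR_ge0// ltW.
  have h1 : N t ^+ 2 <= (C' * ((1 + t `^ (- d)) * (1 + t))) ^+ 2.
    by rewrite -real_normK ?num_real// lerXn2r//; exact: NC.
  have tw0 : 0 <= t * w t by rewrite mulr_ge0// ltW.
  apply: (le_trans (ler_wpM2l tw0 h1)).
  rewrite exprMn mulrCA ler_wpM2l ?sqr_ge0// exprMn.
  have h2 : (1 + t `^ (- d)) ^+ 2 <= 2 * (1 + t `^ (- d) * t `^ (- d)).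
    by have := sqr_ge0 (1 - t `^ (- d)); lra.
  have h3 : (1 + t) ^+ 2 <= 2 * (1 + t ^+ 2) by have := sqr_ge0 (1 - t); lra.
  have h4 := ler_pM (sqr_ge0 _) (sqr_ge0 _) h2 h3.
  apply: (le_trans (ler_wpM2l tw0 h4)); rewrite le_eqVlt; apply/orP; left; apply/eqP.
  have t2 : t ^+ 2 = t `^ 2 by rewrite (powR_mulrn 2) ?ltW.
  have t1 : t = t `^ 1 by rewrite powRr1 ?ltW.
  have -> : t * w t = t `^ a * expR (- t).
    by rewrite {1}t1 /w mulrA powR_mul// addrCA subrr addr0.
  rewrite /S (_ : a - 2 * d = a + (- d + - d)); last by ring.
  rewrite -(powR_mul (a + (- d + - d)) 2 tt0) -(powR_mul a 2 tt0).
  by rewrite -(powR_mul a (- d + - d) tt0) -(powR_mul (- d) (- d) tt0) -t2; ring.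
pose psi t := E t * N t ^+ 2 / (t - z).
(* Along endpoints at distance at least z/2 from z the denominator of psi is harmless, and [S]
   forces the boundary term to 0. *)
have psiP (h : nat -> R) : (forall k, 0 < h k) -> (forall k, z / 2 <= `|h k - z|) ->
    (forall p, 0 < p -> h k `^ p * expR (- h k) @[k --> \oo] --> 0) ->
    psi (h k) @[k --> \oo] --> 0.
  move=> h0 hz hcvg; apply/norm_cvg0P.
  apply: (@squeeze_cvgr _ _ _ _ (cst 0) (fun k => 2 * C' ^+ 2 * S (h k))).
  - apply: nearW => k; rewrite normr_ge0/= /psi normrM normfV /E.
    have hk := h0 k; have tw : 0 <= h k * w (h k) by rewrite mulr_ge0// ltW.
    rewrite ger0_norm; last by rewrite mulr_ge0 ?sqr_ge0// mulr_ge0 ?(ltW z0).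
    have hzk : 0 < `|h k - z| by apply: lt_le_trans (hz k); rewrite divr_gt0.
    rewrite ler_pdivrMr// -mulrA.
    have S0 : 0 <= C' ^+ 2 * S (h k).
      by apply: le_trans (SP _ hk); rewrite mulr_ge0 ?sqr_ge0.
    apply: (le_trans (ler_wpM2l (ltW z0) (SP _ hk))).
    have := ler_wpM2r S0 (hz k); rewrite -/z; lra.
  - exact: cvg_cst.
  - rewrite -[X in _ --> X](mulr0 (2 * C' ^+ 2)); apply: cvgM; first exact: cvg_cst.
    rewrite /S -[X in _ --> X](mulr0 4); apply: cvgM; first exact: cvg_cst.
    rewrite -[X in _ --> X](addr0 0) -[X in _ --> X + _](addr0 0)
      -[X in _ --> X + _ + _](addr0 0).
    by apply: cvgD; [apply: cvgD; [apply: cvgD|]|]; apply: hcvg; move: d0 da a1; lra.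
have half (k : nat) : (k.+3%:R : R)^-1 <= 3^-1 by rewrite lef_pV2 ?posrE// ler_nat.
have half2 (k : nat) : ((2 * k.+1%:R)^-1 : R) <= 2^-1.
  by rewrite lef_pV2 ?posrE ?mulr_gt0// ler_peMr// ler1n.
have k2 (k : nat) : k.+2%:R = k%:R + 2 :> R by rewrite -addn2 natrD.
have psir : psi (z * k.+2%:R) @[k --> \oo] --> 0.
  apply: psiP => [k|k|p p0]; last exact: cvg_right.
  - by rewrite mulr_gt0.
  - rewrite ger0_norm; last by rewrite subr_ge0 ler_peMr ?ler1n// ltW.
    by rewrite -[X in _ - X]mulr1 -mulrBr ler_pM2l// k2; have := ler0n R k; lra.
have psil : psi (z / k.+3%:R) @[k --> \oo] --> 0.
  apply: psiP => [k|k|p p0]; last exact: cvg_left.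
  - by rewrite divr_gt0.
  - rewrite distrC ger0_norm; last first.
      by rewrite subr_ge0 ler_piMr ?(ltW z0)// (le_trans (half k))// invf_le1 ?ler1n.
    by rewrite -[X in X - _]mulr1 -mulrBr ler_pM2l//; have := half k;
      move: (k.+3%:R^-1) => u; lra.
have main : (\int[leb]_(t in D0) ((a - 1) * w t * N t ^+ 2)%:E <=
    \int[leb]_(t in D0) (t ^+ 2 * w t * dM t ^+ 2)%:E)%E.
  rewrite -DE.
  (* The endpoints z/(k+3) and z(k+2) lie strictly outside z -/+ z/(2(k+1)) already for k = 0, where
     they read z/3 < z/2 and 3z/2 < 2z. *)
  have leps k : z / k.+3%:R < z - z / (2 * k.+1%:R).
    rewrite -[X in _ < X - _]mulr1 -mulrBr ltr_pM2l//.
    by have := half k; have := half2 k; move: (k.+3%:R^-1) ((_ * k.+1%:R)^-1) => u v; lra.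
  have epsr k : z + z / (2 * k.+1%:R) < z * k.+2%:R.
    rewrite -[X in X + _]mulr1 -mulrDr ltr_pM2l//.
    by have := half2 k; rewrite k2; have := ler0n R k; move: ((_ * k.+1%:R)^-1) => v; lra.
  have ndl k : z / k.+4%:R <= z / k.+3%:R.
    by rewrite ler_pM2l// lef_pV2 ?posrE// ler_nat.
  have ndr k : z * k.+2%:R <= z * k.+3%:R by rewrite ler_pM2l// ler_nat.
  have eps0 k : 0 < z / (2 * k.+1%:R) by rewrite divr_gt0// mulr_gt0.
  have epsn k : z / (2 * k.+2%:R) <= z / (2 * k.+1%:R).
    by rewrite ler_pM2l// lef_pV2 ?posrE ?mulr_gt0// ler_pM2l// ler_nat.
  have epsc : z / (2 * k.+1%:R) @[k --> \oo] --> 0.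
    under eq_fun do rewrite invfM mulrA; exact: cvg_div_natS.
  have dNP t (tD : (\bigcup_k `[z / k.+3%:R, z * k.+2%:R]%classic) t) : is_derive t (1 : R) N (dM t).
    have H := derB (dMP (Dpos t tD)) (der_cst (M z) t).
    by rewrite subr0 in H; exact: H.
  have dEP t (tD : (\bigcup_k `[z / k.+3%:R, z * k.+2%:R]%classic) t) : is_derive t (1 : R) E (dE t).
    have tt0 := Dpos t tD.
    have H := derM (der_cst (a - 1) t) (derM (der_id t) (der_w tt0)).
    apply: (der_eq H).
    by rewrite /dE; field; rewrite gt_eqF.
  have cw t (tD : (\bigcup_k `[z / k.+3%:R, z * k.+2%:R]%classic) t) : {for t, continuous w} := der_continuous (der_w (Dpos t tD)).
  have cdE t (tD : (\bigcup_k `[z / k.+3%:R, z * k.+2%:R]%classic) t) : {for t, continuous dE}.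
    apply: contM; last exact: cw tD.
    apply: contM; first exact: cont_cst.
    by apply: contB; [exact: cont_cst|exact: cvg_id].
  have ce t (tD : (\bigcup_k `[z / k.+3%:R, z * k.+2%:R]%classic) t) : {for t, continuous (fun t => t ^+ 2 * w t)}.
    by apply: contM; [apply: contX; exact: cvg_id|exact: cw tD].
  have e0 t (tD : (\bigcup_k `[z / k.+3%:R, z * k.+2%:R]%classic) t) :
    0 <= t ^+ 2 * w t by rewrite mulr_ge0 ?sqr_ge0.
  have quad x s b : (\bigcup_k `[z / k.+3%:R, z * k.+2%:R]%classic) x -> x != z ->
    (a - 1) * w x * b ^+ 2 + (2 * E x * s * b / (x - z) + dE x * b ^+ 2 / (x - z) -
     E x * b ^+ 2 / (x - z) ^+ 2) <= x ^+ 2 * w x * s ^+ 2.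
    move=> xD xz; rewrite -subr_ge0.
    (* With z = a - 1 one has (x - z)^2 + (a - x)(x - z) - x = -(a - 1), which is exactly what
       completes the square. *)
    rewrite [leRHS](_ : _ = w x * (x * s - (a - 1) * b / (x - z)) ^+ 2).
      by rewrite mulr_ge0 ?sqr_ge0.
    have xz' : x - z != 0 by rewrite subr_eq0.
    by move: xz'; rewrite /E /dE /z => xz'; field.
  exact: (hardy2 leps epsr ndl ndr eps0 epsn epsc (ltW z0) (subrr (M z))
    dNP dEP (fun t tD => cdM (Dpos t tD)) cdE ce cw e0 (fun t tD => w0 t) quad
    psir psil).
apply: le_trans main.
have iw : leb.-integrable D0 (fun t => (w t)%:E) by apply: gamma_integrable; move: a1; lra.
have iM := gamma_integrable_wM; have iM2 := gamma_integrable_wM2.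
have i1 := integrableZl mD (2 * M z) iM.
have i2 := integrableZl mD (M z ^+ 2) iw.
have i3 := integrableB mD iM2 i1.
have NE t : (w t * N t ^+ 2)%:E = ((w t * M t ^+ 2)%:E - (2 * M z)%:E * (w t * M t)%:E
    + (M z ^+ 2)%:E * (w t)%:E)%E.
  by rewrite -!EFinM -EFinB -EFinD; congr _%:E; rewrite /N; ring.
(* M has mean zero under w, so subtracting the constant M(z) can only increase the second moment. *)
have NI : (\int[leb]_(t in D0) (w t * N t ^+ 2)%:E =
   \int[leb]_(t in D0) (w t * M t ^+ 2)%:E +
   (M z ^+ 2)%:E * \int[leb]_(t in D0) (w t)%:E)%E.
  under eq_integral do rewrite NE.
  rewrite (integralD mD i3 i2) (integralB mD iM2 i1) (integralZl mD iM) wM0 mule0 sube0.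
  by rewrite (integralZl mD iw).
have -> : (\int[leb]_(t in D0) ((a - 1) * w t * N t ^+ 2)%:E =
  (a - 1)%:E * \int[leb]_(t in D0) (w t * N t ^+ 2)%:E)%E.
  rewrite -ge0_integralZl//.
  - by apply: eq_integral => t _; rewrite -EFinM; congr _%:E; ring.
  - apply/measurable_EFinP; apply: measurable_funM => //; apply: measurable_funX.
    by apply: measurable_funB => //; exact: measurable_cst.
  - by move=> t _; rewrite lee_fin mulr_ge0 ?sqr_ge0.
  - by rewrite lee_fin; exact: ltW z0.
rewrite lee_pmul2l// NI leeDl// mule_ge0 ?lee_fin ?sqr_ge0//.
by apply: integral_ge0 => t _; rewrite lee_fin.
Qed.

End gamma_poincare.

(** * The Cauchy weight as a Gamma mixture of Gaussians *)

Section gauss_mixture.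
Context {R : realType} (n : nat).
Notation leb := (@lebesgue_measure R).
Notation D0 := (`]0%R, +oo[%classic : set R).
Notation E t := (wE (lebesgue_rV n) (gauss t)).
Notation pg := (pgrowth (@omega R n)).
Implicit Types (F H : 'rV[R]_n -> R) (t b : R).
Let om1 := @omega_ge1 R n.

Lemma gauss_powR t (x : 'rV[R]_n) : 0 < t ->
  gauss t x = t `^ (n%:R / 2) / Num.sqrt pi ^+ n * expR (t * (1 - omega x)).
Proof.
move=> t0; rewrite /gauss; congr (_ * _).
rewrite sqrtrM ?(ltW t0)// sqrtrV ?pi_ge0// expr_div_n; congr (_ / _).
by rewrite -powR12_sqrt ?(ltW t0)// -powR_mulrn ?powR_ge0// -powRrM mulrC.
Qed.

Lemma integrable_expR F t : 0 < t -> pg F ->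
  (lebesgue_rV n).-integrable setT (fun x => (F x * expR (t * (1 - omega x)))%:E).
Proof.
move=> t0 Fp; have c0 : Num.sqrt (t / pi) ^+ n != 0.
  by rewrite gt_eqF// exprn_gt0// sqrt_tau_pi_gt0.
have := integrableZl measurableT (Num.sqrt (t / pi) ^+ n)^-1
  (pg_integrable (mw_gauss n t0) Fp).
congr (_.-integrable _ _); apply/funext => x; rewrite -EFinM; congr _%:E.
by rewrite /gauss; field.
Qed.

(** Differentiation under the integral sign; the first term comes from the normalising power
    t^(n/2). Comparing with [hermite2], the derivative is -1/(2t) times the mean of F [hermite2]. *)
Lemma der_gaussE F t : 0 < t -> pg F ->
  is_derive t (1 : R) (fun s => E s F)
    (n%:R / (2 * t) * E t F + E t (fun x => (1 - omega x) * F x)).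
Proof.
move=> t0 Fp.
pose f (s : R) x := F x * expR (s * (1 - omega x)).
pose A s := (\int[lebesgue_rV n]_x f s x)%R.
have fder s x : is_derive s (1 : R) (f^~ x) ((1 - omega x) * F x * expR (s * (1 - omega x))).
  have h : is_derive s (1 : R) (fun s => s * (1 - omega x)) (1 - omega x).
    by apply: (der_eq (derM (der_id s) (der_cst (1 - omega x) s))); rewrite mulr0 addr0 mul1r.
  have H := derM (der_cst (F x) s) (der_comp (f := expR) (is_derive_expR _) h).
  by apply: (der_eq H); ring.
have d1E s x : partial1of2 f s x = (1 - omega x) * F x * expR (s * (1 - omega x)).
  by rewrite partial1of2E; have [] := fder s x.
have omp := @pgrowth_omega R n.
have FGp : pg (fun x => `|F x| * omega x).
  apply: pgrowthM => //; apply: (pgrowth_le _ Fp) => [|x]; last by rewrite normr_id.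
  by apply: measurableT_comp => //; exact: Fp.1.
(* Domination of the parameter derivative for all s in ]t/2, 2t[: |1 - omega| <= omega, and the
   exponential is largest at s = t/2. *)
pose G x := `|F x| * omega x * expR (t / 2 * (1 - omega x)).
have t2 : 0 < t / 2 by rewrite divr_gt0.
have It : `]t / 2, 2 * t[%classic t by rewrite /= in_itv/=; apply/andP; split; lra.
have intf s : `]t / 2, 2 * t[%classic s -> (lebesgue_rV n).-integrable setT (EFin \o f s).
  by rewrite /= in_itv/= => /andP[s1 _]; exact: integrable_expR (lt_trans t2 s1) Fp.
have derf s (x : 'rV[R]_n) : `]t / 2, 2 * t[%classic s -> [set: 'rV[R]_n] x ->
    derivable (f^~ x) s 1 by move=> _ _; have [] := fder s x.
have G0 x : 0 <= G x.
  by rewrite !mulr_ge0 ?expR_ge0// (le_trans _ (om1 x)).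
have Gi : (lebesgue_rV n).-integrable setT (EFin \o G) by exact: integrable_expR.
have Gub s (x : 'rV[R]_n) : `]t / 2, 2 * t[%classic s -> [set: 'rV[R]_n] x ->
    `|partial1of2 f s x| <= G x.
  rewrite /= in_itv/= => /andP[s1 _] _; rewrite d1E /G !normrM (ger0_norm (expR_ge0 _)).
  have o1 := om1 x; rewrite (mulrC `|1 - _|) ler_pM ?mulr_ge0 ?expR_ge0//.
    by rewrite ler_wpM2l// ler_norml; apply/andP; split; lra.
  by rewrite ler_expR ler_wnM2r ?(ltW s1)// subr_le0.
have dA : is_derive t (1 : R) A (\int[lebesgue_rV n]_x ((1 - omega x) * F x * expR (t * (1 - omega x))))%R.
  apply: DeriveDef.
    exact: (derivable_under_integral measurableT It intf derf G0 Gi Gub).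
  rewrite -derive1E (differentiation_under_integral measurableT It intf derf G0 Gi Gub).
  by apply: eq_Rintegral => x _; rewrite d1E.
have EA (H : 'rV[R]_n -> R) s : 0 < s -> pg H -> E s H = s `^ (n%:R / 2) / Num.sqrt pi ^+ n *
   (\int[lebesgue_rV n]_x (H x * expR (s * (1 - omega x))))%R.
  move=> s0 Hp; rewrite -RintegralZl//; last exact: integrable_expR.
  by apply: eq_Rintegral => x _; rewrite gauss_powR//; ring.
have main := derM (derM (is_derive1_powR (n%:R / 2) t0) (der_cst (Num.sqrt pi ^+ n)^-1 t)) dA.
have opF : pg (fun x => (1 - omega x) * F x).
  by apply: pgrowthM => //; apply: pgrowthB => //; exact: pgrowth_cst.
apply: (near_eq_is_derive (f := fun s => s `^ (n%:R / 2) / Num.sqrt pi ^+ n * A s)).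
- near=> s; rewrite (EA F)//; near: s.
  exact: lt_nbhsr.
- apply: (der_eq main); rewrite (EA F)// (EA _ _ t0 opF) /A /f.
  have -> : t `^ (n%:R / 2 - 1) = t `^ (n%:R / 2) / t.
    by rewrite -(powR_mul _ _ t0) powRN powRr1 ?ltW.
  move: (t `^ _) (\int[_]_x _)%R (\int[_]_x _)%R => p u v.
  have : Num.sqrt (pi : R) ^+ n != 0.
    by rewrite gt_eqF// exprn_gt0// sqrtr_gt0 pi_gt0.
  move: (_ ^+ n) => c c0; rewrite mulr0 addr0; field.
  by rewrite c0 gt_eqF.
Unshelve. all: by end_near. Qed.

(** Gamma(b) / pi^(n/2): Gamma(b) comes from integrating s^(b-1) e^(-s omega), the power of pi from
    the Gaussian normalisation. *)
Definition mix_cst b := Gam b / Num.sqrt pi ^+ n.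

Lemma mix_cst_gt0 b : 0 < b -> 0 < mix_cst b.
Proof.
by move=> b0; rewrite divr_gt0 ?Gam_gt0// exprn_gt0// sqrtr_gt0 pi_gt0.
Qed.

(* The Cauchy density is a Gamma mixture of centred Gaussian densities. *)
Lemma gauss_mixture b H : 1 <= b -> measurable_fun setT H -> (forall x, 0 <= H x) ->
  (\int[leb]_(s in D0) ((s `^ (b - n%:R / 2 - 1) * expR (- s))%:E *
     \int[lebesgue_rV n]_x (H x * gauss s x)%:E) =
   (mix_cst b)%:E * \int[lebesgue_rV n]_x (H x * omega x `^ (- b))%:E)%E.
Proof.
move=> b1 mH H0.
pose w s := s `^ (b - n%:R / 2 - 1) * expR (- s).
pose k (s : R) x := w s * (H x * gauss s x).
(* The indicator of the half-line is put into the kernel, so that Tonelli applies on the whole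
   product space. *)
pose K (p : measurableTypeR R * 'rV[R]_n) : \bar R := (\1_D0 p.1 * k p.1 p.2)%:E.
have mD : measurable (D0 : set (measurableTypeR R)) by exact: measurable_itv.
have w0 s : 0 <= w s by rewrite mulr_ge0 ?powR_ge0 ?expR_ge0.
have k0 s x : 0 <= k s x by apply: mulr_ge0 => //; apply: mulr_ge0 => //; exact: gauss_ge0.
have mw : measurable_fun setT w by exact: measurable_powR_expRN.
have mK : measurable_fun setT K.
  apply/measurable_EFinP; apply: measurable_funM.
    apply: measurableT_comp; last exact: measurable_fst.
    exact: measurable_indic.
  apply: measurable_funM.
    exact: (measurableT_comp mw measurable_fst).
  apply: measurable_funM; first exact: (measurableT_comp mH measurable_snd).
  apply: measurable_funM.
    apply: measurable_funX; apply: (measurableT_comp (f := fun s : R => Num.sqrt (s / pi))).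
      apply: continuous_measurable_fun => s.
      apply: continuous_comp; last exact: sqrt_continuous.
      by apply: cvgM; [exact: cvg_id|exact: cvg_cst].
    exact: measurable_fst.
  apply: measurableT_comp; first exact: measurable_expR.
  apply: measurable_funM; first exact: measurable_fst.
  apply: measurable_funB; first exact: measurable_cst.
  exact: (measurableT_comp (@measurable_omega R n) measurable_snd).
have K0 p : (0 <= K p)%E by rewrite lee_fin mulr_ge0 ?k0.
have msec s : measurable_fun setT (fun x => (H x * gauss s x)%:E).
  by apply/measurable_EFinP; apply: measurable_funM => //; exact: measurable_gauss.
transitivity (\int[leb]_s \int[lebesgue_rV n]_x K (s, x))%E.
  rewrite [LHS]integral_mkcond; apply: eq_integral => s _.
  rewrite /K /= patchE indicE; case: ifPn => sD; last first.
    by under eq_integral do rewrite mul0r; rewrite integral0.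
  rewrite -ge0_integralZl//.
  - by apply: eq_integral => x _; rewrite mul1r.
  - by move=> x _; rewrite lee_fin mulr_ge0 ?gauss_ge0.
  - by rewrite lee_fin; exact: w0.
transitivity (\int[lebesgue_rV n]_x \int[leb]_s K (s, x))%E.
  exact: (fubini_tonelli K mK K0).
rewrite -ge0_integralZl//; last 3 first.
- apply/measurable_EFinP; apply: measurable_funM => //.
  exact: (measurableT_comp (measurable_powR _) (@measurable_omega R n)).
- by move=> x _; rewrite lee_fin mulr_ge0 ?powR_ge0.
- by rewrite lee_fin ltW// mix_cst_gt0// (lt_le_trans ltr01).
apply: eq_integral => x _.
(* At fixed x the factors combine into a Gamma integral at scale [omega x]; the s^(n/2) of the
   Gaussian density turns the exponent b - n/2 - 1 into b - 1. *)
transitivity (\int[leb]_(s in D0) ((H x / Num.sqrt pi ^+ n)%:E *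
   (s `^ (b - 1) * expR (- (omega x * s)))%:E))%E.
  rewrite [RHS]integral_mkcond; apply: eq_integral => s _.
  rewrite /K /= patchE indicE; case: ifPn => sD; last by rewrite mul0r.
  have s0 : 0 < s by move: sD; rewrite inE/= in_itv/= andbT.
  rewrite mul1r -EFinM /k /w gauss_powR//; congr _%:E.
  have -> : b - 1 = b - n%:R / 2 - 1 + n%:R / 2 by ring.
  rewrite -(powR_mul (b - n%:R / 2 - 1) _ s0).
  have -> : expR (- (omega x * s)) = expR (- s) * expR (s * (1 - omega x)).
    by rewrite -expRD; congr expR; ring.
  by ring.
rewrite ge0_integralZl//.
- rewrite gamma_int_scale ?omega_gt0// -!EFinM; congr _%:E; rewrite /mix_cst; ring.
- by apply/measurable_EFinP; apply: measurable_funTS; exact: measurable_powR_expR.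
- by move=> s _; rewrite lee_fin mulr_ge0 ?powR_ge0 ?expR_ge0.
- by rewrite lee_fin divr_ge0// exprn_ge0.
Qed.

(** The mixture identity for H = 1: each Gaussian has mass 1, so the Cauchy mass is a ratio of Gamma
    values, the classical normalising constant. *)
Lemma integral_omega_powR b : 1 <= b -> n%:R / 2 < b ->
  (\int[lebesgue_rV n]_x (omega x `^ (- b))%:E =
   (Gam (b - n%:R / 2) / mix_cst b)%:E)%E.
Proof.
move=> b1 nb.
have b0 : 0 < b by exact: lt_le_trans b1.
have m1 : measurable_fun setT (fun _ : 'rV[R]_n => (1 : R)) by exact: measurable_cst.
have := @gauss_mixture b (fun=> 1) b1 m1 (fun=> ler01).
have -> : (\int[leb]_(s in D0) ((s `^ (b - n%:R / 2 - 1) * expR (- s))%:E *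
     \int[lebesgue_rV n]_x (1 * gauss s x)%:E) = (Gam (b - n%:R / 2))%:E)%E.
  rewrite -GamE ?subr_gt0//; apply: eq_integral => s; rewrite inE/= in_itv/= andbT => s0.
  by under eq_integral do rewrite mul1r; rewrite integral_gauss// mule1.
under [X in _ = (_ * X)%E -> _]eq_integral do rewrite mul1r.
have c0 := mix_cst_gt0 b0; move=> H.
by rewrite mulrC EFinM H muleA -EFinM mulVf ?mul1e// gt_eqF.
Qed.

End gauss_mixture.

(** * The Poincaré inequality for the Cauchy weight, through the mixture *)

Section cauchy_poincare.
Context {R : realType} (n : nat).
Notation leb := (@lebesgue_measure R).
Notation D0 := (`]0%R, +oo[%classic : set R).
Notation E t := (wE (lebesgue_rV n) (gauss t)).
Notation pg := (pgrowth (@omega R n)).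
Let om1 := @omega_ge1 R n.

(** The Gaussian mean of [omega] is affine in 1/t, the extremal of [gamma_poincare]; this is why
    [omega] is the extremal function in the middle regime. *)
Lemma gauss_omega (t : R) : 0 < t -> t * E t (@omega R n) = t + n%:R / 2.
Proof.
move=> t0; have := @gauss_hermite2_mean R n t t0; rewrite /hermite2.
have mw := mw_gauss n t0; have omp := @pgrowth_omega R n.
have -> : (fun x : 'rV[R]_n => 2 * t * (omega x - 1) - n%:R) =
    (fun x => 2 * t * omega x - cst (2 * t + n%:R) x).
  by apply/funext => x /=; ring.
rewrite (wEB mw); [|exact: pgrowthZ|exact: pgrowth_cst].
by rewrite (wEZ mw)// (wE_cst mw); lra.
Qed.

Lemma powR_le_1D (y d : R) : 0 <= y -> 0 <= d -> d <= 1 -> y `^ d <= 1 + y.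
Proof.
move=> y0 d0 d1; have [y1|y1] := leP y 1.
  apply: (@le_trans _ _ (1 `^ d)); last by rewrite powR1 lerDl.
  by rewrite ge0_ler_powR// nnegrE.
by rewrite (le_trans (ler_powR (ltW y1) d1))// powRr1// lerDr.
Qed.

(** By scaling, omega^d = t^(-d) (t omega)^d <= t^(-d) (1 + t omega), and the Gaussian mean of the
    right-hand side is explicit. *)
Lemma gauss_mean_bound (f : 'rV[R]_n -> R) (C d t : R) :
  0 <= C -> 0 <= d -> d <= 1 -> 0 < t -> pg f ->
  (forall x, `|f x| <= C * omega x `^ d) ->
  `|E t f| <= C * (1 + n%:R / 2) * t `^ (- d) * (1 + t).
Proof.
move=> C0 d0 d1 t0 fp fC; have mw := mw_gauss n t0.
have omp := @pgrowth_omega R n.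
pose B (x : 'rV[R]_n) := C * t `^ (- d) + C * t `^ (- d) * t * omega x.
have Bp : pg B.
  by apply: pgrowthD => //; [exact: pgrowth_cst|exact: pgrowthZ].
have fB x : `|f x| <= B x.
  apply: (le_trans (fC x)).
  have ox := omega_gt0 x.
  have -> : omega x `^ d = t `^ (- d) * (t * omega x) `^ d.
    rewrite powRM ?(ltW t0) ?(ltW ox)// mulrA powR_mul// addNr powRr0 mul1r//.
  have -> : B x = C * (t `^ (- d) * (1 + t * omega x)) by rewrite /B; ring.
  rewrite ler_wpM2l// ler_wpM2l ?powR_ge0// powR_le_1D// mulr_ge0 ?ltW//.
have EB : E t B = C * t `^ (- d) * (1 + t + n%:R / 2).
  rewrite (wED mw); [|exact: pgrowth_cst|exact: pgrowthZ].
  by rewrite (wE_cst mw) (wEZ mw)// -mulrA gauss_omega//; ring.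
apply: (@le_trans _ _ (E t B)).
  rewrite ler_norml -mulN1r -(wEZ mw)//; apply/andP; split; apply: (wE_le mw) => //.
  - exact: pgrowthZ.
  - by move=> x; have := fB x; rewrite ler_norml mulN1r => /andP[].
  - by move=> x; exact: le_trans (ler_norm _) (fB x).
rewrite EB [leRHS](_ : _ = C * t `^ (- d) * ((1 + n%:R / 2) * (1 + t))); last by ring.
rewrite ler_wpM2l ?mulr_ge0 ?powR_ge0//.
have : 0 <= n%:R / 2 * t by rewrite !mulr_ge0// ltW.
by lra.
Qed.

Variables (beta : R).
Hypotheses (n_gt0 : (0 < n)%N) (beta2 : 2 <= beta).
Let a := beta - n%:R / 2.
Hypothesis a1 : 1 < a.
Let w (t : R) := t `^ (a - 1) * expR (- t).

Let w0 (t : R) : 0 <= w t. Proof. by rewrite mulr_ge0 ?powR_ge0 ?expR_ge0. Qed.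

Let fineE (H : 'rV[R]_n -> R) (t : R) : 0 < t -> pg H ->
  (\int[lebesgue_rV n]_x (H x * gauss t x)%:E = (E t H)%:E)%E.
Proof.
by move=> t0 Hp; rewrite fineK//; exact: integrable_fin_num (pg_integrable (mw_gauss n t0) Hp).
Qed.

Section mean.
Variables (f : 'rV[R]_n -> R) (C d : R).
Hypotheses (C0 : 0 <= C) (d0 : 0 <= d) (d1 : d <= 1) (da : 2 * d < a).
Hypotheses (fp : pg f) (fC : forall x, `|f x| <= C * omega x `^ d).

Let M t := E t f.
Let dM t := n%:R / (2 * t) * E t f + E t (fun x => (1 - omega x) * f x).

Let opf : pg (fun x => (1 - omega x) * f x).
Proof.
apply: pgrowthM => //; apply: pgrowthB => //; first exact: pgrowth_cst.
exact: pgrowth_omega.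
Qed.

Let dMP (t : R) : 0 < t -> is_derive t (1 : R) M (dM t).
Proof. by move=> t0; exact: der_gaussE. Qed.

Let cdM (t : R) : 0 < t -> {for t, continuous dM}.
Proof.
move=> t0; apply: contD; last exact: der_continuous (der_gaussE t0 opf).
apply: contM; last exact: der_continuous (dMP t0).
apply: contM; first exact: cont_cst.
apply: contV; first by rewrite mulf_neq0// gt_eqF.
by apply: contM; [exact: cont_cst|exact: cvg_id].
Qed.

Let C'0 : 0 <= C * (1 + n%:R / 2).
Proof. by rewrite mulr_ge0// addr_ge0// divr_ge0. Qed.

Let MC (t : R) : 0 < t -> `|M t| <= C * (1 + n%:R / 2) * t `^ (- d) * (1 + t).
Proof. by move=> t0; exact: gauss_mean_bound. Qed.

Let iM := gamma_integrable_wM d0 da C'0 dMP MC.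
Let iM2 := gamma_integrable_wM2 d0 da C'0 dMP MC.

(** Integrability on the Gamma side follows from [gauss_mean_bound]; the mixture identity then
    transfers it to the Lebesgue side. *)
Lemma ge0_gauss_mixture_mean : (forall x, 0 <= f x) ->
  [/\ leb.-integrable D0 (fun t => (w t * E t f)%:E),
    (lebesgue_rV n).-integrable setT (fun x => (f x * omega x `^ (- beta))%:E) &
    (\int[leb]_(t in D0) (w t * E t f)%:E =
     (mix_cst n beta)%:E * \int[lebesgue_rV n]_x (f x * omega x `^ (- beta))%:E)%E].
Proof.
move=> f0.
have b1 : 1 <= beta by apply: le_trans beta2; rewrite ler1n.
have c0 : 0 < mix_cst n beta by apply: mix_cst_gt0; exact: lt_le_trans b1.
have eqm : (\int[leb]_(t in D0) (w t * E t f)%:E =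
   (mix_cst n beta)%:E * \int[lebesgue_rV n]_x (f x * omega x `^ (- beta))%:E)%E.
  rewrite -(gauss_mixture b1 fp.1 f0); apply: eq_integral => t.
  by rewrite inE/= in_itv/= andbT => t0; rewrite fineE// -EFinM.
have fo0 x : 0 <= f x * omega x `^ (- beta) by rewrite mulr_ge0 ?powR_ge0.
have mD : measurable (D0 : set (measurableTypeR R)) by exact: measurable_itv.
have iM' : leb.-integrable D0 (fun t => (w t * E t f)%:E) := iM.
split=> //; apply/integrableP; split.
  apply/measurable_EFinP; apply: measurable_funM; first exact: fp.1.
  exact: (measurableT_comp (measurable_powR _) (@measurable_omega R n)).
under eq_integral do rewrite gee0_abs ?lee_fin ?fo0//.
have := integrable_fin_num mD iM'; rewrite eqm.
have : (0 <= \int[lebesgue_rV n]_x (f x * omega x `^ (- beta))%:E)%E.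
  by apply: integral_ge0 => x _; rewrite lee_fin fo0.
case: integral => [r|_|//]; first by rewrite ltry.
by rewrite gt0_muley ?lte_fin.
Qed.

Variables (df : 'I_n -> 'rV[R]_n -> R) (lam : R).
Hypotheses (dfP : forall i, C1_line i f (df i)) (dfp : forall i, pg (df i)).
Hypotheses (lam0 : 0 <= lam) (lam1 : lam <= 4 * (a - 1)) (lam2 : lam <= 2 * (beta - 1)).
Hypothesis mean0 : (\int[leb]_(t in D0) (w t * E t f)%:E = 0)%E.

(** For each t, the improved Gaussian inequality bounds lam times the variance plus a multiple of
    t^2 M'(t)^2 by the energy. Integrated against the Gamma law, the M' term absorbs lam times the
    second moment of M by [gamma_poincare], and both sides are mixtures in the sense of
    [gauss_mixture]. *)
Lemma cauchy_poincare_mix0 :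
  (lam%:E * \int[lebesgue_rV n]_x (f x ^+ 2 * omega x `^ (- beta))%:E <=
   \int[lebesgue_rV n]_x ((\sum_(i < n) df i x ^+ 2) * omega x `^ (1 - beta))%:E)%E.
Proof.
have mD : measurable (D0 : set (measurableTypeR R)) by exact: measurable_itv.
have nR : 0 < n%:R :> R by rewrite ltr0n.
have Dpos (t : R) : D0 t -> 0 < t by rewrite /= in_itv/= andbT.
have f2p : pg (fun x => f x ^+ 2) by exact: pgrowthX.
pose S x := \sum_(i < n) df i x ^+ 2.
have Sp : pg S by apply: pgrowth_sum => // i; exact: pgrowthX.
have S0 x : 0 <= S x by apply: sumr_ge0 => i _; exact: sqr_ge0.
(* The weight left for t^2 M'^2 once lam V has been taken out of 2(beta - 1)(V + u), using u <=
   V. *)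
pose q := (4 * (beta - 1) - lam) * (2 / n%:R).
have q0 : 0 <= q by rewrite mulr_ge0 ?divr_ge0//; move: lam2 beta2; lra.
have qa : lam <= q * (a - 1).
  rewrite /q mulrAC mulrA ler_pdivlMr//.
  (* Substituting n = 2(beta - 1) - 2(a - 1), the claim lam <= q (a - 1) reduces to lam <= 4(a -
     1). *)
  have aE : n%:R = 2 * (beta - 1) - 2 * (a - 1) by rewrite /a; field.
  have b1 : 0 <= beta - 1 by move: beta2; lra.
  have := ler_wpM2r b1 lam1; rewrite aE; nra.
have dME (t : R) : 0 < t -> dM t = - E t (fun x => f x * hermite2 t x) / (2 * t).
  move=> t0; have mw := mw_gauss n t0.
  have -> : (fun x => f x * hermite2 t x) = (fun x => - (2 * t) * ((1 - omega x) * f x) - n%:R * f x).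
    by apply/funext => x; rewrite /hermite2; ring.
  rewrite (wEB mw)//; [|exact: pgrowthZ|exact: pgrowthZ].
  by rewrite !(wEZ mw)// /dM; field; rewrite gt_eqF.
have pointwise (t : R) : 0 < t -> lam * (w t * E t (fun x => f x ^+ 2)) + q * (t ^+ 2 * w t * dM t ^+ 2) <=
    (beta - 1) * (w t / t * E t S) + lam * (w t * M t ^+ 2).
  move=> t0.
  have [] := gauss_poincare_improved t0 n_gt0 dfP fp dfp.
  set V := _ - _; set c := wE _ _ _ => h1 h2.
  have cE : c ^+ 2 / (2 * n%:R) = 2 / n%:R * (t ^+ 2 * dM t ^+ 2).
    by rewrite (dME _ t0) -/c; field; rewrite !gt_eqF.
  pose u := c ^+ 2 / (2 * n%:R).
  have h3 : 2 * (V + u) <= E t S / t by rewrite ler_pdivlMr// mulrC mulrA (mulrC t).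
  have b10 : 0 <= beta - 1 by move: beta2; lra.
  have h4 : lam * V + (4 * (beta - 1) - lam) * u <= (beta - 1) * (E t S / t).
    apply: le_trans (ler_wpM2l b10 h3).
    (* The two sides of [h4], bounded through 2(beta - 1)(V + u), differ exactly by this product;
       its signs come from lam <= 2(beta - 1) and Bessel's inequality u <= V. *)
    have h5 : 0 <= (2 * (beta - 1) - lam) * (V - u).
      by rewrite mulr_ge0 ?subr_ge0.
    by move: h5; rewrite /u; nra.
  have h6 := ler_wpM2l (w0 t) h4.
  have -> : q * (t ^+ 2 * w t * dM t ^+ 2) = w t * ((4 * (beta - 1) - lam) * u).
    by rewrite /u cE /q; ring.
  have -> : E t (fun x => f x ^+ 2) = V + M t ^+ 2 by rewrite /V /M; ring.
  rewrite [w t / t * E t S]mulrAC -[w t * E t S / t]mulrA.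
  by move: h6; move: (w t) (E t S / t) => W Y; nra.
have cont_meas (g : R -> R) : (forall t, 0 < t -> {for t, continuous g}) -> measurable_fun D0 g.
  move=> cg; apply: open_continuous_measurable_fun; first exact: interval_open.
  by move=> t; rewrite inE => /Dpos; exact: cg.
have mE (H : 'rV[R]_n -> R) : pg H -> measurable_fun D0 (fun t => E t H).
  by move=> Hp; apply: cont_meas => t t0; exact: der_continuous (der_gaussE t0 Hp).
have mw : measurable_fun D0 w by apply: measurable_funTS; exact: measurable_powR_expRN.
have ms2 : measurable_fun D0 (fun t => w t * E t (fun x => f x ^+ 2)).
  by apply: measurable_funM => //; exact: mE.
have mdM : measurable_fun D0 (fun t => t ^+ 2 * w t * dM t ^+ 2).
  apply: measurable_funM; last by apply: measurable_funX; exact: cont_meas.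
  by apply: measurable_funM => //; apply: measurable_funX.
have mS : measurable_fun D0 (fun t => w t / t * E t S).
  apply: measurable_funM; last exact: mE.
  apply: measurable_funM => //; apply: cont_meas => t t0.
  by apply: contV; [rewrite gt_eqF|exact: cvg_id].
have mM2 : measurable_fun D0 (fun t => w t * M t ^+ 2).
  by apply: measurable_funM => //; apply: measurable_funX; exact: mE.
have E2ge0 (t : R) : 0 < t -> 0 <= E t (fun x => f x ^+ 2).
  by move=> t0; apply: (wE_ge0 (mw_gauss n t0)) => x; exact: sqr_ge0.
have ESge0 (t : R) : 0 < t -> 0 <= E t S.
  by move=> t0; exact: (wE_ge0 (mw_gauss n t0)).
have p1 (t : R) : D0 t -> (0 <= (w t * E t (fun x => f x ^+ 2))%:E)%E.
  by move=> /Dpos t0; rewrite lee_fin mulr_ge0 ?E2ge0.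
have p2 (t : R) : D0 t -> (0 <= (t ^+ 2 * w t * dM t ^+ 2)%:E)%E.
  by move=> _; rewrite lee_fin mulr_ge0 ?sqr_ge0// mulr_ge0 ?sqr_ge0.
have p3 (t : R) : D0 t -> (0 <= (w t / t * E t S)%:E)%E.
  by move=> /Dpos t0; rewrite lee_fin mulr_ge0 ?ESge0// divr_ge0// ltW.
have p4 (t : R) : D0 t -> (0 <= (w t * M t ^+ 2)%:E)%E.
  by move=> _; rewrite lee_fin mulr_ge0 ?sqr_ge0.
have b10 : 0 <= beta - 1 by move: beta2; lra.
have int_le : (lam%:E * \int[leb]_(t in D0) (w t * E t (fun x => f x ^+ 2))%:E +
    q%:E * \int[leb]_(t in D0) (t ^+ 2 * w t * dM t ^+ 2)%:E <=
    (beta - 1)%:E * \int[leb]_(t in D0) (w t / t * E t S)%:E +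
    lam%:E * \int[leb]_(t in D0) (w t * M t ^+ 2)%:E)%E.
  rewrite -!(ge0_integralZl _ mD)//; try exact/measurable_EFinP.
  have mZ k (g : R -> R) : measurable_fun D0 g -> measurable_fun D0 (fun t => (k%:E * (g t)%:E)%E).
    by move=> mg; apply/measurable_EFinP; apply: measurable_funM => //; exact: measurable_cst.
  rewrite -!ge0_integralD//; try exact: mZ.
  - apply: ge0_le_integral => //.
    + by move=> t tD; rewrite adde_ge0// mule_ge0 ?lee_fin// -lee_fin; [exact: p1|exact: p2].
    + by apply: emeasurable_funD; exact: mZ.
    + by apply: emeasurable_funD; exact: mZ.
    + by move=> t /Dpos t0; rewrite -!EFinM -!EFinD lee_fin; exact: pointwise.
  - by move=> t tD; rewrite mule_ge0 ?lee_fin// -lee_fin; exact: p3.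
  - by move=> t tD; rewrite mule_ge0 ?lee_fin// -lee_fin; exact: p4.
  - by move=> t tD; rewrite mule_ge0 ?lee_fin// -lee_fin; exact: p1.
  - by move=> t tD; rewrite mule_ge0 ?lee_fin// -lee_fin; exact: p2.
have gp := gamma_poincare a1 d0 da C'0 dMP cdM MC mean0.
have b1 : 1 <= beta by move: beta2; lra.
have X1 : (\int[leb]_(t in D0) (w t * E t (fun x => f x ^+ 2))%:E =
   (mix_cst n beta)%:E * \int[lebesgue_rV n]_x (f x ^+ 2 * omega x `^ (- beta))%:E)%E.
  rewrite -(gauss_mixture b1 f2p.1 (fun x => sqr_ge0 _)); apply: eq_integral => t.
  by rewrite inE => /Dpos t0; rewrite fineE// -EFinM.
(* Dividing the Gamma weight by t lowers a by one, so the energy is a mixture with beta - 1 in place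
   of beta; this produces the weight [omega^(1 - beta)]. *)
have X2 : (\int[leb]_(t in D0) (w t / t * E t S)%:E =
   (mix_cst n (beta - 1))%:E * \int[lebesgue_rV n]_x (S x * omega x `^ (1 - beta))%:E)%E.
  have b11 : 1 <= beta - 1 by move: beta2; lra.
  rewrite -[1 - beta]opprB -(gauss_mixture b11 Sp.1 S0); apply: eq_integral => t.
  rewrite inE => /Dpos t0; rewrite fineE// -EFinM; congr (_ * _)%:E.
  rewrite /w /a.
  have -> : beta - 1 - n%:R / 2 - 1 = (beta - n%:R / 2 - 1) + (- 1) by ring.
  by rewrite -(powR_mul (beta - n%:R / 2 - 1) _ t0) powRN powRr1 ?(ltW t0)// mulrAC.
(* The functional equation of Gamma; it cancels the factor beta - 1 of the Gaussian step. *)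
have mixS : mix_cst n beta = (beta - 1) * mix_cst n (beta - 1).
  rewrite /mix_cst mulrA -GamS ?subrK//.
  by move: beta2; lra.
have iM2' : leb.-integrable D0 (fun t => (w t * M t ^+ 2)%:E) := iM2.
have Yfin : (\int[leb]_(t in D0) (w t * M t ^+ 2)%:E)%E \is a fin_num.
  by have := integrable_fin_num mD iM2'.
(* lam times the second moment of M is finite and at most q times the M' term, so it can be
   cancelled from both sides. *)
have final : (lam%:E * \int[leb]_(t in D0) (w t * E t (fun x => f x ^+ 2))%:E <=
    (beta - 1)%:E * \int[leb]_(t in D0) (w t / t * E t S)%:E)%E.
  rewrite -(@leeD2rE _ (lam%:E * \int[leb]_(t in D0) (w t * M t ^+ 2)%:E)%E); last first.
    by rewrite fin_numM.
  apply: le_trans int_le; apply: leeD2l.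
  have Y0 : (0 <= \int[leb]_(t in D0) (w t * M t ^+ 2)%:E)%E by exact: integral_ge0.
  apply: (@le_trans _ _ ((q * (a - 1))%:E * \int[leb]_(t in D0) (w t * M t ^+ 2)%:E)%E).
    by apply: lee_wpmul2r => //; rewrite lee_fin.
  by rewrite EFinM -muleA; apply: lee_wpmul2l => //; rewrite lee_fin.
move: final; rewrite X1 X2 !muleA -!EFinM -mixS (mulrC lam) EFinM -muleA.
by rewrite lee_pmul2l// lte_fin mix_cst_gt0//; exact: lt_le_trans b1.
Qed.

End mean.
End cauchy_poincare.

(** * Centred functions of either sign *)

Section cauchy_poincare_mean.
Context {R : realType} (n : nat) (beta : R).
Notation leb := (@lebesgue_measure R).
Notation D0 := (`]0%R, +oo[%classic : set R).
Notation E t := (wE (lebesgue_rV n) (gauss t)).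
Notation pg := (pgrowth (@omega R n)).
Let om1 := @omega_ge1 R n.
Hypotheses (n_gt0 : (0 < n)%N) (beta2 : 2 <= beta) (a1 : 1 < beta - n%:R / 2).
Let w (t : R) := t `^ (beta - n%:R / 2 - 1) * expR (- t).
Variables (f : 'rV[R]_n -> R) (C d : R).
Hypotheses (C0 : 0 <= C) (d0 : 0 <= d) (d1 : d <= 1) (da : 2 * d < beta - n%:R / 2).
Hypotheses (fp : pg f) (fC : forall x, `|f x| <= C * omega x `^ d).

(** The mixture identity for nonnegative functions, applied to the positive and negative parts and
    subtracted; it shows that centring under the Cauchy weight is centring of the Gaussian means
    under the Gamma law. *)
Lemma gauss_mixture_mean :
  (lebesgue_rV n).-integrable setT (fun x => (f x * omega x `^ (- beta))%:E) /\
  (\int[leb]_(t in D0) (w t * E t f)%:E =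
   (mix_cst n beta)%:E * \int[lebesgue_rV n]_x (f x * omega x `^ (- beta))%:E)%E.
Proof.
have mD : measurable (D0 : set (measurableTypeR R)) by exact: measurable_itv.
pose fpos x := Num.max (f x) 0; pose fneg x := Num.max (- f x) 0.
have mf := fp.1.
have pmax (g : 'rV[R]_n -> R) : measurable_fun setT g -> (forall x, `|g x| <= `|f x|) ->
    pg (fun x => Num.max (g x) 0) /\ (forall x, `|Num.max (g x) 0| <= C * omega x `^ d).
  move=> mg gf.
  have gg x : `|Num.max (g x) 0| <= `|f x|.
    apply: le_trans (gf x); have [g0|g0] := leP (g x) 0; first by rewrite normr0.
    by [].
  split=> [|x]; last exact: le_trans (gg x) (fC x).
  by apply: (@pgrowth_le _ _ _ _ _ f) => //; exact: measurable_maxr.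
have [pp pC] : pg fpos /\ (forall x, `|fpos x| <= C * omega x `^ d) by exact: pmax.
have [np nC] : pg fneg /\ (forall x, `|fneg x| <= C * omega x `^ d).
  by apply: pmax => [|x]; [exact: measurableT_comp|rewrite normrN].
have p0 x : 0 <= fpos x by rewrite le_max lexx orbT.
have n0 x : 0 <= fneg x by rewrite le_max lexx orbT.
have fE x : f x = fpos x - fneg x.
  by rewrite /fpos /fneg; have [h|h] := leP (f x) 0; have [h'|h'] := leP (- f x) 0; lra.
have [i1 j1 e1] := ge0_gauss_mixture_mean beta2 C0 d0 d1 da pp pC p0.
have [i2 j2 e2] := ge0_gauss_mixture_mean beta2 C0 d0 d1 da np nC n0.
have jE : (fun x => (f x * omega x `^ (- beta))%:E) =
    (fun x => (fpos x * omega x `^ (- beta))%:E - (fneg x * omega x `^ (- beta))%:E)%E.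
  by apply/funext => x; rewrite fE mulrBl EFinB.
split; first by rewrite jE; exact: integrableB.
rewrite jE integralB// muleBr; last 2 first.
- by [].
- by rewrite fin_num_adde_defr// integrable_fin_num.
rewrite -e1 -e2 -(integralB mD)//; apply: eq_integral => t.
rewrite inE/= in_itv/= andbT => t0; rewrite -EFinB -mulrBr; congr (_ * _)%:E.
by rewrite -(wEB (mw_gauss n t0))//; congr wE; apply/funext => x; rewrite fE.
Qed.

Variables (df : 'I_n -> 'rV[R]_n -> R) (lam : R).
Hypotheses (dfP : forall i, C1_line i f (df i)) (dfp : forall i, pg (df i)).
Hypotheses (lam0 : 0 <= lam) (lam1 : lam <= 4 * (beta - n%:R / 2 - 1))
  (lam2 : lam <= 2 * (beta - 1)).

Theorem cauchy_poincare :
  (\int[lebesgue_rV n]_x (f x * omega x `^ (- beta))%:E = 0)%E ->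
  (lam%:E * \int[lebesgue_rV n]_x (f x ^+ 2 * omega x `^ (- beta))%:E <=
   \int[lebesgue_rV n]_x ((\sum_(i < n) df i x ^+ 2) * omega x `^ (1 - beta))%:E)%E.
Proof.
move=> m0; have [_] := gauss_mixture_mean; rewrite m0 mule0 => mean0.
exact: (cauchy_poincare_mix0 n_gt0 beta2 a1 C0 d0 d1 da fp fC dfP dfp lam0 lam1 lam2 mean0).
Qed.

End cauchy_poincare_mean.

(** * Poincaré inequalities for smooth decaying functions, in both ranges of beta *)

Section core_inequality.
Context {R : realType} (n : nat).
Notation Leb := (@lebesgue_rV R n).
Notation I F := (\int[Leb]_x (F x))%R.
Notation pg := (pgrowth (@omega R n)).
Let om1 := @omega_ge1 R n.
Hypothesis n2 : (2 <= n)%N.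

Let n2R : 2 <= n%:R :> R. Proof. by rewrite ler_nat. Qed.

Lemma measurable_omega_powR b : measurable_fun setT (fun x : 'rV[R]_n => omega x `^ b).
Proof. exact: (measurableT_comp (measurable_powR _) (@measurable_omega R n)). Qed.

Lemma integrable_omega_powR b : n%:R / 2 < b ->
  Leb.-integrable setT (fun x => (omega x `^ (- b))%:E).
Proof.
move=> nb; apply/integrableP; split.
  by apply/measurable_EFinP; exact: measurable_omega_powR.
under eq_integral do rewrite gee0_abs ?lee_fin ?powR_ge0//.
by rewrite integral_omega_powR ?ltry//; move: n2R nb; lra.
Qed.

Lemma integrable_decay (F : 'rV[R]_n -> R) (K b : R) : n%:R / 2 < b -> measurable_fun setT F ->
  (forall x, `|F x| <= K * omega x `^ (- b)) -> Leb.-integrable setT (EFin \o F).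
Proof.
move=> nb mF FK.
have := integrableZl measurableT K (integrable_omega_powR nb).
apply: le_integrable => //; first exact/measurable_EFinP.
move=> x _; rewrite -EFinM !abse_EFin lee_fin.
exact: le_trans (FK x) (ler_norm _).
Qed.

Lemma Rintegral_omega_powR_gt0 b : n%:R / 2 < b ->
  0 < (\int[Leb]_x (omega x `^ (- b)))%R.
Proof.
move=> nb; rewrite /Rintegral integral_omega_powR//=; last by move: n2R nb; lra.
rewrite divr_gt0 ?Gam_gt0//; first by rewrite subr_gt0.
by apply: mix_cst_gt0; move: n2R nb; lra.
Qed.

Lemma coord_le_omega (x : 'rV[R]_n) i : x ord0 i ^+ 2 + 1 <= omega x.
Proof.
by rewrite /omega (bigD1 i)//= [leLHS]addrC lerD2l lerDl sumr_ge0// => j _; exact: sqr_ge0.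
Qed.

Lemma norm_coord_le_omega (x : 'rV[R]_n) i : `|x ord0 i| <= omega x.
Proof.
have := coord_le_omega x i; rewrite -(real_normK (num_real (x ord0 i))).
by move: (`|_|) => y; nra.
Qed.

Variables (phi : 'rV[R]_n -> R) (dphi : 'I_n -> 'rV[R]_n -> R) (K : R).
Hypotheses (phiP : forall i, C1_line i phi (dphi i)).
Hypotheses (mphi : measurable_fun setT phi) (mdphi : forall i, measurable_fun setT (dphi i)).
Hypotheses (phiK : forall x, `|phi x| <= K) (dphiK : forall i x, `|dphi i x| <= K * omega x `^ (- 1)).

Let K0 : 0 <= K. Proof. exact: le_trans (normr_ge0 _) (phiK 0). Qed.

Let dphi_le i x : `|dphi i x| <= K.
Proof.
apply: le_trans (dphiK i x) _; rewrite ler_piMr// powRN powRr1 ?(ltW (omega_gt0 x))//.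
by rewrite invf_le1 ?omega_gt0.
Qed.

Let pphi : pg phi.
Proof. by split=> //; exists K, 0%N => x; rewrite expr0 mulr1. Qed.

Let pdphi i : pg (dphi i).
Proof. by split=> //; exists K, 0%N => x; rewrite expr0 mulr1. Qed.

Section zeta.
Variables (beta c : R).
Hypothesis nb : n%:R / 2 < beta.
Notation zeta := (fun x => phi x - c).

Let zetaK x : `|zeta x| <= K + `|c|.
Proof. by apply: le_trans (ler_normB _ _) _; rewrite lerD2r. Qed.

Let mzeta : measurable_fun setT zeta.
Proof. by apply: measurable_funB. Qed.

Let zeta2K x : `|zeta x ^+ 2| <= (K + `|c|) ^+ 2.
Proof. by rewrite normrX lerXn2r// nnegrE// addr_ge0. Qed.

Lemma integrable_zeta2 : Leb.-integrable setT (fun x => (zeta x ^+ 2 * omega x `^ (- beta))%:E).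
Proof.
apply: (integrable_decay (K := (K + `|c|) ^+ 2) nb).
  by apply: measurable_funM; [exact: measurable_funX|exact: measurable_omega_powR].
by move=> x; rewrite normrM (ger0_norm (powR_ge0 _ _)) ler_wpM2r ?powR_ge0.
Qed.

Lemma integrable_dirichlet : Leb.-integrable setT
  (fun x => ((\sum_(i < n) dphi i x ^+ 2) * omega x `^ (1 - beta))%:E).
Proof.
apply: (integrable_decay (K := n%:R * K ^+ 2) nb).
  apply: measurable_funM; last exact: measurable_omega_powR.
  by apply: measurable_sum => i; exact: measurable_funX.
move=> x; rewrite normrM (ger0_norm (powR_ge0 _ _)).
have -> : omega x `^ (- beta) = omega x `^ (- 1) * omega x `^ (1 - beta).
  by rewrite (powR_mul _ _ (omega_gt0 x)); congr (_ `^ _); lra.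
rewrite mulrA ler_wpM2r ?powR_ge0//.
rewrite ger0_norm; last by apply: sumr_ge0 => i _; exact: sqr_ge0.
apply: (@le_trans _ _ (\sum_(i < n) K ^+ 2 * omega x `^ (- 1))).
  apply: ler_sum => i _; rewrite -real_normK ?num_real// expr2.
  by rewrite [K ^+ 2]expr2 -mulrA ler_pM.
by rewrite sumr_const card_ord -[leLHS]mulr_natl mulrA.
Qed.

Notation h := (fun x : 'rV[R]_n => \sum_(i < n) (- (2 * beta) * x ord0 i * omega x `^ (- beta - 1) * (x ord0 i * (zeta x * zeta x)) +
  omega x `^ (- beta) * (zeta x * zeta x + x ord0 i * (2 * zeta x * dphi i x)))).

(** The integrand [h] is the divergence of the field omega^(-beta) zeta^2 x. The field is O(omega^(1
    - beta)), and beta > n/2 >= 1 makes it vanish at infinity. *)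
Lemma euler_ibp : Leb.-integrable setT (EFin \o h) /\ I h = 0.
Proof.
pose dG i (x : 'rV[R]_n) := - (2 * beta) * x ord0 i * omega x `^ (- beta - 1) * (x ord0 i * (zeta x * zeta x)) +
  omega x `^ (- beta) * (zeta x * zeta x + x ord0 i * (2 * zeta x * dphi i x)).
pose G i (x : 'rV[R]_n) := omega x `^ (- beta) * (x ord0 i * (zeta x * zeta x)).
have K1 : 0 <= K + `|c| by rewrite addr_ge0 ?K0.
have b0 : 0 < beta by move: (n2R) (nb); lra.
have zzK x : `|zeta x * zeta x| <= (K + `|c|) ^+ 2 by rewrite -expr2; exact: zeta2K.
have GP i : C1_line i (G i) (dG i).
  have zP := C1_lineB (phiP i) (C1_line_cst i c).
  apply: (C1_line_ext (C1_lineM (C1_line_omega_powR i (- beta))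
    (C1_lineM (C1_line_coord i i) (C1_lineM zP zP)))) => x.
  by rewrite /dG eqxx mulr1n; ring.
have G0 i : vanish_line i (G i).
  apply: (@vanish_line_decay _ _ _ _ ((K + `|c|) ^+ 2) (beta - 1)); first by move: n2R nb; lra.
  move=> x; rewrite /G normrM (ger0_norm (powR_ge0 _ _)) normrM.
  have -> : omega x `^ (- (beta - 1)) = omega x `^ (- beta) * omega x.
    by rewrite -[X in _ * X](powRr1 (ltW (omega_gt0 x))) (powR_mul _ _ (omega_gt0 x)); congr (_ `^ _); lra.
  rewrite [leRHS]mulrCA ler_wpM2l ?powR_ge0// mulrC; apply: ler_pM => //.
  exact: norm_coord_le_omega.
have dGi i : Leb.-integrable setT (EFin \o dG i).
  apply: (integrable_decay (K := 2 * beta * (K + `|c|) ^+ 2 + ((K + `|c|) ^+ 2 + 2 * (K + `|c|) * K)) nb).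
    apply: measurable_funD; last first.
      apply: measurable_funM; first exact: measurable_omega_powR.
      apply: measurable_funD; first exact: measurable_funM.
      apply: measurable_funM; first exact: measurable_coord.
      by apply: measurable_funM => //; apply: measurable_funM.
    apply: measurable_funM; last first.
      apply: measurable_funM; first exact: measurable_coord.
      exact: measurable_funM.
    apply: measurable_funM; last exact: measurable_omega_powR.
    by apply: measurable_funM => //; exact: measurable_coord.
  move=> x; rewrite /dG [leRHS]mulrDl; apply: le_trans (ler_normD _ _) _.
  have pE : omega x `^ (- beta) = omega x * omega x `^ (- beta - 1).
    by rewrite -[X in X * _](powRr1 (ltW (omega_gt0 x))) (powR_mul _ _ (omega_gt0 x)); congr (_ `^ _); lra.
  apply: lerD.
    rewrite [X in `|X|](_ : _ = - (2 * beta) * (zeta x * zeta x) * (x ord0 i ^+ 2 * omega x `^ (- beta - 1))); last by ring.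
    rewrite normrM (ger0_norm (mulr_ge0 (sqr_ge0 _) (powR_ge0 _ _))).
    rewrite normrM normrN (ger0_norm (mulr_ge0 _ (ltW b0)))//.
    apply: ler_pM.
    - by rewrite mulr_ge0// mulr_ge0// ltW.
    - exact: mulr_ge0 (sqr_ge0 _) (powR_ge0 _ _).
    - by rewrite ler_wpM2l// mulr_ge0// ltW.
    - rewrite pE ler_wpM2r ?powR_ge0//.
      by apply: le_trans (coord_le_omega x i); rewrite lerDl.
  rewrite normrM (ger0_norm (powR_ge0 _ _)) [leRHS]mulrC ler_wpM2l ?powR_ge0//.
  apply: le_trans (ler_normD _ _) _; apply: lerD => //.
  rewrite [X in `|X|](_ : _ = 2 * zeta x * (x ord0 i * dphi i x)); last by ring.
  rewrite normrM; apply: ler_pM => //.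
    by rewrite normrM ger0_norm// ler_wpM2l.
  rewrite normrM; apply: le_trans (ler_pM _ _ (norm_coord_le_omega x i) (dphiK i x)) _ => //.
  rewrite powRN powRr1 ?(ltW (omega_gt0 x))// mulrCA divff ?mulr1//.
  by rewrite gt_eqF// omega_gt0.
have dG0 i : (\int[Leb]_x (dG i x)%:E = 0)%E := integral_line0 (GP i) (G0 i) (dGi i).
have hE : EFin \o h = (fun x => (\sum_(i < n) (EFin \o dG i) x)%E).
  by apply/funext => x; rewrite /= sumEFin.
split; first by rewrite hE; apply: integrable_sum => //.
rewrite /Rintegral; under eq_integral do rewrite -sumEFin.
rewrite (integral_sum measurableT dGi).
by rewrite big1 => [//|i _]; exact: dG0.
Qed.

Lemma centred_le x : `|phi x - c| <= K + `|c|. Proof. exact: zetaK. Qed.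

End zeta.

Variables (beta : R).
Hypothesis nb : n%:R / 2 < beta.

(** Here c is the Cauchy mean of phi; phi - c is bounded, so [cauchy_poincare] applies with growth
    exponent 0. *)
Lemma core_inequality_high lam : n%:R / 2 + 2 <= beta ->
  0 <= lam -> lam <= 4 * (beta - n%:R / 2 - 1) -> lam <= 2 * (beta - 1) ->
  exists c, lam * I (fun x => (phi x - c) ^+ 2 * omega x `^ (- beta)) <=
    I (fun x => (\sum_(i < n) dphi i x ^+ 2) * omega x `^ (1 - beta)).
Proof.
move=> b2 l0 l1 l2.
pose J := I (fun x => omega x `^ (- beta)).
have J0 : 0 < J := Rintegral_omega_powR_gt0 nb.
pose c := I (fun x => phi x * omega x `^ (- beta)) / J.
exists c; rewrite -lee_fin EFinM.
have iphi : Leb.-integrable setT (fun x => (phi x * omega x `^ (- beta))%:E).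
  apply: (integrable_decay (K := K) nb).
    by apply: measurable_funM => //; exact: measurable_omega_powR.
  by move=> x; rewrite normrM (ger0_norm (powR_ge0 _ _)) ler_wpM2r ?powR_ge0.
have iw := integrable_omega_powR nb.
rewrite /Rintegral !fineK; last 2 first.
- exact: integrable_fin_num (integrable_dirichlet nb).
- exact: integrable_fin_num (integrable_zeta2 c nb).
have C0 : 0 <= K + `|c| by rewrite addr_ge0 ?K0.
have b22 : 2 <= beta by move: n2R b2; lra.
have a1 : 1 < beta - n%:R / 2 by move: b2; lra.
apply: (@cauchy_poincare R n beta _ b22 a1 (fun x => phi x - c) (K + `|c|) 0 C0) => //.
- by move: n2; case: (n).
- by rewrite mulr0; move: a1; lra.
- by apply: pgrowthB => //; exact: pgrowth_cst.
- by move=> x; rewrite powRr0 mulr1; exact: centred_le.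
- move=> i; apply: (C1_line_ext (C1_lineB (phiP i) (C1_line_cst i c))) => x.
  by rewrite subr0.
- transitivity (\int[Leb]_x ((phi x * omega x `^ (- beta))%:E - c%:E * (omega x `^ (- beta))%:E))%E.
    by apply: eq_integral => x _; rewrite -EFinM -EFinB mulrBl.
  rewrite integralB//; last exact: integrableZl.
  rewrite integralZl//.
  rewrite -(fineK (integrable_fin_num measurableT iphi)) -(fineK (integrable_fin_num measurableT iw)).
  rewrite -EFinM -EFinB; congr _%:E.
  by rewrite -[fine (integral _ _ (fun x => (omega x `^ _)%:E))]/J /c divfK ?gt_eqF// subrr.
Qed.

(** The inequality at exponent n/2 + 2 is conjugated by a power of [omega]. The cross term created
    by differentiating the power is removed with [euler_ibp], which costs 4 - a^2 of the constant
    4. *)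
Lemma core_inequality_low : beta <= n%:R / 2 + 2 ->
  exists c, (beta - n%:R / 2) ^+ 2 * I (fun x => (phi x - c) ^+ 2 * omega x `^ (- beta)) <=
    I (fun x => (\sum_(i < n) dphi i x ^+ 2) * omega x `^ (1 - beta)).
Proof.
move=> b2.
(* [b0] is the exponent at which the constant is 4, and [dl] = 1 - a/2 is chosen so that 2 dl - b0 =
   -beta: the square of omega^dl z against omega^(-b0) is then z^2 against omega^(-beta). *)
pose a := beta - n%:R / 2; pose b0 : R := n%:R / 2 + 2; pose g := a / 2; pose dl := 1 - g.
have a0 : 0 < a by rewrite subr_gt0.
have a2 : a <= 2 by rewrite /a; move: b2; lra.
have bE : beta = a + n%:R / 2 by rewrite /a; lra.
pose e := 1 - g - b0.
have ne : n%:R / 2 < - e by rewrite /e /g /b0; move: a0; lra.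
pose J := I (fun x => omega x `^ e).
have J0 : 0 < J by rewrite /J -[e]opprK; exact: Rintegral_omega_powR_gt0.
(* [e] = dl - b0, so this constant is not the Cauchy mean: it makes omega^dl (phi - c) centred for
   the weight omega^(-b0). *)
pose c := I (fun x => phi x * omega x `^ e) / J.
exists c.
pose z (x : 'rV[R]_n) := phi x - c.
have zK x : `|z x| <= K + `|c| := centred_le c x.
pose f (x : 'rV[R]_n) := omega x `^ dl * z x.
pose df i (x : 'rV[R]_n) := 2 * dl * x ord0 i * omega x `^ (dl - 1) * z x + omega x `^ dl * dphi i x.
have C0 : 0 <= K + `|c| by rewrite addr_ge0 ?K0.
have b22 : 2 <= b0 by rewrite /b0; move: (n2R); lra.
have [hi h0] := euler_ibp c nb.
have dl0 : 0 <= dl by rewrite /dl /g; lra.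
have dl1 : dl <= 1 by rewrite /dl /g; move: a0; lra.
have po d : 0 <= d -> d <= 1 -> pg (fun x => omega x `^ d).
  move=> d0 d1; split; first exact: measurable_omega_powR.
  exists 1, 1%N => x; rewrite ger0_norm ?powR_ge0// mul1r expr1.
  by rewrite -[leRHS](powRr1 (ltW (omega_gt0 x))) ler_powR.
have po' d : d <= 0 -> pg (fun x => omega x `^ d).
  move=> d1; split; first exact: measurable_omega_powR.
  exists 1, 0%N => x; rewrite ger0_norm ?powR_ge0// mul1r expr0.
  by rewrite -[leRHS](powRr0 (omega x)) ler_powR.
have pz : pg z by apply: pgrowthB => //; exact: pgrowth_cst.
have fp : pg f by apply: pgrowthM => //; exact: po.
have fC x : `|f x| <= (K + `|c|) * omega x `^ dl.
  by rewrite normrM (ger0_norm (powR_ge0 _ _)) mulrC ler_wpM2r ?powR_ge0.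
have dfP i : C1_line i f (df i).
  have zP := C1_lineB (phiP i) (C1_line_cst i c).
  apply: (C1_line_ext (C1_lineM (C1_line_omega_powR i dl) zP)) => x.
  by rewrite /df subr0.
have dfp i : pg (df i).
  apply: pgrowthD => //; last by apply: pgrowthM => //; exact: po.
  apply: pgrowthM => //; apply: pgrowthM => //; last by apply: po'; move: dl1; lra.
  by apply: pgrowthZ => //; exact: pgrowth_coord.
have ie := integrable_omega_powR ne.
have iphi : Leb.-integrable setT (fun x => (phi x * omega x `^ e)%:E).
  apply: (integrable_decay (K := K) ne).
    by apply: measurable_funM => //; exact: measurable_omega_powR.
  by move=> x; rewrite opprK normrM (ger0_norm (powR_ge0 _ _)) ler_wpM2r ?powR_ge0.
have mean0 : (\int[Leb]_x (f x * omega x `^ (- b0))%:E = 0)%E.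
  transitivity (\int[Leb]_x ((phi x * omega x `^ e)%:E - c%:E * (omega x `^ (- - e))%:E))%E.
    apply: eq_integral => x _; rewrite -EFinM -EFinB opprK; congr _%:E.
    have -> : omega x `^ e = omega x `^ dl * omega x `^ (- b0).
      by rewrite (powR_mul _ _ (omega_gt0 x)).
    by rewrite /f /z; ring.
  rewrite integralB//; last exact: integrableZl.
  rewrite integralZl//.
  rewrite -(fineK (integrable_fin_num measurableT iphi)) -(fineK (integrable_fin_num measurableT ie)).
  rewrite opprK -EFinM -EFinB; congr _%:E.
  by rewrite -[fine (integral _ _ (fun x => (omega x `^ _)%:E))]/J /c divfK ?gt_eqF// subrr.
have a1 : 1 < b0 - n%:R / 2 by rewrite /b0; lra.
have da : 2 * dl < b0 - n%:R / 2 by rewrite /b0 /dl /g; move: a0; lra.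
have l1 : 4 <= 4 * (b0 - n%:R / 2 - 1) by rewrite /b0; lra.
have l2 : 4 <= 2 * (b0 - 1) by rewrite /b0; move: (n2R); lra.
have n0 : (0 < n)%N by move: n2; case: (n).
have cp := cauchy_poincare n0 b22 a1 C0 dl0 dl1 da fp fC dfP dfp (ler0n _ 4) l1 l2 mean0.
pose Z (x : 'rV[R]_n) := z x ^+ 2 * omega x `^ (- beta).
pose B (x : 'rV[R]_n) := (\sum_(i < n) dphi i x ^+ 2) * omega x `^ (1 - beta).
pose H (x : 'rV[R]_n) := \sum_(i < n) (- (2 * beta) * x ord0 i * omega x `^ (- beta - 1) * (x ord0 i * (z x * z x)) +
  omega x `^ (- beta) * (z x * z x + x ord0 i * (2 * z x * dphi i x))).
have ZE x : f x ^+ 2 * omega x `^ (- b0) = Z x.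
  rewrite /f /Z exprMn mulrAC [RHS]mulrC; congr (_ * _).
  rewrite expr2 !(powR_mul _ _ (omega_gt0 x)); congr (_ `^ _).
  by rewrite bE /dl /g /b0; lra.
(* Expanding |d(omega^dl z)|^2, the term z x . dz is the one in 2 dl [H], so only multiples of z^2
   remain to be compared. *)
have key x : (\sum_(i < n) df i x ^+ 2) * omega x `^ (1 - b0) <= B x + 2 * dl * H x + (4 - a ^+ 2) * Z x.
  pose o := omega x; have o0 : 0 < o := omega_gt0 x.
  pose p := o `^ (- beta - 1); have p0 : 0 <= p := powR_ge0 _ _.
  pose q := o `^ (- g).
  have p1E : omega x `^ (- beta) = o * p.
    by rewrite -[X in X * _](powRr1 (ltW o0)) (powR_mul _ _ o0); congr (_ `^ _); lra.
  have p2E : omega x `^ (1 - beta) = o * (o * p).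
    by rewrite -p1E -[X in X * _](powRr1 (ltW o0)) (powR_mul _ _ o0).
  have q1E : omega x `^ dl = o * q.
    by rewrite -[X in X * _](powRr1 (ltW o0)) (powR_mul _ _ o0).
  have q0E : omega x `^ (dl - 1) = q by congr (_ `^ _); rewrite /dl; lra.
  have qp : q * q * omega x `^ (1 - b0) = p.
    rewrite !(powR_mul _ _ o0); congr (_ `^ _).
    by rewrite bE /g /b0; lra.
  pose S1 := \sum_(i < n) x ord0 i ^+ 2.
  pose S2 := \sum_(i < n) x ord0 i * dphi i x.
  pose S3 := \sum_(i < n) dphi i x ^+ 2.
  have S1E : S1 = o - 1 by rewrite /o /omega addrC addKr.
  have AE : (\sum_(i < n) df i x ^+ 2) * omega x `^ (1 - b0) =
      p * (4 * dl ^+ 2 * z x ^+ 2 * S1 + 4 * dl * o * z x * S2 + o ^+ 2 * S3).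
    rewrite -qp [RHS]mulrAC; congr (_ * _).
    rewrite /S1 /S2 /S3 !mulr_sumr -!big_split/= mulr_sumr; apply: eq_bigr => i _.
    by rewrite /df q1E q0E; ring.
  have HE : H x = n%:R * (o * p * z x ^+ 2) - 2 * beta * p * z x ^+ 2 * S1 + 2 * o * p * z x * S2.
    have -> : n%:R * (o * p * z x ^+ 2) = \sum_(i < n) o * p * z x ^+ 2.
      by rewrite sumr_const card_ord mulr_natl.
    rewrite /S1 /S2 !mulr_sumr -sumrB -big_split/=; apply: eq_bigr => i _.
    by rewrite p1E -/p; ring.
  rewrite AE HE /B /Z -/S3 p1E p2E S1E -subr_ge0.
  have -> : n%:R = 2 * (beta - a) :> R by rewrite bE; field.
  (* The terms in omega^(-beta) z^2 cancel because (2 dl + a)^2 = 4. What is left comes from |x|^2 =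
     omega - 1 and is nonnegative. *)
  rewrite (_ : _ - _ = (4 * dl * beta + 4 * dl ^+ 2) * (p * z x ^+ 2)).
    by rewrite mulr_ge0 ?(mulr_ge0 p0 (sqr_ge0 _))// addr_ge0 ?mulr_ge0 ?sqr_ge0//; move: (n2R) (nb); lra.
  by rewrite /dl /g; field.
have iZ : Leb.-integrable setT (EFin \o Z) := integrable_zeta2 c nb.
have iB : Leb.-integrable setT (EFin \o B) := integrable_dirichlet nb.
have iH : Leb.-integrable setT (EFin \o H) := hi.
suff : a ^+ 2 * I Z <= I B by [].
have IR : I (fun x => B x + 2 * dl * H x + (4 - a ^+ 2) * Z x) = I B + (4 - a ^+ 2) * I Z.
  have iH' := integrableZl measurableT (2 * dl) iH.
  have iZ' := integrableZl measurableT (4 - a ^+ 2) iZ.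
  rewrite RintegralD//; last exact: (integrableD measurableT iB iH').
  by rewrite RintegralD// !RintegralZl// [I H]h0 mulr0 addr0.
have iR : Leb.-integrable setT (EFin \o (fun x => B x + 2 * dl * H x + (4 - a ^+ 2) * Z x)).
  have iH' := integrableZl measurableT (2 * dl) iH.
  have iZ' := integrableZl measurableT (4 - a ^+ 2) iZ.
  exact: (integrableD measurableT (integrableD measurableT iB iH') iZ').
suff : 4 * I Z <= I (fun x => B x + 2 * dl * H x + (4 - a ^+ 2) * Z x) by rewrite IR; lra.
rewrite -lee_fin EFinM /Rintegral !fineK; last 2 first.
- exact: (integrable_fin_num measurableT iR).
- exact: (integrable_fin_num measurableT iZ).
under eq_integral do rewrite -ZE.
apply: le_trans cp _; apply: ge0_le_integral => //.
- move=> x _; rewrite lee_fin mulr_ge0 ?powR_ge0// sumr_ge0// => i _; exact: sqr_ge0.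
- apply/measurable_EFinP; apply: measurable_funM; last exact: measurable_omega_powR.
  by apply: measurable_sum => i; apply: measurable_funX; exact: (dfp i).1.
- by have /integrableP[] := iR.
- by move=> x _; rewrite lee_fin; exact: key.
Qed.

End core_inequality.

(** * Integration against a measure with a density *)

Section density.
Local Open Scope ereal_scope.
Context d (T : measurableType d) (R : realType).
Variables (m nu : {measure set T -> \bar R}) (p : T -> R).
Hypotheses (mp : measurable_fun setT p) (p0 : forall x, (0 <= p x)%R).
Hypothesis nuE : forall A, measurable A -> nu A = \int[m]_(x in A) (p x)%:E.

Let density_indic E : measurable E ->
  \int[nu]_x (\1_E x)%:E = \int[m]_x ((\1_E x)%:E * (p x)%:E).
Proof.
move=> mE; rewrite integral_indic// setIT nuE// integral_mkcond.
apply: eq_integral => x _; rewrite patchE indicE.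
by case: ifPn => _; rewrite ?mul1e ?mul0e.
Qed.

Import HBNNSimple.

Let mpE : measurable_fun setT (EFin \o p). Proof. exact/measurable_EFinP. Qed.

Let density_nnsfun (h : {nnsfun T >-> R}) :
  \int[nu]_x (h x)%:E = \int[m]_x ((h x)%:E * (p x)%:E).
Proof.
under [LHS]eq_integral do rewrite fimfunE -fsumEFin//.
rewrite [LHS]ge0_integral_fsum//; last 2 first.
  - by move=> r; exact/measurable_EFinP/measurableT_comp.
  - by move=> n x _; rewrite EFinM nnfun_muleindic_ge0.
under [RHS]eq_integral.
  move=> x xD; rewrite fimfunE -fsumEFin// muleC ge0_mule_fsumr; last first.
    by move=> r; rewrite EFinM nnfun_muleindic_ge0.
  over.
rewrite [RHS]ge0_integral_fsum//; last 2 first.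
  - move=> r; apply: emeasurable_funM => //.
    by apply/measurable_EFinP; do 2 apply/measurableT_comp => //.
  - by move=> n x _; apply: mule_ge0; [rewrite lee_fin|rewrite EFinM nnfun_muleindic_ge0].
apply: eq_fsbigr => r _.
under eq_integral do rewrite EFinM.
rewrite integralZl_indic_nnsfun//= density_indic//.
have [r0|r0] := leP 0%R r.
  rewrite -ge0_integralZl//.
  - by apply: eq_integral => x _; rewrite [RHS]muleC EFinM muleA.
  - apply: emeasurable_funM => //; exact/measurable_EFinP/measurable_indic.
  - by move=> x _; rewrite mule_ge0// lee_fin.
rewrite (preimage_nnfun0 h r0); under eq_integral do rewrite indic0 mul0e.
rewrite integral0 mule0; apply/esym; apply: integral0_eq => x _.
by rewrite /= indic0 mulr0 mule0.
Qed.

Lemma ge0_integral_density (f : T -> \bar R) : measurable_fun setT f ->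
  (forall x, 0 <= f x) -> \int[nu]_x f x = \int[m]_x (f x * (p x)%:E).
Proof.
move=> mf f0; pose f_ := nnsfun_approx measurableT mf.
have mf_ k : measurable_fun setT (fun x => (f_ k x)%:E) by exact/measurable_EFinP.
transitivity (limn (fun k => \int[nu]_x (f_ k x)%:E)).
  rewrite -monotone_convergence//=.
  - by apply: eq_integral => x _; apply/esym/cvg_lim => //=; exact: cvg_nnsfun_approx.
  - by move=> n x _; rewrite lee_fin.
  - by move=> x _ a b ab; rewrite lee_fin//; exact/lefP/nd_nnsfun_approx.
transitivity (limn (fun k => \int[m]_x ((f_ k x)%:E * (p x)%:E))).
  by congr (limn _); apply/funext => k; exact: density_nnsfun.
rewrite -monotone_convergence//=.
- apply: eq_integral => x _; apply/cvg_lim => //.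
  by apply: cvgeZr => //; exact: cvg_nnsfun_approx.
- by move=> n; exact: emeasurable_funM.
- by move=> n x _; rewrite mule_ge0// lee_fin.
- move=> x _ a b ab; apply: lee_wpmul2r; rewrite lee_fin//.
  exact/lefP/nd_nnsfun_approx.
Qed.

Lemma integrable_density (f : T -> R) : measurable_fun setT f ->
  m.-integrable setT (fun x => (f x * p x)%:E) -> nu.-integrable setT (EFin \o f).
Proof.
move=> mf /integrableP[_ fi]; apply/integrableP; split; first exact/measurable_EFinP.
rewrite ge0_integral_density//; last by apply/measurableT_comp => //; exact/measurable_EFinP.
move: fi; congr (_ < _); apply: eq_integral => x _.
by rewrite EFinM abseM (gee0_abs (p0 x : (0 <= (p x)%:E))).
Qed.

Lemma integral_density (f : T -> R) : measurable_fun setT f ->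
  \int[nu]_x (f x)%:E = \int[m]_x (f x * p x)%:E.
Proof.
move=> mf; rewrite [LHS]integralE [RHS]integralE.
have mfE : measurable_fun setT (EFin \o f) by exact/measurable_EFinP.
rewrite !ge0_integral_density//; [|exact: measurable_funeneg|exact: measurable_funepos].
have maxp (y : R) x : maxe y%:E 0 * (p x)%:E = maxe (y * p x)%:E 0.
  by rewrite -!EFin_max -EFinM mulrC maxr_pMr// mulr0 mulrC.
congr (_ - _); apply: eq_integral => x _.
  by rewrite !funeposE/= maxp.
by rewrite !funenegE/= maxp mulNr.
Qed.

End density.

(** * Convergence of products in L^2 *)

Section L2_convergence.
Local Open Scope ereal_scope.
Context d (T : measurableType d) (R : realType) (P : probability T R).
Implicit Types f g u v : T -> R.
Notation N f := ('N[P]_2%:E[f]).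

Lemma Lfun_measurable f : f \in Lfun P 2%:E -> measurable_fun setT f.
Proof. by rewrite inE => /andP[/[!inE]]. Qed.

Lemma Lfun2P f : measurable_fun setT f ->
  P.-integrable setT (EFin \o (fun x => f x ^+ 2)%R) -> f \in Lfun P 2%:E.
Proof.
move=> mf fi; rewrite inE; apply/andP; split; rewrite inE//=.
rewrite /finite_norm unlock poweR_lty//.
have /integrableP[_] := fi; congr (_ < _); apply: eq_integral => x _ /=.
by rewrite powR_mulrn// normrX.
Qed.

Lemma Lfun2_norm_fin f : f \in Lfun P 2%:E -> (N (EFin \o f)) < +oo.
Proof. by rewrite inE => /andP[_ /[!inE]]. Qed.

Lemma Lfun2B f g : f \in Lfun P 2%:E -> g \in Lfun P 2%:E ->
  (f \- g)%R \in Lfun P 2%:E.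
Proof. by move=> lf lg; rewrite rpredB ?lee1n//=. Qed.

Lemma Lfun2_cst c : cst c \in Lfun P 2%:E.
Proof. exact: Lfun_cst. Qed.

Lemma Lfun2_mul_integrable f g : f \in Lfun P 2%:E -> g \in Lfun P 2%:E ->
  P.-integrable setT (fun x => (f x * g x)%:E).
Proof. by move=> lf lg; apply/Lfun1_integrable; exact: Lfun2_mul_Lfun1. Qed.

Lemma cauchy_schwarz f g : measurable_fun setT f -> measurable_fun setT g ->
  \int[P]_x `|(f x * g x)%:E| <= (N (EFin \o f)) * (N (EFin \o g)).
Proof.
move=> mf mg; have := @hoelder _ _ _ P f g 2 2 mf mg.
rewrite Lnorm1; apply => //.
by lra.
Qed.

Lemma cauchy_schwarz_Rintegral f g : f \in Lfun P 2%:E -> g \in Lfun P 2%:E ->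
  (`|\int[P]_x (f x * g x)| <= fine (N (EFin \o f)) * fine (N (EFin \o g)))%R.
Proof.
move=> lf lg.
have fi := Lfun2_mul_integrable lf lg.
have nfin h : h \in Lfun P 2%:E -> (N (EFin \o h)) \is a fin_num.
  by move=> lh; rewrite ge0_fin_numE ?Lnorm_ge0//; exact: Lfun2_norm_fin.
apply: (le_trans (le_normr_Rintegral _ fi)) => //.
rewrite -fineM ?nfin//; apply: fine_le.
- by have := integrable_fin_num measurableT (integrable_abse fi).
- by rewrite fin_numM ?nfin.
- exact: cauchy_schwarz (Lfun_measurable lf) (Lfun_measurable lg).
Qed.

Lemma L2_cvg_mul (u v : nat -> T -> R) f g :
  (forall k, u k \in Lfun P 2%:E) -> (forall k, v k \in Lfun P 2%:E) ->
  f \in Lfun P 2%:E -> g \in Lfun P 2%:E ->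
  ((N (EFin \o (u k \- f)%R)) @[k --> \oo] --> 0) ->
  ((N (EFin \o (v k \- g)%R)) @[k --> \oo] --> 0) ->
  (\int[P]_x (u k x * v k x))%R @[k --> \oo] --> (\int[P]_x (f x * g x))%R.
Proof.
move=> lu lv lf lg uf vg.
have luf k : (u k \- f)%R \in Lfun P 2%:E by exact: Lfun2B.
have lvg k : (v k \- g)%R \in Lfun P 2%:E by exact: Lfun2B.
pose a k := fine (N (EFin \o (u k \- f)%R)); pose b k := fine (N (EFin \o (v k \- g)%R)).
have ca : a k @[k --> \oo] --> (0%R : R) by exact: (fine_cvg uf).
have cb : b k @[k --> \oo] --> (0%R : R) by exact: (fine_cvg vg).
pose A := fine (N (EFin \o f)); pose B := fine (N (EFin \o g)).
have key k : (`|\int[P]_x (u k x * v k x) - \int[P]_x (f x * g x)| <=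
    a k * b k + (a k * B + A * b k))%R.
  have i1 := Lfun2_mul_integrable (luf k) (lvg k).
  have i2 := Lfun2_mul_integrable (luf k) lg.
  have i3 := Lfun2_mul_integrable lf (lvg k).
  have i23 := integrableD measurableT i2 i3.
  have i0 := Lfun2_mul_integrable lf lg.
  have -> : (\int[P]_x (u k x * v k x) = \int[P]_x (f x * g x) +
     (\int[P]_x ((u k \- f) x * (v k \- g) x) +
     (\int[P]_x ((u k \- f) x * g x) + \int[P]_x (f x * (v k \- g) x))))%R.
    rewrite -(RintegralD _ i2 i3)// -(RintegralD _ i1 i23)//.
    rewrite -(RintegralD _ i0 (integrableD measurableT i1 i23))//.
    by apply: eq_Rintegral => x _ /=; ring.
  rewrite addrC addKr; apply: le_trans (ler_normD _ _) _.
  apply: lerD; first exact: cauchy_schwarz_Rintegral.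
  by apply: le_trans (ler_normD _ _) _; apply: lerD; exact: cauchy_schwarz_Rintegral.
have c0 : (a k * b k + (a k * B + A * b k))%R @[k --> \oo] --> (0%R : R).
  rewrite [X in _ --> X](_ : _ = 0 * 0 + (0 * B + A * 0))%R; last by ring.
  by apply: cvgD; [exact: cvgM|apply: cvgD; [exact: cvgMl|exact: cvgMr]].
have /cvgrPdist_le c1 := c0.
apply/cvgrPdist_le => e e0; near=> k; rewrite distrC.
apply: (le_trans (key k)); apply: le_trans (ler_norm _) _.
by rewrite -normrN -sub0r; near: k; exact: c1.
Unshelve. all: by end_near. Qed.

End L2_convergence.

(** * Integrals against the Cauchy probability measure *)

Section cauchy_integral.
Context {R : realType} (n : nat) (beta : R).
Notation Leb := (@lebesgue_rV R n).
Notation mu := (@Defs.cauchy R n beta).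
Notation I F := (\int[Leb]_x (F x))%R.
Notation J := (I (fun x => omega x `^ (- beta))).
Hypotheses (n2 : (2 <= n)%N) (nb : n%:R / 2 < beta).
Let J0 : 0 < J := Rintegral_omega_powR_gt0 n2 nb.
Let p (x : 'rV[R]_n) := J^-1 * omega x `^ (- beta).

Let mp : measurable_fun setT p.
Proof. by apply: measurable_funM => //; exact: measurable_omega_powR. Qed.

Let p0 x : 0 <= p x. Proof. by rewrite mulr_ge0 ?powR_ge0// invr_ge0 ltW. Qed.

Let cauchyE (A : set 'rV[R]_n) : measurable A -> mu A = (\int[Leb]_(x in A) (p x)%:E)%E.
Proof.
move=> mA.
have JE : (cauchy_weight beta : {measure set 'rV[R]_n -> \bar R}) setT = J%:E.
  by rewrite /= /cauchy_weight fineK// (integrable_fin_num measurableT (integrable_omega_powR n2 nb)).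
rewrite /Defs.cauchy/= /mnormalize.
(* The total mass is positive and finite, so [mnormalize] takes its ordinary branch and not the
   Dirac mass. *)
rewrite JE/= eqe (gt_eqF J0)/= muleC /cauchy_weight.
rewrite -ge0_integralZl//.
- apply/measurable_EFinP; apply: measurable_funTS; exact: measurable_omega_powR.
- by move=> x _; rewrite lee_fin powR_ge0.
- by rewrite lee_fin invr_ge0 ltW.
Qed.

Lemma cauchy_integrable (F : 'rV[R]_n -> R) : measurable_fun setT F ->
  Leb.-integrable setT (fun x => (F x * omega x `^ (- beta))%:E) ->
  mu.-integrable setT (EFin \o F).
Proof.
move=> mF iF; apply: (integrable_density mp p0 cauchyE mF).
have := integrableZl measurableT J^-1 iF.
by congr (_.-integrable _ _); apply/funext => x; rewrite -EFinM mulrCA.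
Qed.

Lemma cauchy_Rintegral (F : 'rV[R]_n -> R) : measurable_fun setT F ->
  Leb.-integrable setT (fun x => (F x * omega x `^ (- beta))%:E) ->
  (\int[mu]_x F x)%R = J^-1 * I (fun x => F x * omega x `^ (- beta)).
Proof.
move=> mF iF; rewrite -RintegralZl// /Rintegral (integral_density mp p0 cauchyE mF).
by congr fine; apply: eq_integral => x _; rewrite mulrCA.
Qed.

End cauchy_integral.

(** * Test functions and their decay *)

Section test_functions.
Context {R : realType} (n : nat).
Implicit Types (phi : 'rV[R]_n -> R).
Notation D phi s := (foldr partial phi s).

Lemma differentiable_omega (x : 'rV[R]_n) : differentiable (@omega R n) x.
Proof.
have -> : @omega R n = cst 1 + \sum_(i < n) ((fun y : 'rV[R]_n => y ord0 i) ^+ 2).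
  apply/funext => y; rewrite /omega /= fct_sumE; congr (_ + _).
apply: differentiableD; first exact: differentiable_cst.
apply: differentiable_sum => i; apply: differentiableX; exact: differentiable_coord.
Qed.

Lemma smooth_continuous phi s : smooth phi -> continuous (D phi s).
Proof. by move=> sp x; apply: differentiable_continuous; exact: sp. Qed.

Lemma differentiable_C1_line i phi : (forall x, differentiable phi x) ->
  (forall x, differentiable (partial i phi) x) -> C1_line i phi (partial i phi).
Proof.
move=> d1 d2 x t; split.
  have dp : derivable phi (x + t *: delta_mx ord0 i) (delta_mx ord0 i) by exact: diff_derivable.
  have e : (fun h : R => h^-1 *: (((fun s : R => phi (x + s *: delta_mx ord0 i)) \o shift t) (h *: 1) - phi (x + t *: delta_mx ord0 i))) =
     (fun h : R => h^-1 *: ((phi \o shift (x + t *: delta_mx ord0 i)) (h *: delta_mx ord0 i) - phi (x + t *: delta_mx ord0 i))).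
    apply/funext => h /=; congr (_ *: (phi _ - _)).
    by rewrite [h *: 1]mulr1 scalerDl addrCA.
  apply: DeriveDef; first by rewrite /derivable e.
  by rewrite /partial /derive e.
have cp : {for x + t *: delta_mx ord0 i, continuous (partial i phi)}.
  exact: differentiable_continuous.
have cl : {for t, continuous (fun s : R => x + s *: delta_mx ord0 i)}.
  apply: (@continuousD _ _ _ (cst x) (fun s : R => s *: delta_mx ord0 i)).
    exact: cvg_cst.
  exact: (@scalel_continuous R _ (delta_mx ord0 i)).
exact: (continuous_comp cl cp).
Qed.

Lemma smooth_C1_line phi i s : smooth phi -> C1_line i (D phi s) (partial i (D phi s)).
Proof.
by move=> sp; apply: differentiable_C1_line => x; [exact: sp|exact: (sp (i :: s))].
Qed.

Lemma smooth_measurable phi s : smooth phi -> measurable_fun setT (D phi s).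
Proof. by move=> sp; apply: continuous_measurable_rV; exact: smooth_continuous. Qed.

Lemma partial_closure0 phi s x : ~ closure [set y | phi y != 0] x -> D phi s x = 0.
Proof.
elim: s x => [|i s IH] x xK.
  by apply/eqP/negPn/negP => p0; apply: xK; exact: subset_closure.
have oK : open (~` closure [set y | phi y != 0]) by apply: closed_openC; exact: closed_closure.
have nK : \forall y \near x, D phi s y = cst 0 y.
  by near=> y; apply: IH; near: y; exact: open_nbhs_nbhs.
rewrite /= /partial (near_eq_derive _ nK); first exact: derive_cst.
Unshelve. all: by end_near. Qed.

(** A derivative vanishes off the closed support, and on this compact set its product with a power
    of [omega] is continuous, hence bounded. *)
Lemma test_function_decay phi s b : test_function phi ->
  exists C, forall x, `|D phi s x| <= C * omega x `^ (- b).
Proof.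
move=> [sp cK].
pose F x := D phi s x * omega x `^ b.
have cF : continuous F.
  move=> x; apply: continuousM; first exact: smooth_continuous.
  apply: (@continuous_comp _ _ _ (@omega R n) (fun y => y `^ b)); first exact: differentiable_continuous (differentiable_omega x).
  exact: (der_continuous (is_derive1_powR b (omega_gt0 x))).
have /compact_bounded [M [_ MK]] : compact (F @` closure [set x | phi x != 0]).
  by apply: continuous_compact => //; exact: continuous_subspaceT.
exists (`|M| + 1) => x.
rewrite powRN ler_pdivlMr ?powR_gt0 ?omega_gt0//.
have -> : `|D phi s x| * omega x `^ b = `|F x|.
  by rewrite normrM (ger0_norm (powR_ge0 _ _)).
have [xK|xK] := pselect (closure [set x | phi x != 0] x).
  apply: MK; last by exists x.
  by rewrite (le_lt_trans (ler_norm M))// ltrDl.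
by rewrite /F partial_closure0// mul0r normr0 addr_ge0.
Qed.

End test_functions.

(** * Rapidly decreasing functions *)

Section rapid_decay.
Context {R : realType} (n : nat).
Notation Leb := (@lebesgue_rV R n).
Notation I F := (\int[Leb]_x (F x))%R.
Notation pg := (pgrowth (@omega R n)).
Let om1 := @omega_ge1 R n.

(** A class containing test functions, their derivatives and their images by L, stable under
    products with functions of polynomial growth; every integral needed for integration by parts
    converges on it. *)
Definition rapid (F : 'rV[R]_n -> R) := measurable_fun setT F /\
  forall b, exists C, forall x, `|F x| <= C * omega x `^ (- b).

Lemma rapidM F G : rapid F -> pg G -> rapid (fun x => F x * G x).
Proof.
move=> [mF FC] Gp; split; first exact: measurable_funM mF Gp.1.
move=> b; have [C C0 [k Gk]] := pgrowth_ub om1 Gp.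
have [C' FC'] := FC (b + k%:R); exists (C' * C) => x.
rewrite normrM; apply: (le_trans (ler_pM (normr_ge0 _) (normr_ge0 _) (FC' x) (Gk x))).
rewrite mulrACA -powR_mulrn ?(ltW (omega_gt0 x))// (powR_mul _ _ (omega_gt0 x)).
by rewrite opprD subrK.
Qed.

Lemma rapidD F G : rapid F -> rapid G -> rapid (fun x => F x + G x).
Proof.
move=> [mF FC] [mG GC]; split; first exact: measurable_funD mF mG.
move=> b; have [C FC'] := FC b; have [C' GC'] := GC b; exists (C + C') => x.
by rewrite mulrDl (le_trans (ler_normD _ _))// lerD.
Qed.

Lemma rapid0 : rapid (fun=> 0).
Proof.
by split=> // b; exists 0 => x; rewrite mul0r normr0.
Qed.

Lemma rapid_sum (I : Type) (s : seq I) (F : I -> 'rV[R]_n -> R) :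
  (forall i, rapid (F i)) -> rapid (fun x => \sum_(i <- s) F i x).
Proof.
move=> Fp; elim: s => [|i s IH].
  by have := rapid0; congr rapid; apply/funext => x; rewrite big_nil.
have := rapidD (Fp i) IH; congr rapid.
by apply/funext => x; rewrite big_cons.
Qed.

Lemma rapid_pgrowth F : rapid F -> pg F.
Proof.
move=> [mF FC]; split=> //; have [C FC0] := FC 0; exists C, 0%N => x.
by have := FC0 x; rewrite oppr0 powRr0 expr0.
Qed.

Lemma rapid_integrable F b : (2 <= n)%N -> rapid F ->
  Leb.-integrable setT (fun x => (F x * omega x `^ b)%:E).
Proof.
move=> n2 [mF FC]; have [C FC1] := FC (n%:R / 2 + 1 + b).
have nb : n%:R / 2 < n%:R / 2 + 1 :> R by rewrite ltrDl.
apply: (integrable_decay (K := C) n2 nb).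
  by apply: measurable_funM => //; exact: measurable_omega_powR.
move=> x; rewrite normrM (ger0_norm (powR_ge0 _ _)).
apply: (le_trans (ler_wpM2r (powR_ge0 _ _) (FC1 x))).
by rewrite -mulrA (powR_mul _ _ (omega_gt0 x)) [- _ + _](_ : _ = - (n%:R / 2 + 1))//; ring.
Qed.

Lemma test_function_rapid phi s : test_function phi -> rapid (foldr partial phi s).
Proof.
move=> hp; split; first exact: smooth_measurable hp.1.
by move=> b; exact: test_function_decay.
Qed.

Lemma diffusion_rapid beta phi : test_function phi -> rapid (diffusion beta phi).
Proof.
move=> hp.
have l : rapid (laplacian phi).
  by apply: rapid_sum => i; exact: (test_function_rapid [:: i; i]).
have e : rapid (fun x => \sum_(i < n) partial i phi x * x ord0 i).
  apply: rapid_sum => i; apply: rapidM; first exact: (test_function_rapid [:: i]).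
  exact: pgrowth_coord.
have := rapidD (rapidM l (@pgrowth_omega R n))
  (rapidM e (pgrowth_cst (@omega R n) (- (2 * (beta - 1))))).
congr rapid; apply/funext => x; rewrite /diffusion mulrC mulrN [in RHS]mulrC.
congr (_ - _); rewrite mulrC; congr (_ * _).
by apply: eq_bigr => i _; rewrite mulrC.
Qed.

End rapid_decay.

(** * The Dirichlet form of L *)

Section lower_bound.
Context {R : realType} (n : nat) (beta : R).
Notation Leb := (@lebesgue_rV R n).
Notation mu := (@Defs.cauchy R n beta).
Notation I F := (\int[Leb]_x (F x))%R.
Notation J := (I (fun x => omega x `^ (- beta))).
Notation pg := (pgrowth (@omega R n)).
Hypotheses (n2 : (2 <= n)%N) (nb : n%:R / 2 < beta).
Let J0 : 0 < J := Rintegral_omega_powR_gt0 n2 nb.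
Let om1 := @omega_ge1 R n.

Lemma rapid_cauchy_Rintegral F : rapid F ->
  (\int[mu]_x F x)%R = J^-1 * I (fun x => F x * omega x `^ (- beta)).
Proof. by move=> rF; apply: cauchy_Rintegral => //; [exact: rF.1|exact: rapid_integrable]. Qed.

Lemma rapid_Lfun2 F : rapid F -> F \in Lfun mu 2%:E.
Proof.
move=> rF; apply: Lfun2P; first exact: rF.1.
apply: cauchy_integrable => //; first exact: measurable_funX rF.1.
have := rapid_integrable (- beta) n2 (rapidM rF (rapid_pgrowth rF)).
by congr (_.-integrable _ _); apply/funext => x; rewrite expr2.
Qed.

Variable phi : 'rV[R]_n -> R.
Hypothesis tphi : test_function phi.
Let rphi : rapid phi := test_function_rapid [::] tphi.
Let rd i : rapid (partial i phi) := test_function_rapid [:: i] tphi.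
Let rdd i j : rapid (partial i (partial j phi)) := test_function_rapid [:: i; j] tphi.

(** L phi times omega^(-beta) is the divergence of omega^(1 - beta) d phi; hence the sum of both
    integrands is the divergence of omega^(1 - beta) phi d phi, whose integral is zero. *)
Lemma dirichlet_form : I (fun x => phi x * diffusion beta phi x * omega x `^ (- beta)) =
  - I (fun x => (\sum_(i < n) partial i phi x ^+ 2) * omega x `^ (1 - beta)).
Proof.
pose dG i (x : 'rV[R]_n) := 2 * (1 - beta) * x ord0 i * omega x `^ (1 - beta - 1) * (phi x * partial i phi x) +
  omega x `^ (1 - beta) * (partial i phi x * partial i phi x + phi x * partial i (partial i phi) x).
have rpp i : rapid (fun x => phi x * partial i phi x) by exact: rapidM (rapid_pgrowth (rd i)).
have dGi i : Leb.-integrable setT (EFin \o dG i).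
  have r1 := rapid_integrable (1 - beta - 1) n2 (rapidM (rpp i) (pgrowthZ om1 (2 * (1 - beta)) (pgrowth_coord i))).
  have r2 := rapid_integrable (1 - beta) n2 (rapidD (rapidM (rd i) (rapid_pgrowth (rd i)))
     (rapidM rphi (rapid_pgrowth (rdd i i)))).
  have := integrableD measurableT r1 r2.
  by congr (_.-integrable _ _); apply/funext => x; rewrite /dG /= -EFinD; congr _%:E; ring.
have dG0 i : (\int[Leb]_x (dG i x)%:E = 0)%E.
  apply: (@integral_line0 _ _ i (fun x => omega x `^ (1 - beta) * (phi x * partial i phi x))) => //.
    exact: C1_lineM (C1_line_omega_powR i (1 - beta)) (C1_lineM
      (smooth_C1_line i [::] tphi.1) (smooth_C1_line i [:: i] tphi.1)).
  have [C FC] := (rpp i).2 (2 - beta).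
  apply: (@vanish_line_decay _ _ _ _ C 1) => // x.
  rewrite normrM (ger0_norm (powR_ge0 _ _)).
  apply: (le_trans (ler_wpM2l (powR_ge0 _ _) (FC x))).
  by rewrite mulrCA (powR_mul _ _ (omega_gt0 x)) le_eqVlt; apply/orP; left; apply/eqP; congr (_ * _ `^ _); ring.
have s0 : I (fun x => \sum_(i < n) dG i x) = 0.
  rewrite /Rintegral; under eq_integral do rewrite -sumEFin.
  by rewrite (integral_sum measurableT dGi) big1 => [//|i _]; exact: dG0.
apply/eqP; rewrite -subr_eq0 opprK; apply/eqP.
have i1 := rapid_integrable (- beta) n2 (rapidM rphi (rapid_pgrowth (diffusion_rapid beta tphi))).
have i2 : Leb.-integrable setT (fun x => ((\sum_(i < n) partial i phi x ^+ 2) * omega x `^ (1 - beta))%:E).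
  apply: rapid_integrable => //; apply: rapid_sum => i.
  exact: rapidM (rd i) (rapid_pgrowth (rd i)).
rewrite -[RHS]s0 -(RintegralD measurableT i1 i2); apply: eq_Rintegral => x _.
have wE' : omega x `^ (1 - beta) = omega x * omega x `^ (- beta).
  by rewrite -[X in X * _](powRr1 (ltW (omega_gt0 x))) (powR_mul _ _ (omega_gt0 x)).
have -> : \sum_(i < n) dG i x = 2 * (1 - beta) * omega x `^ (- beta) * phi x * (\sum_(i < n) x ord0 i * partial i phi x) +
   omega x `^ (1 - beta) * (\sum_(i < n) partial i phi x ^+ 2) + omega x `^ (1 - beta) * phi x * laplacian phi x.
  rewrite /laplacian !mulr_sumr -!big_split/=; apply: eq_bigr => i _.
  rewrite /dG (_ : 1 - beta - 1 = - beta); last by ring.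
  by ring.
by rewrite /diffusion wE'; ring.
Qed.

(** Any centring constant c is good enough, because the mean minimises the second moment about a
    point; the rest is division by the total mass J. *)
Lemma poincare_of_core lam c : 0 <= lam ->
  lam * I (fun x => (phi x - c) ^+ 2 * omega x `^ (- beta)) <=
    I (fun x => (\sum_(i < n) partial i phi x ^+ 2) * omega x `^ (1 - beta)) ->
  lam * ((\int[mu]_x (phi x * phi x))%R - (\int[mu]_x (phi x * 1))%R ^+ 2) <=
  - (\int[mu]_x (phi x * diffusion beta phi x))%R.
Proof.
move=> l0 core.
have rpp : rapid (fun x => phi x * phi x) by exact: rapidM (rapid_pgrowth rphi).
have rp1 : rapid (fun x => phi x * 1) by apply: rapidM => //; exact: pgrowth_cst.
have rpd : rapid (fun x => phi x * diffusion beta phi x).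
  exact: rapidM (rapid_pgrowth (diffusion_rapid beta tphi)).
rewrite !rapid_cauchy_Rintegral// dirichlet_form.
set A := I (fun x => phi x * phi x * _); set B := I (fun x => phi x * 1 * _).
have cE : I (fun x => (phi x - c) ^+ 2 * omega x `^ (- beta)) = A - 2 * c * B + c ^+ 2 * J.
  have ia := rapid_integrable (- beta) n2 rpp.
  have ib := integrableZl measurableT (- (2 * c)) (rapid_integrable (- beta) n2 rp1).
  have ij := integrableZl measurableT (c ^+ 2) (integrable_omega_powR n2 nb).
  have ibj := integrableD measurableT ib ij.
  rewrite -addrA -mulNr -(RintegralZl _ _ (rapid_integrable (- beta) n2 rp1))// -(RintegralZl _ _ (integrable_omega_powR n2 nb))//.
  rewrite -(RintegralD measurableT ib ij) -(RintegralD measurableT ia ibj).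
  by apply: eq_Rintegral => x _ /=; ring.
have h : A - B ^+ 2 / J <= A - 2 * c * B + c ^+ 2 * J.
  rewrite -subr_ge0 (_ : _ - _ = (B - c * J) ^+ 2 / J); last by field; rewrite gt_eqF.
  by rewrite divr_ge0 ?sqr_ge0// ltW.
have := le_trans (ler_wpM2l l0 h) _; rewrite -cE => /(_ _ core) h2.
rewrite mulrN opprK.
have -> : lam * (J^-1 * A - (J^-1 * B) ^+ 2) = J^-1 * (lam * (A - B ^+ 2 / J)) by field; rewrite gt_eqF.
by rewrite ler_wpM2l// invr_ge0 ltW.
Qed.

End lower_bound.

(** * Lower bounds on the spectral gap *)

Section spectral_gap_lower_bound.
Context {R : realType} (n : nat) (beta : R).
Notation mu := (@Defs.cauchy R n beta).
Hypotheses (n2 : (2 <= n)%N) (nb : n%:R / 2 < beta).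

Lemma variance_Rintegral (f : 'rV[R]_n -> R) : f \in Lfun mu 2%:E ->
  'V_mu[f] = ((\int[mu]_x (f x * f x))%R - (\int[mu]_x (f x * 1))%R ^+ 2)%:E.
Proof.
move=> lf; have lf1 := Lfun2_cst mu 1.
rewrite varianceE// unlock EFinB EFin_expe /Rintegral !fineK.
- by congr (_ - _ ^+ 2)%E; apply: eq_integral => x _; rewrite mulr1.
- exact: (integrable_fin_num measurableT (Lfun2_mul_integrable lf lf1)).
- exact: (integrable_fin_num measurableT (Lfun2_mul_integrable lf lf)).
Qed.

(** A pair in the graph of the closure is a joint L^2 limit of test functions and their images under
    L; second moment, mean and quadratic form all pass to the limit by [L2_cvg_mul], hence so does
    the inequality. *)
Lemma spectral_gap_ge lam : 0 <= lam ->
  (forall phi, test_function phi ->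
    lam * ((\int[mu]_x (phi x * phi x))%R - (\int[mu]_x (phi x * 1))%R ^+ 2) <=
    - (\int[mu]_x (phi x * diffusion beta phi x))%R) ->
  (lam%:E <= spectral_gap n beta)%E.
Proof.
move=> l0 poinc; apply: le_ereal_inf_tmp => _ [f [g [[lf lg [phi [tphi cf cg]]] V0 ->]]].
have l1 := Lfun2_cst mu 1.
have lphi k := rapid_Lfun2 n2 nb (test_function_rapid [::] (tphi k)).
have ldphi k := rapid_Lfun2 n2 nb (diffusion_rapid beta (tphi k)).
have c1 : ('N[mu]_2%:E[EFin \o (cst 1%R \- cst 1%R)%R] @[k --> \oo] --> 0)%E.
  have -> : EFin \o (cst 1 \- cst 1)%R = cst 0%E :> ('rV[R]_n -> \bar R).
    by apply/funext => x /=; rewrite subrr.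
  by rewrite Lnorm0 ?eqe ?pnatr_eq0//; exact: cvg_cst.
have cff := L2_cvg_mul lphi lphi lf lf cf cf.
have cf1 := L2_cvg_mul lphi (fun=> l1) lf l1 cf c1.
have cfg := L2_cvg_mul lphi ldphi lf lg cf cg.
have ineq : lam * ((\int[mu]_x (f x * f x))%R - (\int[mu]_x (f x * 1))%R ^+ 2) <=
    - (\int[mu]_x (f x * g x))%R.
  have cl : lam * ((\int[mu]_x (phi k x * phi k x))%R - (\int[mu]_x (phi k x * 1))%R *
      (\int[mu]_x (phi k x * 1))%R) @[k --> \oo] --> lam * ((\int[mu]_x (f x * f x))%R -
      (\int[mu]_x (f x * 1))%R * (\int[mu]_x (f x * 1))%R).
    by apply: cvgMr; apply: cvgB => //; exact: cvgM.
  have cr : - (\int[mu]_x (phi k x * diffusion beta (phi k) x))%R @[k --> \oo] -->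
    - (\int[mu]_x (f x * g x))%R by exact: cvgN.
  rewrite expr2; apply: (ler_cvg_to cl cr).
  by near=> k; have := poinc _ (tphi k); rewrite expr2.
have V0' : (0 < 'V_mu[f])%E by rewrite lt0e V0 variance_ge0.
move: V0'; rewrite variance_Rintegral// lte_fin => V0'.
have -> : (\int[mu]_x (- f x * g x)%:E = (- (\int[mu]_x (f x * g x))%R)%:E)%E.
  have ifg := Lfun2_mul_integrable lf lg.
  have i' := integrableZl measurableT (- 1) ifg.
  rewrite -mulN1r -(RintegralZl (-1) measurableT ifg) /Rintegral fineK.
    by apply: eq_integral => x _; congr _%:E; ring.
  exact: (integrable_fin_num measurableT i').
by rewrite inver gt_eqF// lee_pdivlMr// -EFinM lee_fin.
Unshelve. all: by end_near. Qed.

Let core_bounds (phi : 'rV[R]_n -> R) : test_function phi -> exists2 K, forall x, `|phi x| <= K &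
  forall (i : 'I_n) (x : 'rV[R]_n), `|partial i phi x| <= K * omega x `^ (- 1).
Proof.
move=> tphi.
have [C0 phiC] := (test_function_rapid [::] tphi).2 0.
have dC i := cid ((test_function_rapid [:: i] tphi).2 1).
exists (`|C0| + \sum_(i < n) `|sval (dC i)|) => [x|i x].
  apply: (le_trans (phiC x)); rewrite oppr0 powRr0 mulr1.
  by apply: (le_trans (ler_norm _)); rewrite lerDl sumr_ge0.
apply: (le_trans (svalP (dC i) x)); rewrite ler_wpM2r ?powR_ge0//.
rewrite (bigD1 i)//= addrCA; apply: (le_trans (ler_norm _)).
by rewrite lerDl addr_ge0// sumr_ge0.
Qed.

Lemma spectral_gap_ge_low : beta <= n%:R / 2 + 2 ->
  (((beta - n%:R / 2) ^+ 2)%:E <= spectral_gap n beta)%E.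
Proof.
move=> b2; apply: spectral_gap_ge => [|phi tphi]; first exact: sqr_ge0.
have [K phiK dphiK] := core_bounds tphi.
have [c core] := core_inequality_low n2 (fun i => smooth_C1_line i [::] tphi.1)
  (smooth_measurable [::] tphi.1) (fun i => smooth_measurable [:: i] tphi.1)
  phiK dphiK nb b2.
exact: (poincare_of_core n2 nb tphi (sqr_ge0 _) core).
Qed.

Lemma spectral_gap_ge_high lam : n%:R / 2 + 2 <= beta -> 0 <= lam ->
  lam <= 4 * (beta - n%:R / 2 - 1) -> lam <= 2 * (beta - 1) ->
  (lam%:E <= spectral_gap n beta)%E.
Proof.
move=> b2 l0 l1 l2; apply: spectral_gap_ge => // phi tphi.
have [K phiK dphiK] := core_bounds tphi.
have [c core] := core_inequality_high n2 (fun i => smooth_C1_line i [::] tphi.1)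
  (smooth_measurable [::] tphi.1) (fun i => smooth_measurable [:: i] tphi.1)
  phiK dphiK nb b2 l0 l1 l2.
exact: (poincare_of_core n2 nb tphi l0 core).
Qed.

End spectral_gap_lower_bound.

(** * Functions flat at the origin *)

Section flat_function.
Context {R : realType}.
Implicit Types t : R.

(** The powers t^(-m) are carried along so that the span of the family is closed under
    differentiation: the derivative of [flat m] is [flat m.+2] - m [flat m.+1], including at 0,
    where the bound by a multiple of t^2 gives derivative 0. *)
Definition flat (m : nat) t := if 0 < t then t^-1 ^+ m * expR (- t^-1) else 0.

Lemma flat_ge0 m t : 0 <= flat m t.
Proof.
rewrite /flat; case: ifP => // t0.
by rewrite mulr_ge0 ?expR_ge0// exprn_ge0// invr_ge0 ltW.
Qed.

Lemma flat_le m t : flat m t <= m`!%:R.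
Proof.
rewrite /flat; case: ifP => // t0.
rewrite expRN ler_pdivrMr ?expR_gt0//.
by apply: exprn_le_expR; rewrite invr_ge0 ltW.
Qed.

Lemma flat_le_sqr m t : flat m t <= (m.+2)`!%:R * t ^+ 2.
Proof.
have := flat_le m.+2 t; rewrite /flat; case: ifP => t0; last by rewrite mulr_ge0// sqr_ge0.
move=> h; have t2 : 0 <= t ^+ 2 by exact: sqr_ge0.
have := ler_wpM2r t2 h; congr (_ <= _).
by rewrite !exprS; move: (_ ^+ m) (expR _) => u v; field; rewrite gt_eqF.
Qed.

Lemma der_quadratic (f : R -> R) C : (forall t, `|f t| <= C * t ^+ 2) ->
  is_derive (0 : R) (1 : R) f 0.
Proof.
move=> fC.
have f0 : f 0 = 0.
  by apply/eqP; rewrite -normr_eq0 eq_le normr_ge0 andbT (le_trans (fC 0))// expr0n mulr0.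
have key : h^-1 *: (f (h *: (1 : R) + 0) - f 0) @[h --> (0 : R)^'] --> (0 : R).
  apply/cvgrPdist_le => e e0; near=> h.
  have h0 : h != 0 by near: h; exact: nbhs_dnbhs_neq.
  rewrite f0 subr0 addr0 sub0r normrN [h *: 1]mulr1 normrM normfV.
  rewrite ler_pdivrMl ?normr_gt0//; apply: (le_trans (fC h)).
  rewrite -real_normK ?num_real// expr2 mulrCA ler_wpM2l//.
  apply: (@le_trans _ _ ((`|C| + 1) * `|h|)).
    by rewrite ler_wpM2r// (le_trans (ler_norm C))// lerDl.
  rewrite mulrC -ler_pdivlMr ?ltr_wpDl//.
  near: h; apply: dnbhs0_le; rewrite divr_gt0// ltr_wpDl//.
by apply: DeriveDef; [apply/cvg_ex; exists 0|exact: (cvg_lim _ key)].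
Unshelve. all: by end_near. Qed.

Lemma der_flat m t : is_derive t (1 : R) (flat m) (flat m.+2 t - m%:R * flat m.+1 t).
Proof.
have [t0|t0|->] := ltgtP t 0.
- have -> : flat m.+2 t - m%:R * flat m.+1 t = 0.
    by rewrite /flat ltNge (ltW t0)/= mulr0 subr0.
  apply: (@near_eq_is_derive _ _ _ (cst 0)).
  near=> s; rewrite /flat ifF//; apply/negbTE; rewrite -leNgt ltW//.
  by near: s; exact: lt_nbhsl.
- have fE : \near t, t^-1 ^+ m * expR (- t^-1) = flat m t.
    near=> s; rewrite /flat ifT//.
    by near: s; exact: lt_nbhsr.
  have hV := derV (lt0r_neq0 t0) (der_id t).
  have h1 := derX m hV.
  have h2 := @der_comp _ expR (fun s => - s^-1) t _ _ (is_derive_expR (- t^-1)) (derN hV).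
  have h := derM h1 h2.
  apply: (der_eq (near_eq_is_derive fE h)); rewrite /flat t0 /=.
  move: (expR _) => v; case: m {hV h1 h2 h fE} => [|m].
    by rewrite !mul0r subr0 expr0 !mul1r add0r exprS expr1; field; rewrite gt_eqF.
  by rewrite /= !exprS; move: (_ ^+ m) => u; field; rewrite gt_eqF.
- have -> : flat m.+2 0 - m%:R * flat m.+1 0 = 0 :> R.
    by rewrite /flat ltxx mulr0 subr0.
  apply: (@der_quadratic _ (m.+2)`!%:R) => s.
  by rewrite ger0_norm ?flat_ge0// flat_le_sqr.
Unshelve. all: by end_near. Qed.

Lemma continuous_flat m : continuous (flat m).
Proof. by move=> t; exact: (der_continuous (der_flat m t)). Qed.

End flat_function.

(** * Smooth cutoffs *)

Section cutoff.
Context {R : realType} (n : nat).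
Implicit Types f g : 'rV[R]_n -> R.
Notation e_ := (delta_mx ord0).

Lemma C1_line_partial (i : 'I_n) f df : C1_line i f df -> partial i f = df.
Proof.
move=> fP; apply/funext => x; have [[_ h] _] := fP x 0.
rewrite scale0r addr0 in h; rewrite -h /partial /derive.
have -> : (fun s : R => s^-1 *: (((fun s : R => f (x + s *: e_ i)) \o shift 0) (s *: 1) - f (x + 0 *: e_ i))) =
    (fun s : R => s^-1 *: ((f \o shift x) (s *: e_ i) - f x)).
  by apply/funext => s /=; rewrite addr0 scale0r addr0 [s *: 1]mulr1 [x + _]addrC.
by [].
Qed.

Lemma C1_line_flat m (k : R) i : C1_line i (fun x : 'rV[R]_n => flat m (1 - k * omega x))
  (fun x => (flat m.+2 (1 - k * omega x) - m%:R * flat m.+1 (1 - k * omega x)) * (0 - k * (2 * x ord0 i))).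
Proof.
have h := C1_lineB (C1_line_cst i 1) (C1_lineZ k (C1_line_omega i)).
apply: (@C1_line_comp _ _ i (flat m) (fun t => flat m.+2 t - m%:R * flat m.+1 t) _ _ (fun x => der_flat m _) _ h) => x.
apply: contB; first exact: continuous_flat.
by apply: contM; [exact: cont_cst|exact: continuous_flat].
Qed.

(** An algebra of differentiable functions closed under partial derivatives, so its members are
    smooth by induction. It contains the trial functions and the cutoffs. *)
Inductive smooth_gen : ('rV[R]_n -> R) -> Prop :=
| gen_cst c : smooth_gen (fun=> c)
| gen_coord i : smooth_gen (fun x => x ord0 i)
| gen_omega d : smooth_gen (fun x => omega x `^ d)
| gen_flat m k : smooth_gen (fun x => flat m (1 - k * omega x))
| gen_add f g : smooth_gen f -> smooth_gen g -> smooth_gen (fun x => f x + g x)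
| gen_mul f g : smooth_gen f -> smooth_gen g -> smooth_gen (fun x => f x * g x).

Lemma smooth_gen_C1 f : smooth_gen f -> forall i, exists2 df, smooth_gen df & C1_line i f df.
Proof.
elim => {f} [c i|j i|d i|m k i|f g _ IHf _ IHg i|f g fS IHf gS IHg i].
- by exists (fun=> 0); [exact: gen_cst|exact: C1_line_cst].
- by exists (fun=> (j == i)%:R); [exact: gen_cst|exact: C1_line_coord].
- exists (fun x : 'rV[R]_n => 2 * d * x ord0 i * omega x `^ (d - 1)); last exact: C1_line_omega_powR.
  apply: gen_mul; last exact: gen_omega.
  by apply: gen_mul; [exact: gen_cst|exact: gen_coord].
- exists (fun x : 'rV[R]_n => (flat m.+2 (1 - k * omega x) + (- m%:R) * flat m.+1 (1 - k * omega x)) *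
      ((- k * 2) * x ord0 i)).
    apply: gen_mul; last by apply: gen_mul; [exact: gen_cst|exact: gen_coord].
    apply: gen_add; first exact: gen_flat.
    by apply: gen_mul; [exact: gen_cst|exact: gen_flat].
  by apply: (C1_line_ext (C1_line_flat m k i)) => x; ring.
- have [df dfS fP] := IHf i; have [dg dgS gP] := IHg i.
  by exists (fun x => df x + dg x); [exact: gen_add|exact: C1_lineD].
- have [df dfS fP] := IHf i; have [dg dgS gP] := IHg i.
  exists (fun x => df x * g x + f x * dg x); last exact: C1_lineM.
  by apply: gen_add; exact: gen_mul.
Qed.

Lemma smooth_gen_differentiable f x : smooth_gen f -> differentiable f x.
Proof.
have comp (phi : R -> R) (h : 'rV[R]_n -> R) dphi : is_derive (h x) (1 : R) phi dphi ->
    differentiable h x -> differentiable (fun x => phi (h x)) x.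
  move=> [dp _] dh; apply: (@differentiable_comp _ _ _ _ h phi) => //.
  exact/derivable1_diffP.
elim => {f} [c|j|d|m k|f g _ IHf _ IHg|f g fS IHf gS IHg].
- exact: differentiable_cst.
- exact: differentiable_coord.
- exact: (comp (fun y => y `^ d) _ _ (is_derive1_powR d (omega_gt0 x)) (differentiable_omega x)).
- have d1 : differentiable (cst 1 - cst k * @omega R n) x.
    apply: differentiableB; first exact: differentiable_cst.
    by apply: differentiableM; [exact: differentiable_cst|exact: differentiable_omega].
  exact: (comp (flat m) (cst 1 - cst k * @omega R n) _ (der_flat m _) d1).
- exact: differentiableD.
- exact: differentiableM.
Qed.

Lemma smooth_gen_smooth f : smooth_gen f -> smooth f.
Proof.
move=> fS s; suff h : smooth_gen (foldr partial f s).
  by move=> x; exact: smooth_gen_differentiable.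
elim: s => [//|i s IH] /=.
by have [df dfS /C1_line_partial ->] := smooth_gen_C1 IH i.
Qed.

(* Equal to [1] in the limit [k -> oo], and supported in the ball [omega <= k + 1]. *)
Definition cutoff (k : nat) (x : 'rV[R]_n) := expR 1 * flat 0 (1 - k.+1%:R^-1 * omega x).

Lemma cutoff_smooth_gen k : smooth_gen (cutoff k).
Proof. by apply: gen_mul; [exact: gen_cst|exact: gen_flat]. Qed.

Lemma cutoff_eq0 k x : k.+1%:R <= omega x -> cutoff k x = 0.
Proof.
move=> kx; rewrite /cutoff /flat ifF ?mulr0//; apply/negbTE.
by rewrite -leNgt subr_le0 ler_pdivlMl ?mulr1.
Qed.

Lemma compact_omega_le (A : R) : compact [set x : 'rV[R]_n | omega x <= A].
Proof.
have cs : compact [set v : 'rV[R]_n | forall i, `[- A, A]%classic (v ord0 i)].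
  apply: (@rV_compact R n (fun=> `[- A, A]%classic)) => i; exact: segment_compact.
apply: (subclosed_compact _ cs).
  have -> : [set x : 'rV[R]_n | omega x <= A] = @omega R n @^-1` [set y | y <= A] by [].
  apply: closed_comp; last exact: closed_le.
  by move=> x _; exact: differentiable_continuous (differentiable_omega x).
move=> x /= xA i; rewrite in_itv/= -ler_norml.
exact: le_trans (norm_coord_le_omega x i) xA.
Qed.

Lemma cutoff_test_function f k : smooth_gen f -> test_function (fun x => f x * cutoff k x).
Proof.
move=> fS; split.
  by apply: smooth_gen_smooth; apply: gen_mul => //; exact: cutoff_smooth_gen.
have cK := @compact_omega_le k.+1%:R.
apply: (subclosed_compact _ cK); first exact: closed_closure.
have cl : closed [set x : 'rV[R]_n | omega x <= k.+1%:R].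
  have -> : [set x : 'rV[R]_n | omega x <= k.+1%:R] = @omega R n @^-1` [set y | y <= k.+1%:R] by [].
  apply: closed_comp; last exact: closed_le.
  by move=> x _; exact: differentiable_continuous (differentiable_omega x).
rewrite [X in _ `<=` X]((closure_id _).1 cl).
apply: closure_subset => x /=; apply: contraNT; rewrite -ltNge => kx.
by rewrite cutoff_eq0 ?mulr0// ltW.
Qed.

Definition dcutoff (k : nat) i (x : 'rV[R]_n) :=
  expR 1 * flat 2 (1 - k.+1%:R^-1 * omega x) * (- (2 * x ord0 i) / k.+1%:R).

Lemma C1_line_cutoff k i : C1_line i (cutoff k) (dcutoff k i).
Proof.
by apply: (C1_line_ext (C1_lineZ (expR 1) (C1_line_flat 0 k.+1%:R^-1 i))) => x; rewrite /dcutoff; ring.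
Qed.

Lemma cutoff_ge0 k x : 0 <= cutoff k x.
Proof. by rewrite mulr_ge0 ?expR_ge0 ?flat_ge0. Qed.

Lemma cutoff_le k x : cutoff k x <= expR 1.
Proof. by rewrite ler_piMr ?expR_ge0// (le_trans (flat_le 0 _)). Qed.

(** Where the derivative is nonzero both omega/(k+1) and x_i^2/(k+1) are below 1, so omega times the
    square is bounded uniformly in k. This is the decay at which F times the gradient of the cutoff
    is dominated like dF. *)
Lemma dcutoff_sqr_le k i x : dcutoff k i x ^+ 2 <= (4 * expR 1) ^+ 2 * omega x `^ (- 1).
Proof.
have ox := omega_gt0 x.
rewrite powRN powRr1 ?(ltW ox)// ler_pdivlMr//.
have [kx|kx] := leP k.+1%:R (omega x).
  rewrite /dcutoff /flat ifF.
    by rewrite mulr0 mul0r expr0n mul0r sqr_ge0.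
  by apply/negbTE; rewrite -leNgt subr_le0 ler_pdivlMl ?mulr1.
have k0 : 0 < k.+1%:R :> R by [].
pose y := flat 2 (1 - k.+1%:R^-1 * omega x).
have y0 : 0 <= y := flat_ge0 _ _.
have y2 : y <= 2 := flat_le _ _.
have -> : dcutoff k i x ^+ 2 * omega x =
    (expR 1 * 2) ^+ 2 * (y ^+ 2 * ((x ord0 i ^+ 2 / k.+1%:R) * (omega x / k.+1%:R))).
  by rewrite /dcutoff -/y; field; rewrite gt_eqF.
have -> : (4 * expR 1) ^+ 2 = (expR 1 * 2) ^+ 2 * (2 ^+ 2 * (1 * 1)) :> R by ring.
have x1 : x ord0 i ^+ 2 <= omega x by apply: le_trans (coord_le_omega x i); rewrite lerDl.
rewrite ler_wpM2l ?sqr_ge0//; apply: ler_pM; rewrite ?sqr_ge0//.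
- by rewrite mulr_ge0 ?divr_ge0 ?sqr_ge0 ?(ltW ox).
- by rewrite lerXn2r// nnegrE.
- apply: ler_pM; rewrite ?divr_ge0 ?sqr_ge0 ?(ltW ox)//.
    by rewrite ler_pdivrMr// mul1r (le_trans x1)// ltW.
  by rewrite ler_pdivrMr// mul1r ltW.
Qed.

Lemma cutoff_cvg x : cutoff k x @[k --> \oo] --> (1 : R).
Proof.
have c1 : 1 - k.+1%:R^-1 * omega x @[k --> \oo] --> (1 : R).
  rewrite [X in _ --> X](_ : _ = 1 - 0 * omega x); last by rewrite mul0r subr0.
  by apply: cvgB; [exact: cvg_cst|apply: cvgMl; exact: cvg_harmonic].
have -> : (1 : R) = expR 1 * flat 0 1.
  by rewrite /flat ltr01 expr0 mul1r invr1 expRN divff// gt_eqF// expR_gt0.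
apply: cvgMr; apply: (continuous_cvg _ _ c1); exact: continuous_flat.
Qed.

Lemma dcutoff_cvg i x : dcutoff k i x @[k --> \oo] --> (0 : R).
Proof.
have c1 : 1 - k.+1%:R^-1 * omega x @[k --> \oo] --> (1 : R).
  rewrite [X in _ --> X](_ : _ = 1 - 0 * omega x); last by rewrite mul0r subr0.
  by apply: cvgB; [exact: cvg_cst|apply: cvgMl; exact: cvg_harmonic].
rewrite [X in _ --> X](_ : _ = expR 1 * flat 2 1 * (- (2 * x ord0 i) * 0)); last by rewrite !mulr0.
apply: cvgM; last by apply: cvgMr; exact: cvg_harmonic.
apply: cvgMr; apply: (continuous_cvg _ _ c1); exact: continuous_flat.
Qed.

End cutoff.

(** * Rayleigh quotients of trial functions and their truncations *)

Lemma le_ratio_lim {R : realType} (g : \bar R) (Ak Bk Ek : nat -> R) (A B E J : R) :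
  Ak k @[k --> \oo] --> A -> Bk k @[k --> \oo] --> B -> Ek k @[k --> \oo] --> E ->
  (forall k, 0 < Ak k - Bk k ^+ 2 / J -> (g <= (Ek k / (Ak k - Bk k ^+ 2 / J))%:E)%E) ->
  0 < A - B ^+ 2 / J -> (g <= (E / (A - B ^+ 2 / J))%:E)%E.
Proof.
move=> cA cB cE gk d0.
have cd : Ak k - Bk k ^+ 2 / J @[k --> \oo] --> A - B ^+ 2 / J.
  by apply: cvgB => //; apply: cvgMl; rewrite expr2; exact: cvgM.
have cq : Ek k / (Ak k - Bk k ^+ 2 / J) @[k --> \oo] --> E / (A - B ^+ 2 / J).
  by apply: cvgM => //; apply: cvgV => //; rewrite gt_eqF.
apply/lee_addgt0Pr => e e0.
have h1 : \forall k \near \oo, 0 < Ak k - Bk k ^+ 2 / J by exact: (cvgr_gt _ cd).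
have h2 : \forall k \near \oo, Ek k / (Ak k - Bk k ^+ 2 / J) <= E / (A - B ^+ 2 / J) + e.
  by apply: (cvgr_le _ cq); rewrite ltrDl.
have [k _ kP] := filterI h1 h2.
have [dk qk] := kP k (leqnn k).
by apply: (le_trans (gk k dk)); rewrite -EFinD lee_fin.
Qed.

Section trial_functions.
Context {R : realType} (n : nat) (beta : R).
Notation Leb := (@lebesgue_rV R n).
Notation mu := (@Defs.cauchy R n beta).
Notation I F := (\int[Leb]_x (F x))%R.
Notation J := (I (fun x => omega x `^ (- beta))).
Hypotheses (n2 : (2 <= n)%N) (nb : n%:R / 2 < beta).
Let J0 : 0 < J := Rintegral_omega_powR_gt0 n2 nb.

(** A test function lies in the domain as the limit of the constant sequence, so its own Rayleigh
    quotient is a competitor; the common factor 1/J cancels. *)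
Lemma spectral_gap_le phi : test_function phi ->
  let A := I (fun x => phi x * phi x * omega x `^ (- beta)) in
  let B := I (fun x => phi x * 1 * omega x `^ (- beta)) in
  let E := I (fun x => (\sum_(i < n) partial i phi x ^+ 2) * omega x `^ (1 - beta)) in
  0 < A - B ^+ 2 / J -> (spectral_gap n beta <= (E / (A - B ^+ 2 / J))%:E)%E.
Proof.
move=> tphi A B E d0.
have rphi : rapid phi := test_function_rapid [::] tphi.
have rd := diffusion_rapid beta tphi.
have rpp : rapid (fun x => phi x * phi x) by exact: rapidM (rapid_pgrowth rphi).
have rp1 : rapid (fun x => phi x * 1) by apply: rapidM => //; exact: pgrowth_cst.
have rpd : rapid (fun x => phi x * diffusion beta phi x) by exact: rapidM (rapid_pgrowth rd).
have lphi := rapid_Lfun2 n2 nb rphi; have ld := rapid_Lfun2 n2 nb rd.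
have VE : 'V_mu[phi] = (J^-1 * (A - B ^+ 2 / J))%:E.
  rewrite variance_Rintegral// !rapid_cauchy_Rintegral//; congr _%:E.
  by rewrite -/A -/B; field; rewrite gt_eqF.
have V0 : 0 < J^-1 * (A - B ^+ 2 / J) by rewrite mulr_gt0// invr_gt0.
have cN (f : 'rV[R]_n -> R) : ('N[mu]_2%:E[EFin \o (f \- f)%R] @[k --> \oo] --> 0)%E.
  have -> : EFin \o (f \- f)%R = cst 0%E :> ('rV[R]_n -> \bar R).
    by apply/funext => x /=; rewrite subrr.
  by rewrite Lnorm0 ?eqe ?pnatr_eq0//; exact: cvg_cst.
apply: ge_ereal_inf; exists ((\int[mu]_x (- phi x * diffusion beta phi x)%:E) / 'V_mu[phi])%E.
  exists phi, (diffusion beta phi); split=> //.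
    by split=> //; exists (fun=> phi); split=> //; exact: cN.
  by rewrite VE eqe gt_eqF.
have -> : (\int[mu]_x (- phi x * diffusion beta phi x)%:E = (J^-1 * E)%:E)%E.
  have ifg := Lfun2_mul_integrable lphi ld.
  have i' := integrableZl measurableT (- 1) ifg.
  have -> : J^-1 * E = - (\int[mu]_x (phi x * diffusion beta phi x))%R.
    by rewrite (rapid_cauchy_Rintegral n2 nb rpd) (dirichlet_form beta n2 tphi) mulrN opprK.
  rewrite -mulN1r -(RintegralZl (-1) measurableT ifg) /Rintegral fineK.
    by apply: eq_integral => x _; congr _%:E; ring.
  exact: (integrable_fin_num measurableT i').
rewrite VE inver gt_eqF// -EFinM lee_fin le_eqVlt; apply/orP; left; apply/eqP.
by move: d0; move: (A - _) => d d0; field; rewrite !gt_eqF.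
Qed.

Lemma cvg_Rintegral_decay (f_ : nat -> 'rV[R]_n -> R) (f : 'rV[R]_n -> R) (K b : R) : n%:R / 2 < b ->
  (forall k, measurable_fun setT (f_ k)) -> measurable_fun setT f ->
  (forall x, f_ k x @[k --> \oo] --> f x) ->
  (forall k x, `|f_ k x| <= K * omega x `^ (- b)) -> I (f_ k) @[k --> \oo] --> I f.
Proof.
move=> b0 mf_ mf cf fK.
have ig := integrableZl measurableT K (integrable_omega_powR n2 b0).
have mfE_ k : measurable_fun setT (EFin \o f_ k) by exact/measurable_EFinP.
have mfE : measurable_fun setT (EFin \o f) by exact/measurable_EFinP.
have cfE : {ae Leb, forall x, setT x -> (EFin \o f_ k) x @[k --> \oo] --> (EFin \o f) x}.
  by apply: aeW => x _ /=; apply: cvg_EFin; [near do by []|exact: cf].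
have fKE : {ae Leb, forall x, forall k, setT x -> (`|(EFin \o f_ k) x| <= K%:E * (omega x `^ (- b))%:E)%E}.
  by apply: aeW => x k _; rewrite -EFinM abse_EFin lee_fin.
have [fi _ c] := dominated_convergence measurableT mfE_ mfE cfE ig fKE.
apply: fine_cvg; rewrite fineK; first exact: c.
exact: (integrable_fin_num measurableT fi).
Unshelve. all: by end_near. Qed.

Variables (F : 'rV[R]_n -> R) (dF : 'I_n -> 'rV[R]_n -> R) (C r : R).
Hypotheses (FS : smooth_gen F) (FP : forall i, C1_line i F (dF i)).
Hypotheses (mdF : forall i, measurable_fun setT (dF i)) (r0 : 0 <= r) (ra : r < beta - n%:R / 2).
Hypotheses (FC : forall x, F x ^+ 2 <= C * omega x `^ r)
  (dFC : forall i x, dF i x ^+ 2 <= C * omega x `^ (r - 1)).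

Let mF : measurable_fun setT F.
Proof.
by apply: continuous_measurable_rV => x; apply: differentiable_continuous; exact: smooth_gen_differentiable.
Qed.

Let mcut k : measurable_fun setT (@cutoff R n k).
Proof.
apply: continuous_measurable_rV => x; apply: differentiable_continuous.
by apply: smooth_gen_differentiable; exact: cutoff_smooth_gen.
Qed.

Let phi k x := F x * cutoff k x.
Let dphi k i x := dF i x * cutoff k x + F x * dcutoff k i x.

Let tphi k : test_function (phi k). Proof. exact: cutoff_test_function. Qed.

Let dphiE k i : partial i (phi k) = dphi k i.
Proof. by apply: C1_line_partial; exact: C1_lineM (C1_line_cutoff k i). Qed.

Let phi_cvg x : phi k x @[k --> \oo] --> F x.
Proof. by rewrite -[X in _ --> X]mulr1; apply: cvgMr; exact: cutoff_cvg. Qed.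

Let dphi_cvg i x : dphi k i x @[k --> \oo] --> dF i x.
Proof.
rewrite [X in _ --> X](_ : _ = dF i x * 1 + F x * 0); last by ring.
by apply: cvgD; apply: cvgMr; [exact: cutoff_cvg|exact: dcutoff_cvg].
Qed.

Let rb : n%:R / 2 < beta - r. Proof. by move: ra; lra. Qed.

Let phi2_le k x : phi k x ^+ 2 <= C * expR 1 ^+ 2 * omega x `^ r.
Proof.
rewrite /phi exprMn [leRHS]mulrAC; apply: ler_pM; rewrite ?sqr_ge0 ?FC//.
by rewrite lerXn2r ?nnegrE ?expR_ge0 ?cutoff_ge0 ?cutoff_le.
Qed.

Let omega_split (x : 'rV[R]_n) : omega x `^ (- (beta - r)) = omega x `^ r * omega x `^ (- beta).
Proof. by rewrite (powR_mul _ _ (omega_gt0 x)) opprB. Qed.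

Let cvg_A : I (fun x => phi k x * phi k x * omega x `^ (- beta)) @[k --> \oo] -->
  I (fun x => F x * F x * omega x `^ (- beta)).
Proof.
apply: (cvg_Rintegral_decay (K := C * expR 1 ^+ 2) rb).
- move=> k; apply: measurable_funM; last exact: measurable_omega_powR.
  by apply: measurable_funM; apply: measurable_funM.
- apply: measurable_funM; last exact: measurable_omega_powR.
  exact: measurable_funM.
- move=> x; apply: cvgMl; apply: cvgM; exact: phi_cvg.
- move=> k x; rewrite -expr2 (ger0_norm (mulr_ge0 (sqr_ge0 _) (powR_ge0 _ _))).
  by rewrite omega_split mulrA ler_wpM2r ?powR_ge0.
Qed.

Let cvg_B : I (fun x => phi k x * 1 * omega x `^ (- beta)) @[k --> \oo] -->
  I (fun x => F x * 1 * omega x `^ (- beta)).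
Proof.
apply: (cvg_Rintegral_decay (K := 1 + C * expR 1 ^+ 2) rb).
- move=> k; apply: measurable_funM; last exact: measurable_omega_powR.
  by apply: measurable_funM => //; apply: measurable_funM.
- apply: measurable_funM; last exact: measurable_omega_powR.
  exact: measurable_funM.
- move=> x; apply: cvgMl; apply: cvgMl; exact: phi_cvg.
- move=> k x; rewrite mulr1 normrM (ger0_norm (powR_ge0 _ _)).
  rewrite omega_split mulrA ler_wpM2r ?powR_ge0//.
  have o1 : 1 <= omega x `^ r.
    by rewrite -[leLHS](powRr0 (omega x)) ler_powR// omega_ge1.
  apply: (@le_trans _ _ (1 + phi k x ^+ 2)).
    rewrite -[phi k x ^+ 2]real_normK ?num_real//.
    by move: (`|phi k x|) => y; have := sqr_ge0 (y - 1); rewrite !expr2; nra.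
  by rewrite mulrDl mul1r lerD.
Qed.

Let cvg_E : I (fun x => (\sum_(i < n) partial i (phi k) x ^+ 2) * omega x `^ (1 - beta)) @[k --> \oo] -->
  I (fun x => (\sum_(i < n) dF i x ^+ 2) * omega x `^ (1 - beta)).
Proof.
(* 34 = 2 (1 + 16): (u + v)^2 <= 2 u^2 + 2 v^2, where u is bounded with constant C e^2 and v, from
   the gradient of the cutoff, with 16 C e^2. *)
apply: (cvg_Rintegral_decay (K := n%:R * (34 * (C * expR 1 ^+ 2))) rb).
- move=> k; apply: measurable_funM; last exact: measurable_omega_powR.
  apply: measurable_sum => i; apply: measurable_funX.
  exact: (smooth_measurable [:: i] (tphi k).1).
- apply: measurable_funM; last exact: measurable_omega_powR.
  by apply: measurable_sum => i; apply: measurable_funX.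
- move=> x; apply: cvgMl; apply: cvg_big => [|i _]; first exact: add_continuous.
  have -> : (fun k => partial i (phi k) x ^+ 2) = (fun k => dphi k i x * dphi k i x).
    by apply/funext => k; rewrite dphiE expr2.
  rewrite expr2; apply: cvgM; exact: dphi_cvg.
- move=> k x; rewrite ger0_norm; last first.
    by rewrite mulr_ge0 ?powR_ge0// sumr_ge0// => i _; exact: sqr_ge0.
  have -> : omega x `^ (- (beta - r)) = omega x `^ (r - 1) * omega x `^ (1 - beta).
    by rewrite (powR_mul _ _ (omega_gt0 x)); congr (_ `^ _); ring.
  rewrite mulrA ler_wpM2r ?powR_ge0//.
  rewrite -mulrA [leRHS]mulr_natl -[X in _ *+ X](card_ord n) -sumr_const.
  apply: ler_sum => i _; rewrite dphiE /dphi.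
  have h1 : (dF i x * cutoff k x) ^+ 2 <= C * expR 1 ^+ 2 * omega x `^ (r - 1).
    rewrite exprMn [leRHS]mulrAC; apply: ler_pM; rewrite ?sqr_ge0 ?dFC//.
    by rewrite lerXn2r ?nnegrE ?expR_ge0 ?cutoff_ge0 ?cutoff_le.
  have h2 : (F x * dcutoff k i x) ^+ 2 <= C * expR 1 ^+ 2 * 16 * omega x `^ (r - 1).
    rewrite exprMn -(powR_mul _ _ (omega_gt0 x)).
    rewrite [leRHS](_ : _ = (C * omega x `^ r) * ((4 * expR 1) ^+ 2 * omega x `^ (- 1))); last by ring.
    by apply: ler_pM; rewrite ?sqr_ge0 ?FC ?dcutoff_sqr_le.
  move: h1 h2; move: (dF i x * _) (F x * _) (omega x `^ _) (C * _) => a b o c h1 h2.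
  have : 0 <= (a - b) ^+ 2 by exact: sqr_ge0.
  by rewrite -mulrA; nra.
Qed.

(** Truncate by the cutoffs and let k grow. With F^2 = O(omega^r), |dF|^2 = O(omega^(r-1)) and r <
    beta - n/2, all integrands are dominated by a multiple of omega^(-(beta - r)), which is
    integrable. *)
Lemma spectral_gap_le_trial :
  let A := I (fun x => F x * F x * omega x `^ (- beta)) in
  let B := I (fun x => F x * 1 * omega x `^ (- beta)) in
  let E := I (fun x => (\sum_(i < n) dF i x ^+ 2) * omega x `^ (1 - beta)) in
  0 < A - B ^+ 2 / J -> (spectral_gap n beta <= (E / (A - B ^+ 2 / J))%:E)%E.
Proof.
exact: (le_ratio_lim cvg_A cvg_B cvg_E (fun k => spectral_gap_le (tphi k))).
Qed.

End trial_functions.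

(** * Upper bounds on the spectral gap *)

Section spectral_gap_upper_bound.
Context {R : realType} (n : nat) (beta : R).
Notation Leb := (@lebesgue_rV R n).
Notation I F := (\int[Leb]_x (F x))%R.
Notation M b := (I (fun x => omega x `^ (- b))).
Hypotheses (n2 : (2 <= n)%N) (nb : n%:R / 2 < beta).
Let n2R : 2 <= n%:R :> R. Proof. by rewrite ler_nat. Qed.

(** Both integrals are explicit ratios of Gamma values, and the functional equation is applied to b
    and to b - n/2. *)
Lemma omega_powR_recurrence b : n%:R / 2 < b -> M (b + 1) = (b - n%:R / 2) / b * M b.
Proof.
move=> b0; have bp : 0 < b by move: (n2R) b0; lra.
have b1 : 1 <= b by move: (n2R) b0; lra.
have b1' : 1 <= b + 1 by rewrite lerDr ltW.
have b0' : n%:R / 2 < b + 1 by rewrite (lt_trans b0)// ltrDl.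
rewrite /Rintegral !integral_omega_powR//=.
rewrite /mix_cst GamS// (_ : b + 1 - n%:R / 2 = b - n%:R / 2 + 1); last by ring.
rewrite GamS ?subr_gt0//.
have g1 : 0 < Gam (b - n%:R / 2) by apply: Gam_gt0; rewrite subr_gt0.
have g2 := Gam_gt0 bp.
have p0 : 0 < Num.sqrt pi ^+ n :> R by rewrite exprn_gt0// sqrtr_gt0 pi_gt0.
by move: (Gam _) (Gam b) (_ ^+ n) g1 g2 p0 => u v w u0 v0 w0; field; rewrite !gt_eqF.
Qed.

Let omega_mul b (x : 'rV[R]_n) : omega x `^ (b + 1) = omega x * omega x `^ b.
Proof.
by rewrite -[X in X * _](powRr1 (ltW (omega_gt0 x))) (powR_mul _ _ (omega_gt0 x)) addrC.
Qed.

(** The trial function is one coordinate. Its mean is zero since x_i omega^(-beta) is proportional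
    to a derivative of omega^(1 - beta). Integrating the derivative of omega^(1 - beta) x_i shows
    that its energy is 2(beta - 1) times its second moment. *)
Lemma spectral_gap_le_coord : n%:R + 1 <= beta ->
  (spectral_gap n beta <= (2 * (beta - 1))%:E)%E.
Proof.
move=> b1.
have n0 : (0 < n)%N by move: n2; case: (n).
pose i0 : 'I_n := Ordinal n0.
have x2 (x : 'rV[R]_n) : x ord0 i0 ^+ 2 <= omega x.
  by apply: le_trans (coord_le_omega x i0); rewrite lerDl.
have nb1 : n%:R / 2 < beta - 1 by move: (n2R) b1; lra.
have b2 : 0 < beta - 2 by move: (n2R) b1; lra.
have i1 := integrable_omega_powR n2 nb1.
have xK (x : 'rV[R]_n) : `|x ord0 i0| <= omega x := norm_coord_le_omega x i0.
have decM b (x : 'rV[R]_n) : omega x * omega x `^ (- b) = omega x `^ (- (b - 1)).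
  by rewrite -omega_mul; congr (_ `^ _); ring.
have ix2 : Leb.-integrable setT (fun x : 'rV[R]_n => (x ord0 i0 * x ord0 i0 * omega x `^ (- beta))%:E).
  apply: (integrable_decay (K := 1) n2 nb1).
    apply: measurable_funM; last exact: measurable_omega_powR.
    by apply: measurable_funM; exact: measurable_coord.
  move=> x; rewrite -expr2 (ger0_norm (mulr_ge0 (sqr_ge0 _) (powR_ge0 _ _))) mul1r -decM.
  by rewrite ler_wpM2r ?powR_ge0.
have ix1 : Leb.-integrable setT (fun x : 'rV[R]_n => (x ord0 i0 * 1 * omega x `^ (- beta))%:E).
  apply: (integrable_decay (K := 1) n2 nb1).
    apply: measurable_funM; last exact: measurable_omega_powR.
    by apply: measurable_funM => //; exact: measurable_coord.
  move=> x; rewrite mulr1 normrM (ger0_norm (powR_ge0 _ _)) mul1r -decM.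
  by rewrite ler_wpM2r ?powR_ge0.
have hB : I (fun x : 'rV[R]_n => x ord0 i0 * 1 * omega x `^ (- beta)) = 0.
  have i' := integrableZl measurableT (2 * (1 - beta)) ix1.
  have := @integral_line0 R n i0 (fun x : 'rV[R]_n => omega x `^ (1 - beta))
     (fun x : 'rV[R]_n => 2 * (1 - beta) * (x ord0 i0 * 1 * omega x `^ (- beta))).
  have c1 : C1_line i0 (fun x : 'rV[R]_n => omega x `^ (1 - beta)) (fun x : 'rV[R]_n => 2 * (1 - beta) * (x ord0 i0 * 1 * omega x `^ (- beta))).
    apply: (C1_line_ext (C1_line_omega_powR i0 (1 - beta))) => x.
    by rewrite (_ : 1 - beta - 1 = - beta); ring.
  have v1 : vanish_line i0 (fun x : 'rV[R]_n => omega x `^ (1 - beta)).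
    apply: (@vanish_line_decay _ _ _ _ 1 (beta - 1)); first by move: b2; lra.
    by move=> x; rewrite mul1r opprB ger0_norm ?powR_ge0.
  move=> /(_ c1 v1 i') h.
  have h2 : 2 * (1 - beta) * I (fun x : 'rV[R]_n => x ord0 i0 * 1 * omega x `^ (- beta)) = 0.
    by rewrite -(RintegralZl _ measurableT ix1) /Rintegral h.
  move/eqP: h2; rewrite mulf_eq0 => /orP[/eqP|/eqP//].
  by move: b2; lra.
have hA : M (beta - 1) = 2 * (beta - 1) * I (fun x : 'rV[R]_n => x ord0 i0 * x ord0 i0 * omega x `^ (- beta)).
  have i' := integrableZl measurableT (2 * (1 - beta)) ix2.
  have iD := integrableD measurableT i1 i'.
  have c1 : C1_line i0 (fun x : 'rV[R]_n => omega x `^ (1 - beta) * x ord0 i0)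
      (fun x : 'rV[R]_n => omega x `^ (- (beta - 1)) + 2 * (1 - beta) * (x ord0 i0 * x ord0 i0 * omega x `^ (- beta))).
    apply: (C1_line_ext (C1_lineM (C1_line_omega_powR i0 (1 - beta)) (C1_line_coord i0 i0))) => x.
    by rewrite eqxx mulr1n (_ : 1 - beta - 1 = - beta) ?opprB; ring.
  have v1 : vanish_line i0 (fun x : 'rV[R]_n => omega x `^ (1 - beta) * x ord0 i0).
    apply: (@vanish_line_decay _ _ _ _ 1 (beta - 2)) => // x.
    rewrite mul1r normrM (ger0_norm (powR_ge0 _ _)) mulrC.
    rewrite (_ : - (beta - 2) = 1 - beta + 1) ?omega_mul; last by ring.
    by rewrite ler_wpM2r ?powR_ge0.
  have h := @integral_line0 R n i0 _ _ c1 v1 iD.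
  have h2 : M (beta - 1) + 2 * (1 - beta) * I (fun x : 'rV[R]_n => x ord0 i0 * x ord0 i0 * omega x `^ (- beta)) = 0.
    by rewrite -(RintegralZl _ measurableT ix2) -(RintegralD measurableT i1 i') /Rintegral h.
  by move: h2; lra.
have m0 := Rintegral_omega_powR_gt0 n2 nb1.
have ra : 1 < beta - n%:R / 2 by move: nb1; lra.
have FC (x : 'rV[R]_n) : x ord0 i0 ^+ 2 <= 1 * omega x `^ 1.
  by rewrite mul1r powRr1 ?(ltW (omega_gt0 x)).
have dFC i (x : 'rV[R]_n) : ((i0 == i)%:R : R) ^+ 2 <= 1 * omega x `^ (1 - 1).
  rewrite mul1r subrr powRr0; case: (_ == _); first by rewrite expr1n.
  by rewrite expr0n.
have := spectral_gap_le_trial n2 nb (gen_coord i0) (fun i => C1_line_coord i i0)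
  (fun i => measurable_cst _) ler01 ra FC dFC.
lazy zeta; rewrite hB expr0n mul0r subr0.
have S1 : \sum_(i < n) ((i0 == i)%:R : R) ^+ 2 = 1.
  rewrite (bigD1 i0)// big1 => [|i /andP[_]]; first by rewrite /= addr0 ?eqxx expr1n.
  by rewrite eq_sym => /negPf ->; rewrite expr0n.
have -> : I (fun x : 'rV[R]_n => (\sum_(i < n) ((i0 == i)%:R : R) ^+ 2) * omega x `^ (1 - beta)) = M (beta - 1).
  by apply: eq_Rintegral => x _; rewrite S1 mul1r opprB.
rewrite hA in m0 *; set v := (\int[_]_x (_ * _ * _))%R in m0 *.
have v0 : 0 < v by move: m0; rewrite pmulr_rgt0//; move: b2; lra.
by move=> /(_ v0); rewrite mulfK// gt_eqF.
Qed.

(* Common part of the radial trial functions [omega `^ g]. *)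
Lemma spectral_gap_le_omega g (d := beta - n%:R / 2 - 2 * g) : 0 < g -> 0 < d ->
  0 < M (beta - 2 * g) - M (beta - g) ^+ 2 / M beta ->
  (spectral_gap n beta <= (4 * g ^+ 2 * (M (beta - 2 * g) - M (beta - 2 * g + 1)) /
    (M (beta - 2 * g) - M (beta - g) ^+ 2 / M beta))%:E)%E.
Proof.
move=> g0 d0 V0.
have r0 : 0 <= 2 * g by rewrite mulr_ge0// ltW.
have ra : 2 * g < beta - n%:R / 2 by move: d0; rewrite /d; lra.
have x2 i (x : 'rV[R]_n) : x ord0 i ^+ 2 <= omega x.
  by apply: le_trans (coord_le_omega x i); rewrite lerDl.
have sq b (x : 'rV[R]_n) : omega x `^ b * omega x `^ b = omega x `^ (2 * b).
  by rewrite (powR_mul _ _ (omega_gt0 x)); congr (_ `^ _); ring.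
have FC (x : 'rV[R]_n) : (omega x `^ g) ^+ 2 <= (1 + 4 * g ^+ 2) * omega x `^ (2 * g).
  by rewrite expr2 sq ler_peMl ?powR_ge0// lerDl mulr_ge0// sqr_ge0.
have dsq i (x : 'rV[R]_n) : (2 * g * x ord0 i * omega x `^ (g - 1)) ^+ 2 =
    4 * g ^+ 2 * omega x `^ (2 * (g - 1)) * x ord0 i ^+ 2.
  by rewrite -sq; ring.
have dFC i (x : 'rV[R]_n) : (2 * g * x ord0 i * omega x `^ (g - 1)) ^+ 2 <=
    (1 + 4 * g ^+ 2) * omega x `^ (2 * g - 1).
  rewrite dsq (_ : 2 * g - 1 = 2 * (g - 1) + 1); last by ring.
  rewrite omega_mul [X in _ <= _ * X]mulrC [leRHS]mulrA; apply: ler_pM; rewrite ?sqr_ge0//.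
    by rewrite mulr_ge0 ?powR_ge0// mulr_ge0// sqr_ge0.
  by rewrite ler_wpM2r ?powR_ge0// lerDr.
have mdF i : measurable_fun setT (fun x : 'rV[R]_n => 2 * g * x ord0 i * omega x `^ (g - 1)).
  apply: measurable_funM; last exact: measurable_omega_powR.
  by apply: measurable_funM => //; exact: measurable_coord.
have := spectral_gap_le_trial n2 nb (gen_omega n g) (fun i => C1_line_omega_powR i g)
  mdF r0 ra FC dFC.
lazy zeta.
have -> : I (fun x : 'rV[R]_n => omega x `^ g * omega x `^ g * omega x `^ (- beta)) = M (beta - 2 * g).
  apply: eq_Rintegral => x _; rewrite sq (powR_mul _ _ (omega_gt0 x)).
  by congr (_ `^ _); ring.
have -> : I (fun x : 'rV[R]_n => omega x `^ g * 1 * omega x `^ (- beta)) = M (beta - g).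
  apply: eq_Rintegral => x _; rewrite mulr1 (powR_mul _ _ (omega_gt0 x)).
  by congr (_ `^ _); ring.
move=> /(_ V0).
have n1 : n%:R / 2 < beta - 2 * g by move: ra; lra.
have n1' : n%:R / 2 < beta - 2 * g + 1 by move: ra; lra.
have i1 := integrable_omega_powR n2 n1; have i2 := integrable_omega_powR n2 n1'.
have -> : I (fun x : 'rV[R]_n => (\sum_(i < n) (2 * g * x ord0 i * omega x `^ (g - 1)) ^+ 2) * omega x `^ (1 - beta)) =
    4 * g ^+ 2 * (M (beta - 2 * g) - M (beta - 2 * g + 1)).
  rewrite -(RintegralB measurableT i1 i2) -RintegralZl//; last exact: (integrableB measurableT i1 i2).
  apply: eq_Rintegral => x _.
  under eq_bigr do rewrite dsq.
  rewrite -mulr_sumr.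
  have -> : \sum_(i < n) x ord0 i ^+ 2 = omega x - 1 by rewrite /omega addrC addKr.
  have -> : omega x `^ (- (beta - 2 * g)) = omega x * omega x `^ (- (beta - 2 * g + 1)).
    by rewrite -omega_mul; congr (_ `^ _); ring.
  have -> : omega x `^ (- (beta - 2 * g + 1)) = omega x `^ (2 * (g - 1)) * omega x `^ (1 - beta).
    by rewrite (powR_mul _ _ (omega_gt0 x)); congr (_ `^ _); ring.
  by move: (omega x) (omega x `^ _) => u v; ring.
by [].
Qed.

(** The trial function is [omega], the case g = 1, square integrable because beta > n/2 + 2; the
    recurrence expresses all integrals through one of them, which cancels. *)
Lemma spectral_gap_le_middle : n%:R / 2 + 2 < beta ->
  (spectral_gap n beta <= (4 * (beta - n%:R / 2 - 1))%:E)%E.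
Proof.
move=> b2.
have d0 : 0 < beta - n%:R / 2 - 2 * 1 by move: b2; lra.
have n1 : n%:R / 2 < beta - 2 by move: b2; lra.
have n1' : n%:R / 2 < beta - 1 by move: b2; lra.
have p1 : 0 < beta - 2 by move: (n2R) b2; lra.
have p2 : 0 < beta - 1 by move: (n2R) b2; lra.
have p3 : 0 < beta - n%:R / 2 - 1 by move: b2; lra.
have p4 : 0 < beta - n%:R / 2 - 2 by move: b2; lra.
have e1 := omega_powR_recurrence n1.
have e2 := omega_powR_recurrence n1'.
rewrite (_ : beta - 2 + 1 = beta - 1) in e1; last by ring.
rewrite subrK in e2.
have X0 := Rintegral_omega_powR_gt0 n2 n1.
have := @spectral_gap_le_omega 1 ltr01 d0.
rewrite mulr1 (_ : beta - 2 + 1 = beta - 1); last by ring.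
rewrite e2 e1.
move: {e1 e2} (M _) X0 => X X0.
have VE : X - ((beta - 2 - n%:R / 2) / (beta - 2) * X) ^+ 2 /
  ((beta - 1 - n%:R / 2) / (beta - 1) * ((beta - 2 - n%:R / 2) / (beta - 2) * X)) =
  n%:R / 2 * X / ((beta - 2) * (beta - n%:R / 2 - 1)).
  by field; rewrite !gt_eqF//=; lra.
rewrite VE.
have V0 : 0 < n%:R / 2 * X / ((beta - 2) * (beta - n%:R / 2 - 1)).
  by rewrite divr_gt0 ?mulr_gt0 ?invr_gt0//; move: (n2R); lra.
move=> /(_ V0) h; apply: (le_trans h); rewrite lee_fin le_eqVlt; apply/orP; left; apply/eqP.
have n0 : 0 < n%:R :> R := lt_le_trans (ltr0Sn _ 1) n2R.
by field; rewrite !gt_eqF//; move: b2; lra.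
Qed.

(** As g increases to (beta - h)/2, the recurrence forces m(beta - 2g) to blow up like 1/d with d =
    beta - h - 2g, while m(beta - g) stays bounded. The squared mean becomes negligible and the
    quotient is at most about 4 g^2, which tends to (beta - h)^2. *)
Lemma radial_quotient (m : R -> R) (h e : R) : 0 < h -> h < beta -> 0 < e ->
  (forall b, h < b -> 0 < m b) -> (forall b c, h < b -> b <= c -> m c <= m b) ->
  (forall b, h < b -> m (b + 1) = (b - h) / b * m b) ->
  exists g, [/\ 0 < g, 0 < beta - h - 2 * g,
    0 < m (beta - 2 * g) - m (beta - g) ^+ 2 / m beta &
    4 * g ^+ 2 * (m (beta - 2 * g) - m (beta - 2 * g + 1)) /
      (m (beta - 2 * g) - m (beta - g) ^+ 2 / m beta) <= (beta - h) ^+ 2 + e].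
Proof.
move=> h0 hb e0 m0 mono mS.
pose a := beta - h.
have a0 : 0 < a by rewrite subr_gt0.
have ha : a / 2 < a by move: a0; lra.
have a20 : 0 < a ^+ 2 by rewrite exprn_gt0.
have nb1 : h < beta + 1 by move: hb; lra.
have nb2 : h < beta - a / 2 by rewrite /a; move: hb; lra.
have J0 := m0 _ hb.
have P0 := m0 _ nb1.
have Q0 := m0 _ nb2.
(* Chosen so that the squared mean term is at most K d times m(beta - 2g). *)
pose K := m (beta - a / 2) ^+ 2 / (m beta * (h * m (beta + 1))).
have K0 : 0 < K.
  by apply: divr_gt0; [exact: exprn_gt0|apply: mulr_gt0 => //; exact: mulr_gt0].
(* The second bound gives K d (a^2 + e) <= e, that is (a^2 + e)(1 - K d) >= a^2, the inequality
   needed at the end. *)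
pose d := Num.min (a / 2) (e / (K * (a ^+ 2 + e))).
have ae0 : 0 < a ^+ 2 + e by rewrite addr_gt0.
have d0 : 0 < d by rewrite lt_min !divr_gt0// mulr_gt0.
have da : d <= a / 2 by rewrite ge_min lexx.
have dK : K * d * (a ^+ 2 + e) <= e.
  have : d <= e / (K * (a ^+ 2 + e)) by rewrite ge_min lexx orbT.
  rewrite ler_pdivlMr; last exact: mulr_gt0.
  apply: le_trans.
  by rewrite le_eqVlt; apply/orP; left; apply/eqP; ring.
pose g := (a - d) / 2.
have da1 : d < a := le_lt_trans da ha.
have g0 : 0 < g by rewrite divr_gt0// subr_gt0.
have dE : beta - h - 2 * g = d by rewrite -/a /g; field.
have d0' : 0 < beta - h - 2 * g by rewrite dE.
have ng : h < beta - 2 * g by rewrite -subr_gt0 addrAC.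
have ng1 : h < beta - 2 * g + 1 by rewrite (lt_trans ng)// ltrDl.
have ngg : h < beta - g.
  by rewrite (lt_trans ng)// ltrD2l ltrN2 mulr_natl mulr2n ltrDl.
have A0 := m0 _ ng.
have A10 := m0 _ ng1.
have B0 := m0 _ ngg.
have Bm : m (beta - g) <= m (beta - a / 2) by apply: mono => //; rewrite lerD2l lerN2 ler_pM2r ?invr_gt0// gerBl ltW.
(* The quantitative blow-up: by the recurrence d m(beta - 2g) = (beta - 2g) m(beta - 2g + 1), which
   is bounded below since m is nonincreasing. *)
have Am : h * m (beta + 1) <= d * m (beta - 2 * g).
  have mE := mS _ ng.
  have bg0 : 0 < beta - 2 * g := lt_trans h0 ng.
  have h1 : (beta - 2 * g) * m (beta - 2 * g + 1) = d * m (beta - 2 * g).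
    rewrite mE -dE; field; rewrite gt_eqF//.
  rewrite -h1; apply: ler_pM; rewrite ?(ltW h0) ?(ltW P0) ?(ltW ng)//.
  by apply: mono => //; rewrite lerD2r gerBl mulr_ge0// ltW.
have BA : m (beta - g) ^+ 2 / m beta <= K * d * m (beta - 2 * g).
  rewrite ler_pdivrMr//.
  apply: (@le_trans _ _ (m (beta - a / 2) ^+ 2)).
    by rewrite lerXn2r// nnegrE ltW.
  have -> : m (beta - a / 2) ^+ 2 = K * m beta * (h * m (beta + 1)).
    rewrite /K;     by field; rewrite !gt_eqF//; rewrite ltr0n; case: (n) n2.
  rewrite [leRHS](_ : _ = K * m beta * (d * m (beta - 2 * g))); last by ring.
  by rewrite ler_wpM2l// mulr_ge0// ltW.
have Kd1 : K * d < 1.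
  rewrite -(ltr_pM2r ae0) mul1r; apply: (le_lt_trans dK).
  by rewrite ltrDr.
have VA : (1 - K * d) * m (beta - 2 * g) <= m (beta - 2 * g) - m (beta - g) ^+ 2 / m beta.
  by rewrite mulrBl mul1r lerD2l lerN2.
have V0 : 0 < m (beta - 2 * g) - m (beta - g) ^+ 2 / m beta.
  by apply: lt_le_trans VA; rewrite mulr_gt0// subr_gt0.
exists g; split=> //; rewrite ler_pdivrMr// -/a.
apply: (@le_trans _ _ ((a ^+ 2 + e) * ((1 - K * d) * m (beta - 2 * g)))); last first.
  by rewrite ler_wpM2l// ltW.
have g2 : 4 * g ^+ 2 <= a ^+ 2.
  have -> : 4 * g ^+ 2 = (a - d) ^+ 2 by rewrite /g; field.
  by rewrite lerXn2r ?nnegrE ?(ltW a0) ?subr_ge0 ?(ltW da1)// gerBl ltW.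
apply: (@le_trans _ _ (a ^+ 2 * m (beta - 2 * g))).
  apply: ler_pM => //; first by rewrite mulr_ge0// sqr_ge0.
    by rewrite subr_ge0; apply: mono => //; rewrite lerDl.
  by rewrite gerBl ltW.
rewrite [leRHS]mulrA ler_wpM2r ?(ltW A0)//.
by rewrite mulrBr mulr1 -addrA lerDl subr_ge0 mulrC.
Qed.

Lemma spectral_gap_le_low : (spectral_gap n beta <= ((beta - n%:R / 2) ^+ 2)%:E)%E.
Proof.
apply/lee_addgt0Pr => e e0.
have h0 : 0 < n%:R / 2 :> R by move: (n2R); lra.
have mono b c : n%:R / 2 < b -> b <= c -> M c <= M b.
  move=> b0 bc; apply: le_Rintegral => //.
  - by apply: integrable_omega_powR => //; exact: lt_le_trans bc.
  - exact: integrable_omega_powR.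
  - by move=> x _; rewrite ler_powR ?omega_ge1// lerN2.
have [g [g0 d0 V0 gE]] := radial_quotient h0 nb e0 (fun b => @Rintegral_omega_powR_gt0 R n n2 b)
  mono omega_powR_recurrence.
by apply: (le_trans (spectral_gap_le_omega g0 d0 V0)); rewrite -EFinD lee_fin.
Qed.

End spectral_gap_upper_bound.

(** * The spectral gap in the three regimes *)

Theorem corollary4p13 (R : realType) (n : nat) (beta : R) :
  (2 <= n)%N -> n%:R / 2 < beta ->
  [/\ n%:R / 2 < beta <= n%:R / 2 + 2 ->
        spectral_gap n beta = ((beta - n%:R / 2) ^+ 2)%:E,
      n%:R / 2 + 2 <= beta <= n%:R + 1 ->
        spectral_gap n beta = (4 * (beta - n%:R / 2 - 1))%:E
    & n%:R + 1 <= beta ->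
        spectral_gap n beta = (2 * (beta - 1))%:E].
Proof.
move=> n2 nb; have n2R : 2 <= n%:R :> R by rewrite ler_nat.
split=> [/andP[_ b2]|/andP[b2 b3]|b3]; apply/eqP; rewrite eq_le; apply/andP; split.
- exact: spectral_gap_le_low.
- exact: spectral_gap_ge_low.
(* At beta = n/2 + 2 exactly [omega] is no longer square integrable; there the bound a^2 is used
   instead, and a = 2 gives a^2 = 4(a - 1). *)
- have [b4|b4] := ltP (n%:R / 2 + 2) beta; first exact: spectral_gap_le_middle.
  have bE : n%:R / 2 + 2 = beta by apply/le_anti; rewrite b2.
  have := spectral_gap_le_low n2 nb.
  by rewrite (_ : (beta - n%:R / 2) ^+ 2 = 4 * (beta - n%:R / 2 - 1))// -bE; field.
- by apply: spectral_gap_ge_high => //; lra.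
- exact: spectral_gap_le_coord.
- by apply: spectral_gap_ge_high => //; lra.
Qed.
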